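(* Let $s\ge 1$ and let $M\subset\mathbb{C}^n$ be a totally real submanifold of Gevrey class $G^s$. If $\dim M=m$ and $ms<n$, then $M$ is pluripolar.
   Context: A set $E\subset\mathbb{C}^n$ is called pluripolar if there exists a non-constant plurisubharmonic function $\phi$ on $\mathbb{C}^n$ such that $\phi\equiv-\infty$ on $E$. Gevrey class: let $U\subset\mathbb{R}^d$ be open and $s\ge 1$. A function $f\in C^\infty(U)$ belongs to the Gevrey class $G^s(U)$ if for every compact $K\subset U$ there is a constant $C_K>0$ such that $\sup_{x\in K}|\partial^\alpha f(x)|\le C_K^{|\alpha|+1}(\alpha!)^s$ for every multi-index $\alpha$, where $|\alpha|=\sum_j\alpha_j$ and $\alpha!=\prod_j\alpha_j!$. The class $G^s$ is closed under composition and the Implicit Function Theorem holds in it, so (sub)manifolds of class $G^s$ are defined in the usual way: a real $m$-dimensional submanifold $M$ of $\mathbb{C}^n\cong\mathbb{R}^{2n}$ is of class $G^s$ if near each of its points it is the common zero set of $2n-m$ real-valued functions of class $G^s$ with linearly independent differentials (equivalently, it is locally a graph of a $G^s$ map over an open subset of an $m$-dimensional real coordinate subspace). $\dim M$ is the real dimension of $M$. A submanifold $M\subset\mathbb{C}^n$ is totally real if for every $p\in M$ the tangent space $T_pM$ contains no complex line. *)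

(* Defs.v *)
From HB Require Import structures.
From mathcomp Require Import all_boot all_order all_algebra.
From mathcomp Require Import all_classical all_reals all_analysis.
From mathcomp Require Import complex.
Set Implicit Arguments.
Unset Strict Implicit.
Unset Printing Implicit Defensive.
Import Order.TTheory GRing.Theory Num.Theory.
Import numFieldNormedType.Exports.
Local Open Scope classical_set_scope.
Local Open Scope complex_scope.
Local Open Scope ring_scope.

(* The library's topology on a numClosedFieldType is attached to the abstract
   carrier only; this transports it to the concrete type R[i]. *)
#[non_forgetful_inheritance]
HB.instance Definition _ (R : realType) := NormedModule.copy R[i] (R[i])^o.

Definition pderivs (R : realType) (d : nat) (js : seq 'I_d)
    (f : 'rV[R]_d -> R) : 'rV[R]_d -> R :=
  foldr (fun j g x => 'D_(delta_mx 0 j) g x) f js.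

(* Smoothness through iterated partial derivatives: 'D is a total operator, so
   existence of every partial derivative has to be required separately.
   As U is open, only the values of f on U matter. *)
Definition smooth_on (R : realType) (d : nat) (U : set 'rV[R]_d)
    (f : 'rV[R]_d -> R) : Prop :=
  forall (js : seq 'I_d) (x : 'rV[R]_d), U x ->
    {for x, continuous (pderivs js f)} /\
    forall j : 'I_d, derivable (pderivs js f) x (delta_mx 0 j).

Definition mderiv (R : realType) (d : nat) (alpha : 'I_d -> nat)
    (f : 'rV[R]_d -> R) : 'rV[R]_d -> R :=
  pderivs (flatten [seq nseq (alpha j) j | j <- enum 'I_d]) f.

Definition gevrey (R : realType) (d : nat) (s : R) (U : set 'rV[R]_d)
    (f : 'rV[R]_d -> R) : Prop :=
  smooth_on U f /\
  forall K : set 'rV[R]_d, compact K -> K `<=` U ->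
    exists2 C : R, 0 < C &
      forall (alpha : 'I_d -> nat) (x : 'rV[R]_d), K x ->
        `|mderiv alpha f x| <=
          C ^+ (\sum_(j < d) alpha j)%N.+1
          * ((\prod_(j < d) (alpha j)`!)%N%:R `^ s).

Definition realify (R : realType) (n : nat) (z : 'rV[R[i]]_n) :
    'rV[R]_(n + n) :=
  row_mx (map_mx (fun w : R[i] => complex.Re w) z) (map_mx (fun w : R[i] => complex.Im w) z).

Definition jacobian_mx (R : realType) (d k : nat)
    (rho : 'I_k -> 'rV[R]_d -> R) (x : 'rV[R]_d) : 'M[R]_(k, d) :=
  \matrix_(i < k, j < d) 'D_(delta_mx 0 j) (rho i) x.

(* The rows of the Jacobian matrix are the differentials of the rho i, so
   row_free says that these are linearly independent. *)
Definition gevrey_submanifold (R : realType) (n : nat) (s : R) (m : nat)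
    (M : set 'rV[R[i]]_n) : Prop :=
  (m <= n + n)%N /\
  forall p : 'rV[R[i]]_n, M p ->
    exists (U : set 'rV[R]_(n + n))
           (rho : 'I_(n + n - m) -> 'rV[R]_(n + n) -> R),
      [/\ open U,
          U (realify p),
          forall k, gevrey s U (rho k),
          forall x, U x -> row_free (jacobian_mx rho x) &
          forall z, U (realify z) -> (M z <-> forall k, rho k (realify z) = 0)].

(* T_p M as the set of velocities at p of curves lying in M. *)
Definition tangent_space (R : realType) (n : nat) (M : set 'rV[R[i]]_n)
    (p : 'rV[R[i]]_n) : set 'rV[R[i]]_n :=
  [set v | exists gamma : R -> 'rV[R[i]]_n,
    [/\ gamma 0 = p,
        \forall t \near (0 : R), M (gamma t) &
        is_derive (0 : R) (1 : R) (fun t => realify (gamma t)) (realify v)]].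

Definition totally_real (R : realType) (n : nat) (M : set 'rV[R[i]]_n) : Prop :=
  forall p, M p ->
    ~ exists2 v : 'rV[R[i]]_n, v != 0 &
        forall c : R[i], tangent_space M p (c *: v).

Definition upper_semicontinuous (R : realType) (T : topologicalType)
    (u : T -> \bar R) : Prop :=
  forall (x : T) (a : R), (u x < a%:E)%E -> \forall y \near x, (u y < a%:E)%E.

(* Subharmonic on the whole complex plane; the function constantly -oo is
   allowed.  The integrand is bounded above on the circle, hence the integral
   is either finite or -oo. *)
Definition subharmonic (R : realType) (u : R[i] -> \bar R) : Prop :=
  [/\ upper_semicontinuous u,
      forall z, (u z < +oo)%E &
      forall (c : R[i]) (r : R), 0 < r ->
        (u c <= ((2 * pi)^-1)%:E *
          \int[lebesgue_measure]_(t in `[0%R, (2 * pi)%R])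
             u (c + r%:C * (cos t +i* sin t))%R)%E].

Definition plurisubharmonic (R : realType) (n : nat)
    (phi : 'rV[R[i]]_n -> \bar R) : Prop :=
  [/\ upper_semicontinuous phi,
      forall z, (phi z < +oo)%E &
      forall a b : 'rV[R[i]]_n, subharmonic (fun w : R[i] => phi (a + w *: b))].

Definition pluripolar (R : realType) (n : nat) (E : set 'rV[R[i]]_n) : Prop :=
  exists phi : 'rV[R[i]]_n -> \bar R,
    [/\ plurisubharmonic phi,
        ~ (exists c, forall z, phi z = c) &
        forall z, E z -> phi z = -oo%E].

(* Main.v *)
Require Import Defs.
From HB Require Import structures.
From mathcomp Require Import all_boot all_order all_algebra.
From mathcomp Require Import all_classical all_reals all_analysis.
From mathcomp Require Import complex measurable_realfun zify ring lra.
Set Implicit Arguments.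
Unset Strict Implicit.
Unset Printing Implicit Defensive.
Import Order.TTheory GRing.Theory Num.Theory.
Import numFieldNormedType.Exports.
Local Open Scope classical_set_scope.
Local Open Scope complex_scope.
Local Open Scope ring_scope.

(** Call a set thin if, for every [A], some polynomial [P] of degree less than
    [N] in each variable, whose largest coefficient has modulus one, satisfies
    [|P| <= e ^ (- A N)] on it.  The proof has two halves.

    A countable union of thin sets is pluripolar ([thin_bigcup_pluripolar]).  The
    functions [N^-1 log|P|] have a common majorant, and on a given ball none of
    them is very negative everywhere, because the coefficients of [P] can be
    recovered from its values by interpolation ([coef_le_sup]).  Baire's theorem
    therefore provides a point at which they stay above a suitable bound, for a
    suitable choice of polynomials, and a weighted series of the [log|P|]
    converges there while it equals [-oo] on the thin sets.  That [log|P|] has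
    the sub-mean value property is obtained from the product of the values of a
    polynomial over the vertices of a regular polygon ([polygon_points]).

    A submanifold of class [G^s] of dimension [m] with [m s < n] is locally thin
    ([thin_piece], [locally_thin]).  Truncated at order [N], the Taylor series of
    a function of class [G^s] has coefficients bounded by [C ^ |alpha|] times
    [N ^ ((s - 1) |alpha|)], as those of an analytic function would be in balls of
    radius about [N ^ (- (s - 1))].  Hence, over a cell of diameter a small
    multiple [theta] of this radius, solving the equations of the submanifold by
    iteration expresses its points, up to an error [(C theta) ^ N], as polynomials
    of degree less than [N] in at most [m] real parameters.  There are about
    [N ^ ((s - 1) m)] cells, and the vanishing of the polynomial that approximates
    [P] over a cell amounts to [N ^ m] linear conditions on [P]: in all about
    [N ^ (m s)] conditions on [N ^ n] coefficients.  For large [N] a nonzero [P]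
    satisfies them, and [theta] is at disposal to make [P] as small as required.

    Countably many boxes then cover the submanifold. *)

(** * Moduli of complex numbers and polynomials in several variables *)

Section ComplexModulus.
Variable R : realType.
Implicit Types z w : R[i].

Definition cabs z : R := Normc.normc z.

Lemma cabsE z : cabs z = Num.sqrt (complex.Re z ^+ 2 + complex.Im z ^+ 2).
Proof. by case: z. Qed.

Lemma cabs0 : cabs 0 = 0. Proof. exact: Normc.normc0. Qed.

Lemma cabs1 : cabs 1 = 1. Proof. exact: Normc.normc1. Qed.

Lemma cabs_ge0 z : 0 <= cabs z. Proof. by rewrite cabsE sqrtr_ge0. Qed.

Lemma cabs_eq0 z : (cabs z == 0) = (z == 0).
Proof.
by apply/eqP/eqP => [/Normc.eq0_normc//|->]; rewrite cabs0.
Qed.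

Lemma cabs_gt0 z : (0 < cabs z) = (z != 0).
Proof. by rewrite lt_def cabs_eq0 cabs_ge0 andbT. Qed.

Lemma cabsM z w : cabs (z * w) = cabs z * cabs w.
Proof. exact: Normc.normcM. Qed.

Lemma cabsV z : cabs z^-1 = (cabs z)^-1.
Proof. exact: Normc.normcV. Qed.

Lemma cabsD z w : cabs (z + w) <= cabs z + cabs w.
Proof. exact: le_normcD. Qed.

Lemma cabsN z : cabs (- z) = cabs z.
Proof. exact: normcN. Qed.

Lemma cabsB z w : cabs (z - w) <= cabs z + cabs w.
Proof. by rewrite -(cabsN w) cabsD. Qed.

Lemma cabs_distC z w : cabs (z - w) = cabs (w - z).
Proof. by rewrite -cabsN opprB. Qed.

Lemma cabsX z k : cabs (z ^+ k) = cabs z ^+ k.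
Proof. by elim: k => [|k IH]; rewrite ?cabs1// !exprS cabsM IH. Qed.

Lemma cabs_real (x : R) : cabs x%:C = `|x|.
Proof. by rewrite cabsE /= expr0n addr0 sqrtr_sqr. Qed.

Lemma cabs_i : cabs 'i = 1.
Proof. by rewrite cabsE /= expr0n add0r expr1n sqrtr1. Qed.

Lemma cabs_nat k : cabs k%:R = k%:R.
Proof. by rewrite -[k%:R](rmorph_nat (real_complex R)) cabs_real normr_nat. Qed.

Lemma cabs_sum (I : Type) (r : seq I) (P : pred I) (F : I -> R[i]) :
  cabs (\sum_(i <- r | P i) F i) <= \sum_(i <- r | P i) cabs (F i).
Proof.
elim/big_ind2: _ => [|a x b y ax by_|//]; first by rewrite cabs0.
by rewrite (le_trans (cabsD _ _))// lerD.
Qed.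

Lemma cabs_prod (I : Type) (r : seq I) (P : pred I) (F : I -> R[i]) :
  cabs (\prod_(i <- r | P i) F i) = \prod_(i <- r | P i) cabs (F i).
Proof. by elim/big_ind2: _ => [|_ x _ y <- <-|//]; rewrite ?cabs1 ?cabsM. Qed.

Lemma normc_cabs z : `|z| = (cabs z)%:C.
Proof. by rewrite normc_def cabsE. Qed.

Lemma cabs_Re z : `|complex.Re z| <= cabs z.
Proof. by rewrite cabsE -sqrtr_sqr ler_wsqrtr // lerDl sqr_ge0. Qed.

Lemma cabs_Im z : `|complex.Im z| <= cabs z.
Proof. by rewrite cabsE -sqrtr_sqr ler_wsqrtr // lerDr sqr_ge0. Qed.

Definition expi (t : R) : R[i] := (cos t +i* sin t)%C.

Lemma expi0 : expi 0 = 1.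
Proof. by rewrite /expi cos0 sin0. Qed.

Lemma expiD s t : expi (s + t) = expi s * expi t.
Proof.
rewrite /expi cosD sinD; apply/eqP; rewrite eq_complex /=.
by rewrite eqxx /= addrC [sin s * _]mulrC.
Qed.

Lemma cabs_expi t : cabs (expi t) = 1.
Proof. by rewrite cabsE /= cos2Dsin2 sqrtr1. Qed.

Lemma expiMn t k : expi (t *+ k) = expi t ^+ k.
Proof.
by elim: k => [|k IH]; rewrite ?mulr0n ?expi0// mulrS exprS expiD IH.
Qed.

Lemma expi2pi : expi (2 * pi) = 1.
Proof. by rewrite /expi mulr_natl cos2pi sin2pi. Qed.

Lemma expi_eq1 t : 0 < t -> t < 2 * pi -> expi t != 1.
Proof.
move=> t0 t2; apply/negP => /eqP [ct _].
have: 0 < sin (t / 2).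
  by apply: sin_gt0_pi; apply/andP; split; lra.
have : cos (t / 2 *+ 2) = 1 by rewrite -mulr_natr mulfVK ?pnatr_eq0.
rewrite cos_mulr2n => c1 s0; have := cos2Dsin2 (t / 2).
suff : 0 < sin (t / 2) ^+ 2 by lra.
by rewrite exprn_gt0.
Qed.

(** The angle of the primitive [D]-th root of unity. *)
Definition unitangle (D : nat) : R := 2 * pi / D%:R.

Lemma unitangle_gt0 D : (0 < D)%N -> 0 < unitangle D.
Proof. by move=> D0; rewrite divr_gt0 ?ltr0n// mulr_gt0// pi_gt0. Qed.

Lemma unitangleMn D : (0 < D)%N -> unitangle D *+ D = 2 * pi.
Proof. by move=> D0; rewrite -[LHS]mulr_natr /unitangle divfK// pnatr_eq0 -lt0n. Qed.

Lemma expi_unitangle D : (0 < D)%N -> expi (unitangle D) ^+ D = 1.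
Proof. by move=> D0; rewrite -expiMn unitangleMn// expi2pi. Qed.

Lemma expi_unitangle_neq1 D k : (0 < k < D)%N ->
  expi (unitangle D) ^+ k != 1.
Proof.
move=> /andP[k0 kD]; have D0 : (0 < D)%N by apply: leq_trans kD.
rewrite -expiMn; apply: expi_eq1.
  by rewrite pmulrn_lgt0 ?unitangle_gt0.
by rewrite -(unitangleMn D0) ltr_pMn2l ?unitangle_gt0.
Qed.

Lemma sum_unitroots D k : (0 < k < D)%N ->
  \sum_(l < D) (expi (unitangle D) ^+ l) ^+ k = 0.
Proof.
move=> kD; have /andP[k0 lkD] := kD.
have D0 : (0 < D)%N by apply: leq_trans lkD.
have := subrX1 (expi (unitangle D) ^+ k) D.
rewrite -exprM mulnC exprM expi_unitangle// expr1n subrr.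
move/esym/eqP; rewrite mulf_eq0 subr_eq0 (negPf (expi_unitangle_neq1 kD))/=.
move=> /eqP s0; rewrite -[RHS]s0; apply: eq_bigr => l _.
by rewrite -!exprM mulnC.
Qed.

(** The mean value property over the vertices of a regular polygon: the
    monomials of degree between [1] and [D - 1] average out. *)
Lemma mean_unitroots (q : {poly R[i]}) (D : nat) (u : R[i]) :
  (0 < D)%N -> (size q <= D)%N ->
  \sum_(l < D) q.[u * expi (unitangle D) ^+ l] = q.[0] *+ D.
Proof.
move=> D0 sq.
under eq_bigr do rewrite (horner_coef_wide _ sq).
rewrite exchange_big /=; case: D D0 sq => // D _ sq.
rewrite big_ord_recl [X in _ + X]big1 => [|k _].
  rewrite addr0 (eq_bigr (fun=> q.[0])) ?sumr_const ?card_ord// => l _.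
  by rewrite expr0 mulr1 horner_coef0.
under eq_bigr do rewrite exprMn mulrA.
by rewrite -mulr_sumr sum_unitroots ?mulr0// -[D.+1]/(1 + D)%N ltn_add2l ltn_ord.
Qed.

Lemma max_unitroots (q : {poly R[i]}) (D : nat) (u : R[i]) :
  (0 < D)%N -> (size q <= D)%N ->
  exists l : 'I_D, cabs q.[0] <= cabs q.[u * expi (unitangle D) ^+ l].
Proof.
move=> D0 sq; apply/existsP; apply: contraT; rewrite negb_exists => /forallP h.
suff : cabs (q.[0] *+ D) < cabs q.[0] *+ D.
  by rewrite -mulr_natr cabsM cabs_nat mulr_natr ltxx.
rewrite -(mean_unitroots u D0 sq) (le_lt_trans (cabs_sum _ _ _))//.
rewrite -[in ltRHS](card_ord D) -sumr_const ltr_sum//.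
- by apply/hasP; exists (Ordinal D0) => //; rewrite mem_index_enum.
- by move=> l _; rewrite ltNge h.
Qed.

End ComplexModulus.

Section Polynomials.
Variables (R : realType) (n : nat).
Implicit Types z a b : 'rV[R[i]]_n.

(** The degree is bounded in each variable separately: the exponents then form
    a product, over which interpolation in one variable can be tensored. *)
Definition peval N (c : {ffun 'I_n -> 'I_N} -> R[i]) z : R[i] :=
  \sum_(beta : {ffun 'I_n -> 'I_N}) c beta * \prod_i z 0 i ^+ beta i.

(** A common majorant of the functions [N^-1 log|P|], for [P] of degree less
    than [N] in each variable with coefficients in the unit disc. *)
Definition growth z : R := n%:R + \sum_i cabs (z 0 i).

Lemma growth_ge0 z : 0 <= growth z.
Proof. by rewrite addr_ge0// sumr_ge0// => i _; rewrite cabs_ge0. Qed.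

Lemma natr_le_expR (k : nat) : k%:R <= expR k%:R :> R.
Proof. by rewrite (le_trans _ (expR_ge1Dx _))// lerDr. Qed.

Lemma peval_le N (c : {ffun 'I_n -> 'I_N} -> R[i]) z :
  (forall beta, cabs (c beta) <= 1) ->
  cabs (peval c z) <= expR (N%:R * growth z).
Proof.
move=> c1; apply: (le_trans (cabs_sum _ _ _)).
have h beta : true -> cabs (c beta * \prod_i z 0 i ^+ beta i) <=
    expR (N%:R * \sum_i cabs (z 0 i)).
  move=> _; rewrite cabsM -[leRHS]mul1r ler_pM ?cabs_ge0//.
  rewrite cabs_prod mulr_sumr expR_sum; apply: ler_prod => i _.
  rewrite cabs_ge0 cabsX [_ * cabs _]mulrC expRM_natr /=.
  have e1 : 1 <= expR (cabs (z 0 i)) by rewrite -expR0 ler_expR cabs_ge0.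
  apply: (@le_trans _ _ (expR (cabs (z 0 i)) ^+ beta i)).
    rewrite lerXn2r ?nnegrE ?cabs_ge0 ?expR_ge0//.
    by rewrite (le_trans _ (expR_ge1Dx _))// lerDr.
  by rewrite ler_weXn2l// ltnW.
apply: (le_trans (ler_sum _ h)).
rewrite sumr_const card_ffun !card_ord -[_ *+ (_ ^ _)]mulr_natl natrX mulrDr expRD ler_pM//.
by rewrite expRM_natr lerXn2r ?nnegrE ?expR_ge0// natr_le_expR.
Qed.

Lemma peval_line N (c : {ffun 'I_n -> 'I_N} -> R[i]) a b :
  exists p : {poly R[i]}, forall w, p.[w] = peval c (a + w *: b).
Proof.
exists (\sum_(beta : {ffun 'I_n -> 'I_N}) (c beta)%:P *
   \prod_i ((a 0 i)%:P + (b 0 i)%:P * 'X) ^+ beta i) => w.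
rewrite horner_sum; apply: eq_bigr => beta _.
rewrite hornerM hornerC; congr (_ * _).
rewrite horner_prod; apply: eq_bigr => i _.
by rewrite !hornerE !mxE mulrC.
Qed.

End Polynomials.

Section ContinuousComplex.
Variables (R : realType) (T : topologicalType).
Implicit Types f g : T -> R[i].

(** Continuity through the real and imaginary parts, so that it can be proved by
    means of the topology of the real line alone. *)
Definition ccontinuous f :=
  continuous (fun t => complex.Re (f t)) /\
  continuous (fun t => complex.Im (f t)).

Lemma ccontinuous_cst (z : R[i]) : ccontinuous (fun=> z).
Proof. by split; apply: cst_continuous. Qed.

Lemma ccontinuousD f g :
  ccontinuous f -> ccontinuous g -> ccontinuous (fun t => f t + g t).
Proof.
move=> [f1 f2] [g1 g2]; split=> t.
  have -> : (fun t => complex.Re (f t + g t)) =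
    (fun t => complex.Re (f t) + complex.Re (g t)).
    by apply/funext => s; case: (f s) (g s) => [? ?] [].
  exact: cvgD (f1 t) (g1 t).
have -> : (fun t => complex.Im (f t + g t)) =
  (fun t => complex.Im (f t) + complex.Im (g t)).
  by apply/funext => s; case: (f s) (g s) => [? ?] [].
exact: cvgD (f2 t) (g2 t).
Qed.

Lemma ccontinuousM f g :
  ccontinuous f -> ccontinuous g -> ccontinuous (fun t => f t * g t).
Proof.
move=> [f1 f2] [g1 g2]; split=> t.
  have -> : (fun t => complex.Re (f t * g t)) =
    (fun t => complex.Re (f t) * complex.Re (g t) -
       complex.Im (f t) * complex.Im (g t)).
    by apply/funext => s; case: (f s) (g s) => [? ?] [].
  exact: cvgB (cvgM (f1 t) (g1 t)) (cvgM (f2 t) (g2 t)).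
have -> : (fun t => complex.Im (f t * g t)) =
  (fun t => complex.Re (f t) * complex.Im (g t) +
     complex.Im (f t) * complex.Re (g t)).
  by apply/funext => s; case: (f s) (g s) => [? ?] [].
exact: cvgD (cvgM (f1 t) (g2 t)) (cvgM (f2 t) (g1 t)).
Qed.

Lemma ccontinuousX f k : ccontinuous f -> ccontinuous (fun t => f t ^+ k).
Proof.
move=> cf; elim: k => [|k IH]; first exact: (ccontinuous_cst 1).
under [X in ccontinuous X]funext do rewrite exprS.
exact: ccontinuousM.
Qed.

Lemma ccontinuous_sum (I : Type) (r : seq I) (F : I -> T -> R[i]) :
  (forall i, ccontinuous (F i)) -> ccontinuous (fun t => \sum_(i <- r) F i t).
Proof.
move=> cF; elim: r => [|i r IH].
  under [X in ccontinuous X]funext do rewrite big_nil.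
  exact: ccontinuous_cst.
under [X in ccontinuous X]funext do rewrite big_cons.
exact: ccontinuousD.
Qed.

Lemma ccontinuous_prod (I : Type) (r : seq I) (F : I -> T -> R[i]) :
  (forall i, ccontinuous (F i)) -> ccontinuous (fun t => \prod_(i <- r) F i t).
Proof.
move=> cF; elim: r => [|i r IH].
  under [X in ccontinuous X]funext do rewrite big_nil.
  exact: ccontinuous_cst.
under [X in ccontinuous X]funext do rewrite big_cons.
exact: ccontinuousM.
Qed.

Lemma ccontinuous_horner (p : {poly R[i]}) f :
  ccontinuous f -> ccontinuous (fun t => p.[f t]).
Proof.
move=> cf; under [X in ccontinuous X]funext do rewrite horner_coef.
apply: ccontinuous_sum => i; apply: ccontinuousM; first exact: ccontinuous_cst.
exact: ccontinuousX.
Qed.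

Lemma continuous_cabs f : ccontinuous f -> continuous (fun t => cabs (f t)).
Proof.
move=> [f1 f2] t; under [X in continuous_at _ X]funext do rewrite cabsE.
apply: (continuous_cvg _ (@sqrt_continuous _ _)).
by apply: cvgD; rewrite expr2; [exact: cvgM (f1 t) (f1 t)|exact: cvgM (f2 t) (f2 t)].
Qed.

Lemma ccontinuous_peval n N (c : {ffun 'I_n -> 'I_N} -> R[i])
    (z : T -> 'rV[R[i]]_n) :
  (forall i, ccontinuous (fun t => z t 0 i)) ->
  ccontinuous (fun t => peval c (z t)).
Proof.
move=> cz; apply: ccontinuous_sum => beta.
apply: ccontinuousM; first exact: ccontinuous_cst.
by apply: ccontinuous_prod => i; apply: ccontinuousX.
Qed.

Lemma continuous_sumr (I : Type) (r : seq I) (F : I -> T -> R) :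
  (forall i, continuous (F i)) -> continuous (fun t => \sum_(i <- r) F i t).
Proof.
move=> cF; elim: r => [|i r IH].
  under [X in continuous X]funext do rewrite big_nil.
  exact: cst_continuous.
under [X in continuous X]funext do rewrite big_cons.
by move=> t; apply: cvgD; [exact: cF|exact: IH].
Qed.

Lemma continuous_growth n (z : T -> 'rV[R[i]]_n) :
  (forall i, ccontinuous (fun t => z t 0 i)) ->
  continuous (fun t => growth (z t)).
Proof.
move=> cz t; apply: cvgD; first exact: cvg_cst.
by apply: (@continuous_sumr _ _ (fun i t => cabs (z t 0 i))) => i;
  exact: continuous_cabs.
Qed.

End ContinuousComplex.

Lemma ccontinuous_expi (R : realType) : ccontinuous (@expi R).
Proof. by split; [exact: continuous_cos|exact: continuous_sin]. Qed.

(** * The logarithm of the modulus of a polynomial is subharmonic *)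

Section CircleMean.
Variable R : realType.
Local Notation mu := (@lebesgue_measure R).

Lemma heine (f : R -> R) (a b e : R) : continuous f -> 0 < e ->
  exists2 d : R, 0 < d & forall x y, a <= x <= b -> `|x - y| < d ->
    `|f x - f y| < e.
Proof.
move=> cf e0.
have /compact_near_coveringP /(_ R 0^'+
    (fun d x => forall y, `|x - y| < d -> `|f x - f y| < e)) :=
  @segment_compact R a b.
case.
  move=> x _.
  have /cvgrPdist_lt /(_ (e / 2)) := cf x.
  rewrite divr_gt0// => /(_ isT) /nbhs_ballP [d /= d0 hd].
  exists (ball x (d / 2), [set d' | 0 < d' < d / 2]).
    split=> /=; first by apply: nbhsx_ballx; rewrite divr_gt0.
    near=> d'; apply/andP; split; near: d'; first exact: nbhs_right_gt.
    by apply: nbhs_right_lt; rewrite divr_gt0.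
  move=> [x' d'] [/= xx' /andP[_ d'd]] y x'y.
  have h1 : `|f x - f x'| < e / 2.
    by apply: hd; rewrite /ball/= (lt_trans xx')// ltr_pdivrMr// ltr_pMr// ltr1n.
  have h2 : `|f x - f y| < e / 2.
    apply: hd; rewrite /ball/= -(subrK x' x) -addrA (le_lt_trans (ler_normD _ _))//.
    by rewrite [ltRHS](splitr d) ltrD// (lt_trans x'y).
  rewrite -(subrK (f x) (f x')) -addrA (le_lt_trans (ler_normD _ _))//.
  by rewrite [ltRHS](splitr e) ltrD// distrC.
move=> d /= d0 hd; exists (d / 2); first by rewrite divr_gt0.
move=> x y xab; apply: (hd (d / 2)) => /=.
- by rewrite sub0r normrN gtr0_norm ?divr_gt0// ltr_pdivrMr// ltr_pMr// ltr1n.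
- by rewrite divr_gt0.
- by rewrite in_itv.
Unshelve. all: by end_near. Qed.

(** Riemann sums with arbitrary sample points bound the integral from below:
    on each arc the integral is attained, by the mean value theorem applied to
    a primitive, and Heine's theorem compares the two values. *)
Lemma riemann_lower_bound (q : R -> R) (v : R) : continuous q ->
  (forall K, (0 < K)%N -> exists t : nat -> R,
     (forall k, unitangle R K *+ k <= t k <= unitangle R K *+ k.+1) /\
     v *+ K <= \sum_(k < K) q (t k)) ->
  2 * pi * v <= \int[mu]_(t in `[0, 2 * pi]) q t.
Proof.
move=> cq hK.
have pi20 : 0 < 2 * pi :> R by rewrite mulr_gt0 ?pi_gt0.
have iq a b : mu.-integrable `[a, b] (EFin \o q).
  apply: continuous_compact_integrable; first exact: segment_compact.
  by apply: continuous_subspaceT.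
pose F (x : R) : R := \int[mu]_(t in `[-1, x]) q t.
have dF (x : R) : 0 <= x -> is_derive x 1 F (q x).
  move=> x0; have [|||dFx Fx] := @continuous_FTC1_closed R q (-1) x (x + 1) _ (iq _ _).
  - by rewrite ltrDl.
  - by lra.
  - exact: cq.
  by apply: DeriveDef dFx _; rewrite -derive1E Fx.
have -> : \int[mu]_(t in `[0, 2 * pi]) q t = F (2 * pi) - F 0.
  rewrite /F Rintegral_itvB//; last 2 first.
  - by rewrite bnd_simp; lra.
  - by rewrite bnd_simp; lra.
  rewrite Rintegral_itv_obnd_cbnd//; apply: integrableS (iq 0 (2 * pi)) => //.
  exact: subset_itv_oc_cc.
apply/ler_addgt0Pr => /= e e0.
have [d d0 hd] := @heine q 0 (2 * pi) (e / (2 * pi)) cq (divr_gt0 e0 pi20).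
have [K K0 Kd] : exists2 K, (0 < K)%N & unitangle R K < d.
  exists (Num.truncn (2 * pi / d)).+1 => //.
  by rewrite /unitangle ltr_pdivrMr// [d * _]mulrC -ltr_pdivrMr// truncnS_gt.
have [t [ht sumt]] := hK K K0.
set h := unitangle R K in Kd ht sumt *.
have h0 : 0 < h by exact: unitangle_gt0.
have hK2 : h *+ K = 2 * pi by exact: unitangleMn.
have step k : (k < K)%N ->
    h * (q (t k) - e / (2 * pi)) <= F (h *+ k.+1) - F (h *+ k).
  move=> kK; have hk0 : 0 <= h *+ k by rewrite mulrn_wge0// ltW.
  have [|||s] := @MVT_segment R F q (h *+ k) (h *+ k.+1).
  - by rewrite mulrS lerDr ltW.
  - move=> x; rewrite in_itv/= => /andP[kx _]; apply: dF.
    by rewrite (le_trans hk0)// ltW.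
  - apply: continuous_in_subspaceT => x; rewrite inE/= in_itv/= => /andP[kx _].
    have [dFx _] := dF x (le_trans hk0 kx).
    by apply: differentiable_continuous; apply/derivable1_diffP.
  rewrite in_itv/= => /andP[ks sk] ->.
  rewrite [h *+ k.+1]mulrS addrK [leRHS]mulrC ler_pM2l//.
  have /andP[kt tk] := ht k.
  have : `|q s - q (t k)| < e / (2 * pi).
    apply: hd.
      rewrite (le_trans hk0 ks)/= (le_trans sk)// -hK2.
      by rewrite ler_pMn2l.
    rewrite (le_lt_trans _ Kd)// ler_norml; move: ks sk kt tk.
    rewrite [h *+ k.+1]mulrS => ? ? ? ?; apply/andP; split; lra.
  by rewrite ltr_norml => /andP[]; lra.
have : \sum_(k < K) h * (q (t k) - e / (2 * pi)) <= F (2 * pi) - F 0.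
  have -> : F (2 * pi) - F 0 = \sum_(k < K) (F (h *+ k.+1) - F (h *+ k)).
    by rewrite -(big_mkord xpredT (fun k => F (h *+ k.+1) - F (h *+ k)))
      telescope_sumr// hK2 mulr0n.
  by apply: ler_sum => k _; apply: step.
rewrite -mulr_sumr sumrB sumr_const card_ord mulrBr mulrnAr -mulrnAl hK2.
rewrite [2 * pi * (e / _)]mulrC divfK ?gt_eqF// => hF.
rewrite -lerBlDr (le_trans _ hF)// lerB// -hK2 mulrnAl -mulrnAr.
by rewrite ler_pM2l.
Qed.

End CircleMean.

Section Jensen.
Variable R : realType.
Local Notation mu := (@lebesgue_measure R).
Implicit Type p : {poly R[i]}.

(** The product of [p] over the vertices of a regular [K]-gon inscribed in the
    circle is a polynomial in the first vertex, whose value at the centre is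
    [p.[c] ^+ K]; by the mean value property some rotation of the polygon does
    at least as well, and rotations by multiples of the central angle may be
    discarded. *)
Lemma polygon_points p (c : R[i]) (r : R) K : (0 < K)%N ->
  exists theta : R, 0 <= theta <= unitangle R K /\
    cabs p.[c] ^+ K <=
    \prod_(k < K) cabs p.[c + r%:C * expi (theta + unitangle R K *+ k)].
Proof.
move=> K0; set zeta := expi (unitangle R K).
pose q := \prod_(k < K) (p \Po (c%:P + (r%:C * zeta ^+ k)%:P * 'X)).
have qE u : q.[u] = \prod_(k < K) p.[c + r%:C * (zeta ^+ k * u)].
  rewrite horner_prod; apply: eq_bigr => k _.
  by rewrite horner_comp !hornerE.
have q0 : q.[0] = p.[c] ^+ K.
  rewrite qE (eq_bigr (fun=> p.[c])) ?prodr_const ?card_ord// => k _.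
  by rewrite !mulr0 addr0.
have rot u : q.[zeta * u] = q.[u].
  rewrite !qE; case: K K0 @zeta @q qE q0 => // K _ zeta _ _ _.
  rewrite big_ord_recr big_ord_recl /= mulrC; congr (_ * _).
    by rewrite [zeta ^+ K * _]mulrA -exprSr expi_unitangle// expr0.
  by apply: eq_bigr => k _; rewrite /bump add1n exprSr -!mulrA.
have rotn l u : q.[zeta ^+ l * u] = q.[u].
  by elim: l u => [|l IH] u; rewrite ?expr0 ?mul1r// exprS -mulrA rot IH.
set D := (size q).+1.
have KD0 : (0 < K * D)%N by rewrite muln_gt0 K0.
have qKD : (size q <= K * D)%N.
  by rewrite (leq_trans (leqnSn _))// leq_pmull.
have [l] := max_unitroots 1 KD0 qKD.
set w := expi (unitangle R (K * D)).
have wD : w ^+ D = zeta.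
  rewrite -expiMn /zeta; congr expi.
  rewrite /unitangle natrM invfM mulrA -[LHS]mulr_natr divfK//.
  by rewrite pnatr_eq0.
rewrite mul1r (divn_eq l D) exprD mulnC exprM wD rotn q0 cabsX qE cabs_prod => h.
exists (unitangle R (K * D) *+ (l %% D)); split.
  rewrite mulrn_wge0/=; last by rewrite ltW// unitangle_gt0.
  have -> : unitangle R K = unitangle R (K * D) *+ D.
    rewrite /unitangle natrM invfM mulrA -[RHS]mulr_natr divfK//.
    by rewrite pnatr_eq0.
  by rewrite ler_pMn2l ?unitangle_gt0// ltnW// ltn_mod.
apply: (le_trans h); apply: ler_prod => k _; rewrite cabs_ge0/=.
by rewrite expiD !expiMn [zeta ^+ _ * _]mulrC.
Qed.

Lemma ccontinuous_circle (c : R[i]) (r : R) :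
  ccontinuous (fun t : R => c + r%:C * expi t).
Proof.
apply: ccontinuousD; first exact: ccontinuous_cst.
apply: ccontinuousM; first exact: ccontinuous_cst.
exact: ccontinuous_expi.
Qed.

Lemma continuous_ln_max (f g : R -> R) : continuous f -> continuous g ->
  (forall t, 0 < g t) -> continuous (fun t => ln (Num.max (f t) (g t))).
Proof.
move=> cf cg g0 t.
apply: (continuous_cvg _ (@continuous_ln _ _ _)).
  by rewrite lt_max g0 orbT.
have -> : (fun t => Num.max (f t) (g t)) =
    (fun t => (f t + g t + `|f t - g t|) / 2).
  by apply/funext => s; rewrite maxr_absE.
rewrite maxr_absE; apply: cvgM; last exact: cvg_cst.
apply: cvgD; first exact: cvgD (cf t) (cg t).
by apply: cvg_norm; exact: cvgB (cf t) (cg t).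
Qed.

(** The truncation makes the integrand continuous and can only increase it, so
    that its Riemann sums are bounded from below by [polygon_points]. *)
Lemma le_circle_mean_ln p (c : R[i]) (r : R) (g : R -> R) :
  continuous g -> (forall t, 0 < g t) -> p.[c] != 0 ->
  2 * pi * ln (cabs p.[c]) <=
  \int[mu]_(t in `[0, 2 * pi]) ln (Num.max (cabs p.[c + r%:C * expi t]) (g t)).
Proof.
move=> cg g0 pc0; have cp0 : 0 < cabs p.[c] by rewrite cabs_gt0.
apply: riemann_lower_bound.
  apply: continuous_ln_max => //; apply: continuous_cabs.
  by apply: ccontinuous_horner; exact: ccontinuous_circle.
move=> K K0; have [theta [/andP[th0 thK] hprod]] := polygon_points p c r K0.
exists (fun k => theta + unitangle R K *+ k); split.
  by move=> k; rewrite lerDr th0 mulrSr addrC lerD2l.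
have prod0 : 0 < \prod_(k < K) cabs p.[c + r%:C * expi (theta + unitangle R K *+ k)].
  by rewrite (lt_le_trans _ hprod)// exprn_gt0.
have pk0 (k : 'I_K) : 0 < cabs p.[c + r%:C * expi (theta + unitangle R K *+ k)].
  rewrite lt_def cabs_ge0 andbT; apply/negP => /eqP pk.
  by move: prod0; rewrite (bigD1 k)//= pk mul0r ltxx.
rewrite -ler_expR -lnXn// lnK ?posrE ?exprn_gt0// (le_trans hprod)// expR_sum.
apply: ler_prod => k _; rewrite cabs_ge0/= lnK ?posrE.
  by rewrite le_max lexx.
by rewrite lt_max g0 orbT.
Qed.

(** Letting the truncation level go to infinity: the sub-mean value property of
    [log|p|], in a form in which all integrands are nonnegative. *)
Lemma circle_mean_deficit p (c : R[i]) (r : R) (G : R -> R) :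
  continuous G -> (forall t, cabs p.[c + r%:C * expi t] <= expR (G t)) ->
  (\int[mu]_(t in `[0%R, (2 * pi)%R])
     ((G t)%:E - lne (cabs p.[c + r%:C * expi t])%:E) <=
   (\int[mu]_(t in `[0%R, (2 * pi)%R]) G t)%R%:E -
     (2 * pi)%:E * lne (cabs p.[c])%:E)%E.
Proof.
move=> cG hG; have pi20 : 0 < 2 * pi :> R by rewrite mulr_gt0 ?pi_gt0.
have [->|pc0] := eqVneq p.[c] 0.
  rewrite cabs0 le0_lneNy// mulrNy gtr0_sg// mul1e /=; exact: leey.
have cp0 : 0 < cabs p.[c] by rewrite cabs_gt0.
set f := fun t => cabs p.[c + r%:C * expi t].
pose lt A t : R := ln (Num.max (f t) (expR (G t - A%:R))).
pose g A t : \bar R := (G t - lt A t)%:E.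
have cE A : continuous (fun t => expR (G t - A%:R)).
  move=> t; apply: (continuous_cvg _ (@continuous_expR _ _)).
  by apply: cvgB; [exact: cG|exact: cvg_cst].
have clt A : continuous (lt A).
  apply: continuous_ln_max => //; last by move=> t; exact: expR_gt0.
  apply: continuous_cabs; apply: ccontinuous_horner.
  exact: ccontinuous_circle.
have int_cont (h : R -> R) : continuous h ->
    mu.-integrable `[0, 2 * pi] (EFin \o h).
  move=> ch; apply: continuous_compact_integrable; first exact: segment_compact.
  exact: continuous_subspaceT.
have max0 A t : 0 < Num.max (f t) (expR (G t - A%:R)).
  by rewrite lt_max expR_gt0 orbT.
have ig A : mu.-integrable `[0, 2 * pi] (g A).
  apply: (@int_cont (fun t => G t - lt A t)) => t.
  by apply: cvgB; [exact: cG|exact: clt].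
have g_ge0 A t : (0 <= g A t)%E.
  rewrite lee_fin subr_ge0 -ler_expR lnK ?posrE// ge_max hG ler_expR.
  by rewrite /= lerBlDr lerDl ler0n.
have g_homo t : {homo g^~ t : A B / (A <= B)%N >-> (A <= B)%E}.
  move=> A B AB; rewrite lee_fin lerB// ler_ln ?posrE//.
  rewrite ge_max !le_max lexx/= ler_expR lerB ?ler_nat ?orbT//.
have g_lim t : limn (g^~ t) = ((G t)%:E - lne (f t)%:E)%E.
  apply/cvg_lim => //.
  have [f0|f0] := eqVneq (f t) 0.
    rewrite f0 le0_lneNy// /=; apply/cvgeryP.
    have -> : (fun A => G t - lt A t) = (fun A => A%:R).
      apply/funext => A; rewrite /lt f0 (elimT max_idPr) ?expR_ge0// expRK.
      by rewrite opprB addrC subrK.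
    exact: cvgr_idn.
  have f1 : 0 < f t by rewrite lt_def f0 cabs_ge0.
  rewrite lne_EFin//; apply: cvg_near_cst.
  exists (Num.truncn (G t - ln (f t))).+1 => // A /= hA.
  rewrite /g /lt (elimT max_idPl)// -[leRHS]lnK ?posrE// ler_expR.
  have : G t - ln (f t) <= A%:R.
    by rewrite ltW// (lt_le_trans (truncnS_gt _))// ler_nat.
  lra.
under eq_integral do rewrite -g_lim.
rewrite monotone_convergence//; last by move=> A; exact: measurable_int (ig A).
apply: lime_le.
  apply: ereal_nondecreasing_is_cvgn => A B AB.
  by apply: le_integral => // t _; exact: g_homo.
apply: nearW => A; rewrite /g.
under eq_integral do rewrite EFinB.
rewrite integralB//; [|exact: int_cont|exact: int_cont].
rewrite lne_EFin// -EFinM.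
have e1 h : continuous h -> (\int[mu]_(t in `[0%R, (2 * pi)%R]) (h t)%:E =
    (\int[mu]_(t in `[0%R, (2 * pi)%R]) h t)%R%:E)%E.
  by move=> ch; rewrite /Rintegral fineK//; apply: integrable_fin_num => //; exact: int_cont.
rewrite !e1// -EFinB lee_fin lerB//.
exact: le_circle_mean_ln (cE A) (fun t => expR_gt0 _) pc0.
Qed.

End Jensen.

(** * Weighted series of logarithms of polynomials are plurisubharmonic *)

Section Semicontinuity.
Variables (R : realType) (T : topologicalType).
Implicit Types f g : T -> \bar R.
Local Open Scope ereal_scope.

Lemma lower_semicontinuousD f g : (forall x, 0 <= f x) -> (forall x, 0 <= g x) ->
  lower_semicontinuous f -> lower_semicontinuous g ->
  lower_semicontinuous (fun x => f x + g x).
Proof.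
move=> f0 g0 cf cg x a afg.
have [a1 [a2 [aa1 af ag]]] : exists a1 a2 : R,
    [/\ (a <= a1 + a2)%R, a1%:E < f x & a2%:E < g x].
  move: afg (f0 x) (g0 x).
  case: (f x) => [r||//]; case: (g x) => [s||//] //=.
  - rewrite -EFinD lte_fin => h _ _.
    exists (r - (r + s - a) / 2)%R, (s - (r + s - a) / 2)%R.
    by rewrite !lte_fin; split; lra.
  - move=> _ _ _; exists (r - 1)%R, (a - r + 1)%R.
    by rewrite lte_fin ltry; split => //; lra.
  - move=> _ _ _; exists (a - s + 1)%R, (s - 1)%R.
    by rewrite lte_fin ltry; split => //; lra.
  - by move=> _ _ _; exists a, 0%R; rewrite !ltry addr0.
have [V xV fV] := cf x _ af; have [W xW gW] := cg x _ ag.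
exists (V `&` W); first exact: filterI.
move=> y [/fV fy /gW gy]; apply: (@le_lt_trans _ _ (a1%:E + a2%:E)).
  by rewrite -EFinD lee_fin.
exact: lteD.
Qed.

Lemma lower_semicontinuousZ (k : R) f : (0 <= k)%R ->
  lower_semicontinuous f -> lower_semicontinuous (fun x => k%:E * f x).
Proof.
rewrite le_eqVlt => /predU1P[<- _|k0 cf] x a.
  by rewrite mul0e => a0; exists setT; [exact: filterT|move=> y _; rewrite mul0e].
rewrite muleC -lte_pdivrMr// -EFinM => /cf [V xV fV]; exists V => // y /fV.
by rewrite EFinM lte_pdivrMr// muleC.
Qed.

Lemma lower_semicontinuous_nneseries (f : nat -> T -> \bar R) :
  (forall j x, 0 <= f j x) -> (forall j, lower_semicontinuous (f j)) ->
  lower_semicontinuous (fun x => \sum_(0 <= j <oo) f j x).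
Proof.
move=> f0 cf.
have cS J : lower_semicontinuous (fun x => \sum_(0 <= j < J) f j x).
  elim: J => [|J IH].
    under [X in lower_semicontinuous X]funext do rewrite big_geq//.
    by move=> x a a0; exists setT; first exact: filterT.
  under [X in lower_semicontinuous X]funext do rewrite big_nat_recr//=.
  by apply: lower_semicontinuousD => // x; apply: sume_ge0.
move=> x a; set u := fun J => \sum_(0 <= j < J) f j x.
have uh : {homo u : m n / (m <= n)%N >-> m <= n}.
  by move=> m n; exact: ereal_nondecreasing_series.
rewrite (cvg_lim _ (ereal_nondecreasing_cvgn uh))// => /ereal_sup_gt.
move=> [_ [J _ <-]] /cS [V xV fV]; exists V => // y /fV /lt_le_trans; apply.
exact: nneseries_lim_ge.
Qed.

Lemma lt_sub_lne (G f a : R) : (0 <= f)%R ->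
  (a%:E < G%:E - lne f%:E) = (f < expR (G - a))%R.
Proof.
rewrite le_eqVlt => /predU1P[<-|f0].
  by rewrite le0_lneNy//= ltry expR_gt0.
rewrite lne_EFin// -EFinB lte_fin -[in RHS](lnK f0) ltr_expR.
by apply/idP/idP; lra.
Qed.

Lemma lower_semicontinuous_sub_lne (G f : T -> R) :
  (forall x, 0 <= f x)%R -> continuous G -> continuous f ->
  lower_semicontinuous (fun x => (G x)%:E - lne (f x)%:E).
Proof.
move=> f0 cG cf x a; rewrite lt_sub_lne// => fa.
have c : {for x, continuous (fun y => expR (G y - a) - f y)%R}.
  apply: cvgB; last exact: cf.
  apply: (continuous_cvg _ (@continuous_expR _ _)).
  by apply: cvgB; [exact: cG|exact: cvg_cst].
have := c; rewrite /continuous_at => /cvgr_gt /(_ 0%R).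
rewrite subr_gt0 => /(_ fa) h.
exists [set y | 0 < expR (G y - a) - f y]%R => // y /=.
by rewrite lt_sub_lne// subr_gt0.
Qed.

End Semicontinuity.

(** The inequality of [defect_circle] below, multiplied by a weight [w]. *)
Lemma weighted_defect_le (R : realType) (u d : \bar R) (w k x g I : R) :
  (0 <= u -> 0 <= d ->
  0 <= w%:E -> 0 <= k%:E -> 0 <= x%:E -> 0 <= g%:E -> 0 <= I%:E ->
  u + (k * (x * g))%R%:E <= (k * I)%R%:E + x%:E * d ->
  w%:E * u + (x * g)%R%:E * (w * k)%R%:E <=
  I%:E * (w * k)%R%:E + x%:E * (w%:E * d))%E.
Proof.
move=> u0 d0; rewrite !lee_fin => w0 k0 x0 g0 I0 h.
have := lee_wpmul2l (_ : 0%:E <= w%:E)%E h; rewrite lee_fin => /(_ w0).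
rewrite !ge0_muleDr ?mule_ge0 ?lee_fin ?mulr_ge0//.
rewrite -!EFinM (_ : w * (k * (x * g)) = x * g * (w * k)); last by ring.
rewrite (_ : w * (k * I) = I * (w * k)); last by ring.
by rewrite muleCA.
Qed.

Section Potential.
Variables (R : realType) (n : nat).
Variable N : nat -> nat.
Variable c : forall j, {ffun 'I_n -> 'I_(N j)} -> R[i].
Variables (w : nat -> R) (E : R).
Hypothesis w_ge0 : forall j, 0 <= w j.
Hypothesis c_le1 : forall j beta, cabs (@c j beta) <= 1.
Hypothesis wE : (\sum_(0 <= j <oo) (w j * (N j)%:R)%:E = E%:E)%E.
Local Notation mu := (@lebesgue_measure R).
Implicit Types z a b : 'rV[R[i]]_n.
Local Open Scope ereal_scope.

(** The nonnegative defect of [log|P_j|] with respect to its majorant. *)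
Definition defect j z : \bar R :=
  ((N j)%:R * growth z)%:E - lne (cabs (peval (@c j) z))%:E.

(** Writing the weighted sum of the [log|P_j|] as a majorant minus a series with
    nonnegative terms makes it converge everywhere. *)
Definition potential z : \bar R :=
  (E * growth z)%:E - \sum_(0 <= j <oo) (w j)%:E * defect j z.

Lemma defect_ge0 j z : 0 <= defect j z.
Proof.
rewrite /defect; set f := cabs _; have : (0 <= f)%R by exact: cabs_ge0.
rewrite le_eqVlt => /predU1P[<-|f0]; first by rewrite le0_lneNy//= leey.
rewrite lne_EFin// -EFinB lee_fin subr_ge0 -ler_expR lnK ?posrE//.
by apply: peval_le; exact: c_le1.
Qed.

Lemma wdefect_ge0 j z : 0 <= (w j)%:E * defect j z.
Proof. by rewrite mule_ge0 ?lee_fin ?defect_ge0. Qed.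

Lemma defects_ge0 z : 0 <= \sum_(0 <= j <oo) (w j)%:E * defect j z.
Proof. by apply: nneseries_ge0 => j _ _; exact: wdefect_ge0. Qed.

Lemma E_ge0 : (0 <= E)%R.
Proof.
rewrite -lee_fin -wE; apply: nneseries_ge0 => j _ _.
by rewrite lee_fin mulr_ge0.
Qed.

Lemma potential_lty z : potential z < +oo.
Proof.
rewrite /potential; have := defects_ge0 z.
by case: (\sum_(_ <= _ <oo) _) => [r _||//] /=; rewrite ?ltry// -EFinB ltry.
Qed.

Section Along.
Variables (T : topologicalType) (zeta : T -> 'rV[R[i]]_n).
Hypothesis czeta : forall i, ccontinuous (fun t => zeta t 0%R i).

Lemma lower_semicontinuous_defect j :
  lower_semicontinuous (fun t => defect j (zeta t)).
Proof.
apply: lower_semicontinuous_sub_lne.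
- by move=> x; exact: cabs_ge0.
- move=> x; apply: cvgM; first exact: cvg_cst.
  exact: continuous_growth.
- by apply: continuous_cabs; exact: ccontinuous_peval.
Qed.

Lemma lower_semicontinuous_defects :
  lower_semicontinuous (fun t => \sum_(0 <= j <oo) (w j)%:E * defect j (zeta t)).
Proof.
apply: lower_semicontinuous_nneseries => [j x|j]; first exact: wdefect_ge0.
by apply: lower_semicontinuousZ => //; exact: lower_semicontinuous_defect.
Qed.

Lemma upper_semicontinuous_potential :
  upper_semicontinuous (fun t => potential (zeta t)).
Proof.
move=> x a; rewrite /potential => ha.
set h := fun t => \sum_(0 <= j <oo) (w j)%:E * defect j (zeta t).
have h0 t : 0 <= h t by exact: defects_ge0.
have [b [bh ba]] : exists b : R, b%:E < h x /\ (E * growth (zeta x) - b < a)%R.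
  move: ha (h0 x); rewrite -/(h x); case: (h x) => [r||//] /=.
    rewrite -EFinB lte_fin => ha _.
    exists (r - (a - (E * growth (zeta x) - r)) / 2)%R.
    by rewrite lte_fin; split; lra.
  move=> _ _; exists (E * growth (zeta x) - a + 1)%R; rewrite ltry; split=> //.
  lra.
have [V xV hV] : exists2 V, nbhs x V & forall y, V y -> b%:E < h y :=
  lower_semicontinuous_defects bh.
have cg : {for x, continuous (fun t => E * growth (zeta t) - b)%R}.
  apply: cvgB; last exact: cvg_cst.
  by apply: cvgM; [exact: cvg_cst|exact: continuous_growth].
have := cg; rewrite /continuous_at => /cvgr_lt /(_ a ba) near_lt.
near=> y.
have /hV hy : V y by near: y.
have gy : (E * growth (zeta y) - b < a)%R by near: y.
rewrite -/(h y); case: (h y) hy (h0 y) => [r||//] /=; last by rewrite ltNyr.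
by rewrite -EFinB !lte_fin; lra.
Unshelve. all: by end_near. Qed.

End Along.

Lemma ccontinuous_line_circle a b (z0 : R[i]) (r : R) i :
  ccontinuous (fun t : R => (a + (z0 + r%:C * expi t) *: b)%R 0%R i).
Proof.
under [X in ccontinuous X]funext do rewrite !mxE.
apply: ccontinuousD; first exact: ccontinuous_cst.
apply: ccontinuousM; last exact: ccontinuous_cst.
exact: ccontinuous_circle.
Qed.

Lemma continuous_growth_circle a b (z0 : R[i]) (r : R) :
  continuous (fun t : R => growth (a + (z0 + r%:C * expi t) *: b)%R).
Proof. by apply: continuous_growth => i; exact: ccontinuous_line_circle. Qed.

Lemma integrable_continuous (G : R -> R) : continuous G ->
  mu.-integrable `[0%R, (2 * pi)%R] (EFin \o G).
Proof.
move=> cG; apply: continuous_compact_integrable; first exact: segment_compact.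
exact: continuous_subspaceT.
Qed.

Lemma measurable_defect_circle j a b (z0 : R[i]) (r : R) :
  measurable_fun `[0%R, (2 * pi)%R]
    (fun t : measurableTypeR R => defect j (a + (z0 + r%:C * expi t) *: b)%R).
Proof.
apply: measurable_funTS; apply: lower_semicontinuous_measurable.
apply: lower_semicontinuous_defect => i; exact: ccontinuous_line_circle.
Qed.

Lemma defect_circle j a b (z0 : R[i]) (r : R) :
  \int[mu]_(t in `[0%R, (2 * pi)%R])
     defect j (a + (z0 + r%:C * expi t) *: b)%R +
  ((N j)%:R * (2 * pi * growth (a + z0 *: b)))%R%:E <=
  ((N j)%:R * \int[mu]_(t in `[0%R, (2 * pi)%R])
     growth (a + (z0 + r%:C * expi t) *: b))%R%:E +
  (2 * pi)%:E * defect j (a + z0 *: b)%R.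
Proof.
have [p hp] := peval_line (@c j) a b.
have pi20 : (0 < 2 * pi :> R)%R by rewrite mulr_gt0 ?pi_gt0.
set G := fun t : R => ((N j)%:R * growth (a + (z0 + r%:C * expi t) *: b))%R.
have cG : continuous G.
  move=> t; apply: cvgM; first exact: cvg_cst.
  exact: continuous_growth_circle.
have pG t : (cabs p.[z0 + r%:C * expi t] <= expR (G t))%R.
  by rewrite hp; apply: peval_le; exact: c_le1.
have := circle_mean_deficit cG pG.
rewrite /G RintegralZl//; last first.
  by apply: integrable_continuous; exact: continuous_growth_circle.
rewrite hp; under eq_integral do rewrite hp -/(defect _ _).
rewrite [X in _ + _ * X]/defect.
set I := integral _ _ _; set J := (_ * \int[_]_(_ in _) _)%R.
set f := cabs _; have : (0 <= f)%R by exact: cabs_ge0.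
rewrite le_eqVlt => /predU1P[<-|f0].
  by rewrite le0_lneNy//= addey// gt0_muley ?lte_fin// addey// leey.
rewrite lne_EFin// -EFinM -!EFinB -EFinM => hI.
apply: le_trans (leeD2r _ hI) _; rewrite -!EFinD lee_fin.
by rewrite le_eqVlt; apply/orP; left; apply/eqP; ring.
Qed.

(** As the defects are nonnegative, their series may be integrated term by term,
    and the inequalities of [defect_circle] summed.  If the series diverges at
    the centre there is nothing to prove, and otherwise all terms are finite. *)
Lemma potential_circle a b (z0 : R[i]) (r : R) :
  potential (a + z0 *: b)%R <= ((2 * pi)^-1)%:E *
    \int[mu]_(t in `[0%R, (2 * pi)%R])
      potential (a + (z0 + r%:C * expi t) *: b)%R.
Proof.
have pi20 : (0 < 2 * pi :> R)%R by rewrite mulr_gt0 ?pi_gt0.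
set gam := fun t : R => (a + (z0 + r%:C * expi t) *: b)%R.
set zc := (a + z0 *: b)%R.
set h := fun z => \sum_(0 <= j <oo) (w j)%:E * defect j z.
have [hinf|hfin] := eqVneq (h zc) +oo.
  by rewrite {1}/potential -/(h zc) hinf /= leNye.
set I := (\int[mu]_(t in `[0%R, (2 * pi)%R]) growth (gam t))%R.
have mdef j := measurable_defect_circle j a b z0 r.
have I0 : (0 <= I)%R by apply: Rintegral_ge0 => t _; exact: growth_ge0.
have main : \int[mu]_(t in `[0%R, (2 * pi)%R]) h (gam t) +
    (E * (2 * pi * growth zc))%R%:E <= (E * I)%R%:E + (2 * pi)%:E * h zc.
  rewrite /h integral_nneseries//; last 2 first.
  - by move=> j; apply: measurable_funeM; exact: mdef.
  - by move=> j t _; exact: wdefect_ge0.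
  rewrite -nneseriesZl; last by move=> j _; exact: wdefect_ge0.
  have eE (x : R) : (E * x)%R%:E = x%:E * E%:E by rewrite mulrC EFinM.
  rewrite !eE -wE -!nneseriesZl; last 2 first.
  - by move=> j _; rewrite lee_fin mulr_ge0.
  - by move=> j _; rewrite lee_fin mulr_ge0.
  rewrite -!nneseriesD; last 4 first.
  - by move=> j _ _; rewrite mule_ge0 ?lee_fin// mulr_ge0.
  - by move=> j _ _; rewrite mule_ge0 ?wdefect_ge0// lee_fin ltW.
  - by move=> j _ _; apply: integral_ge0 => t _; exact: wdefect_ge0.
  - by move=> j _ _; rewrite mule_ge0 ?lee_fin ?mulr_ge0 ?growth_ge0// ?pi_ge0.
  apply: lee_nneseries => [j _ _|j _].
    apply: adde_ge0; first by apply: integral_ge0 => t _; exact: wdefect_ge0.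
    by rewrite -EFinM lee_fin !mulr_ge0 ?growth_ge0 ?pi_ge0.
  rewrite (ge0_integralZl_EFin mu _ (fun t _ => defect_ge0 j (gam t)) (mdef j) (w_ge0 j))//.
  apply: weighted_defect_le (defect_circle j a b z0 r) => //.
  - by apply: integral_ge0 => t _; exact: defect_ge0.
  - exact: defect_ge0.
  - by rewrite lee_fin.
  - by rewrite lee_fin ltW.
  - by rewrite lee_fin growth_ge0.
have hz : h zc \is a fin_num by rewrite ge0_fin_numE ?defects_ge0// ltey.
have ih0 : 0 <= \int[mu]_(t in `[0%R, (2 * pi)%R]) h (gam t).
  by apply: integral_ge0 => t _; exact: defects_ge0.
have ihfin : \int[mu]_(t in `[0%R, (2 * pi)%R]) h (gam t) \is a fin_num.
  rewrite ge0_fin_numE//; apply: le_lt_trans (leeDl _ _) (le_lt_trans main _).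
    by rewrite lee_fin !mulr_ge0 ?growth_ge0 ?E_ge0 ?pi_ge0.
  by rewrite -(fineK hz) -EFinM -EFinD ltry.
have inth : mu.-integrable `[0%R, (2 * pi)%R] (fun t => h (gam t)).
  apply/integrableP; split.
    apply: measurable_funTS; apply: lower_semicontinuous_measurable.
    apply: lower_semicontinuous_defects => i; exact: ccontinuous_line_circle.
  under eq_integral => t _ do rewrite gee0_abs ?defects_ge0//.
  by rewrite -ge0_fin_numE.
have cEg : continuous (fun t => E * growth (gam t))%R.
  move=> t; apply: cvgM; first exact: cvg_cst.
  exact: continuous_growth_circle.
rewrite -[X in _ <= _ * X]/(\int[mu]_(t in `[0%R, (2 * pi)%R])
  ((E * growth (gam t))%R%:E - h (gam t))).
rewrite -[X in X <= _]/((E * growth zc)%R%:E - h zc).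
rewrite integralB//; last exact: integrable_continuous cEg.
have -> : \int[mu]_(t in `[0%R, (2 * pi)%R]) (E * growth (gam t))%R%:E =
    (E * I)%R%:E.
  rewrite -RintegralZl//; last first.
    by apply: integrable_continuous; exact: continuous_growth_circle.
  rewrite /Rintegral fineK//; apply: integrable_fin_num => //.
  exact: integrable_continuous cEg.
set IH := \int[mu]_(t in _) h (gam t) in ihfin main *.
move: (h zc) IH hz ihfin main => hzc IH /fineK <- /fineK <-.
set H := fine IH; set K := fine hzc => main; move: main.
rewrite -[X in _ <= X -> _]/(E * I + 2 * pi * K)%R%:E.
rewrite -[X in X <= _ -> _]/(H + E * (2 * pi * growth zc))%R%:E.
rewrite -[X in _ -> X <= _]/(E * growth zc - K)%R%:E.
rewrite -[X in _ -> _ <= X]/((2 * pi)^-1 * (E * I - H))%R%:E.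
rewrite !lee_fin => main.
rewrite [leRHS]mulrC ler_pdivlMr// mulrBl.
rewrite (_ : E * growth zc * _ = E * (2 * pi * growth zc))%R; last by ring.
lra.
Qed.

Lemma ccontinuous_id : ccontinuous (fun z : R[i] => z).
Proof.
have H (f : R[i] -> R) : (forall u v, f u - f v = f (u - v))%R ->
    (forall u, `|f u| <= cabs u)%R -> continuous f.
  move=> fB fb z A /nbhs_ballP [e /= e0 eA].
  exists e%:C; first by rewrite /= ltcR.
  move=> y /=; rewrite normc_cabs ltcR => zy; apply: eA.
  by rewrite -ball_normE /= fB (le_lt_trans (fb _)).
split; apply: H.
- by case=> [? ?] [].
- by move=> u; exact: cabs_Re.
- by case=> [? ?] [].
- by move=> u; exact: cabs_Im.
Qed.

Lemma ccontinuous_coord i : ccontinuous (fun z : 'rV[R[i]]_n => z 0%R i).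
Proof.
have [cRe cIm] := ccontinuous_id.
have cc : continuous (fun z : 'rV[R[i]]_n => z 0%R i) by exact: coord_continuous.
split=> z.
  exact: (continuous_comp (cc z) (cRe _)).
exact: (continuous_comp (cc z) (cIm _)).
Qed.

Lemma plurisubharmonic_potential : plurisubharmonic potential.
Proof.
split; [|exact: potential_lty|].
  exact: (upper_semicontinuous_potential ccontinuous_coord).
move=> a b; split; [|by move=> z; exact: potential_lty|].
  apply: (@upper_semicontinuous_potential _ (fun z : R[i] => a + z *: b)%R) => i.
  under [X in ccontinuous X]funext do rewrite !mxE.
  apply: ccontinuousD; first exact: ccontinuous_cst.
  by apply: ccontinuousM; [exact: ccontinuous_id|exact: ccontinuous_cst].
by move=> z r _; exact: potential_circle.
Qed.

End Potential.

(** * Lower bounds for normalized polynomials *)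

Section Interpolation.
Variable R : realType.

Lemma coef_XsubC_exp (zeta : R[i]) kappa k :
  cabs (('X - zeta%:P) ^+ kappa)`_k <= (1 + cabs zeta) ^+ kappa.
Proof.
elim: kappa k => [|kappa IH] k.
  by rewrite !expr0 coef1; case: eqP => _; rewrite ?cabs1// cabs0.
rewrite exprS mulrBl coefB coefXM coefCM (le_trans (cabsB _ _))//.
rewrite exprS mulrDl mul1r lerD//; last first.
  by rewrite cabsM ler_wpM2l// cabs_ge0.
by case: eqP => _; [rewrite cabs0 exprn_ge0// addr_ge0 ?cabs_ge0|exact: IH].
Qed.

Lemma dft_coef (N : nat) (q : {poly R[i]}) (k : 'I_N) : (size q <= N)%N ->
  N%:R^-1 * \sum_(l < N) (expi (unitangle R N) ^+ l) ^+ (N - k) *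
    q.[expi (unitangle R N) ^+ l] = q`_k.
Proof.
move=> sq; set w := expi _; have kN := ltn_ord k.
have N0 : (0 < N)%N by apply: leq_ltn_trans kN.
have wN : w ^+ N = 1 by exact: expi_unitangle.
under eq_bigr => l _ do rewrite (horner_coef_wide _ sq) mulr_sumr.
rewrite exchange_big (bigD1 k)//= [X in _ + X]big1 => [|k' kk'].
  rewrite addr0 (eq_bigr (fun=> q`_k)) => [|l _].
    rewrite sumr_const card_ord -[q`_k *+ N]mulr_natl mulrA mulVf ?mul1r//.
    by rewrite pnatr_eq0 -lt0n.
  by rewrite mulrCA -exprD subnK 1?ltnW// -exprM mulnC exprM wN expr1n mulr1.
under eq_bigr => l _ do rewrite mulrCA -exprD.
rewrite -mulr_sumr; have [kk|kk] := leqP k' k.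
  rewrite sum_unitroots ?mulr0//.
  have : (k' < k)%N by rewrite ltn_neqAle kk andbT.
  by move: (k : nat) (k' : nat) kN => a b; lia.
under eq_bigr => l _.
  rewrite (_ : N - k + k' = N + (k' - k))%N; last first.
    by move: (k : nat) (k' : nat) kN kk => a b; lia.
  rewrite exprD -exprM mulnC exprM wN expr1n mul1r.
  over.
rewrite sum_unitroots ?mulr0//.
by have := ltn_ord k'; move: (k : nat) (k' : nat) kN kk => a b; lia.
Qed.

(** The coefficients of a polynomial of degree less than [N] are combinations,
    with coefficients of size exponential in [N], of its values at the vertices
    of a regular polygon inscribed in a given circle. *)
Lemma inverse_vandermonde (N : nat) (zeta : R[i]) (r B : R) :
  0 < r -> 1 <= B -> (1 + cabs zeta) / r <= B ->
  exists lam : 'I_N -> 'I_N -> R[i],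
    (forall k l, cabs (lam k l) <= B ^+ N) /\
    forall k k' : 'I_N,
      \sum_l lam k l * (zeta + r%:C * expi (unitangle R N) ^+ l) ^+ k' =
      (k == k')%:R.
Proof.
move=> r0 B1 rB; set w := expi _.
have rC0 : r%:C != 0 by rewrite -cabs_gt0 cabs_real gtr0_norm.
exists (fun k l => N%:R^-1 * \sum_(kappa < N) (w ^+ l) ^+ (N - kappa) *
   ((r%:C ^- kappa) * (('X - zeta%:P) ^+ kappa)`_k)); split.
  move=> k l; have N0 : (0 < N)%N by apply: leq_ltn_trans (ltn_ord k).
  rewrite cabsM cabsV cabs_nat mulrC ler_pdivrMr ?ltr0n//.
  apply: le_trans (cabs_sum _ _ _) _.
  rewrite mulr_natr -[X in _ *+ X]card_ord -sumr_const; apply: ler_sum => kappa _.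
  rewrite !cabsM cabsX cabsX /w cabs_expi !expr1n mul1r.
  rewrite cabsV cabsX cabs_real gtr0_norm//.
  apply: (@le_trans _ _ (((1 + cabs zeta) / r) ^+ kappa)).
    rewrite expr_div_n mulrC ler_pM2r ?invr_gt0 ?exprn_gt0//.
    exact: coef_XsubC_exp.
  apply: (@le_trans _ _ (B ^+ kappa)).
    rewrite lerXn2r ?nnegrE// ?divr_ge0 ?addr_ge0 ?cabs_ge0 ?(ltW r0)//.
    exact: le_trans ler01 B1.
  by rewrite ler_weXn2l// ltnW.
move=> k k'.
pose q : {poly R[i]} := (zeta%:P + (r%:C)%:P * 'X) ^+ k'.
have sq : (size q <= N)%N.
  rewrite /q; apply: leq_trans (size_poly_exp_leq _ _) _.
  have s2 : (size (zeta%:P + (r%:C)%:P * 'X : {poly R[i]})).-1 = 1%N.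
    by rewrite addrC mul_polyC size_polyDl ?size_scale ?size_polyX// size_polyC;
      case: eqP.
  by rewrite s2 mul1n ltn_ord.
under eq_bigr => l _.
  rewrite (_ : (_ + _) ^+ _ = q.[w ^+ l]); last by rewrite /q !hornerE.
  rewrite -mulrA mulr_suml.
  over.
rewrite -mulr_sumr exchange_big /=.
transitivity (\sum_(kappa < N) q`_kappa *
    (r%:C ^- kappa * (('X - zeta%:P) ^+ kappa)`_k)).
  rewrite mulr_sumr; apply: eq_bigr => kappa _.
  rewrite -(dft_coef kappa sq) -mulrA; congr (_ * _).
  by rewrite mulr_suml; apply: eq_bigr => l _; rewrite mulrAC.
transitivity ((q \Po ((r%:C^-1)%:P * ('X - zeta%:P)))`_k).
  rewrite /comp_poly (@horner_coef_wide _ N) ?size_map_polyC// coef_sum.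
  apply: eq_bigr => kappa _.
  by rewrite [q^:P`_kappa]coef_map coefCM exprMn -polyC_exp coefCM exprVn.
rewrite /q rmorphXn rmorphD rmorphM /= comp_polyX !comp_polyC mulrA -rmorphM/=.
by rewrite divff// mul1r addrC subrK coefXn.
Qed.

(** The inverse Vandermonde matrices of the coordinates, tensored, recover the
    coefficients from the values on a product of polygons. *)
Lemma coef_le_sup n (N : nat) (c : {ffun 'I_n -> 'I_N} -> R[i])
    (z : 'rV[R[i]]_n) (r B M : R) :
  0 < r -> 1 <= B -> (forall i, (1 + cabs (z 0 i)) / r <= B) ->
  (forall x : 'rV[R[i]]_n, (forall i, cabs (x 0 i - z 0 i) <= r) ->
     cabs (peval c x) <= M) ->
  forall beta, cabs (c beta) <= (N%:R * B ^+ N) ^+ n * M.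
Proof.
move=> r0 B1 zB cM beta.
have [lam hlam] := choice (fun i => inverse_vandermonde N r0 B1 (zB i)).
pose x (gamma : {ffun 'I_n -> 'I_N}) : 'rV[R[i]]_n :=
  \row_i (z 0 i + r%:C * expi (unitangle R N) ^+ gamma i).
have -> : c beta = \sum_(gamma : {ffun 'I_n -> 'I_N})
    (\prod_i lam i (beta i) (gamma i)) * peval c (x gamma).
  under eq_bigr do rewrite mulr_sumr.
  rewrite exchange_big /= (bigD1 beta)//= [X in _ + X]big1 => [|beta' bb].
    rewrite addr0.
    under eq_bigr => gamma _.
      rewrite mulrCA -big_split/=; under eq_bigr do rewrite mxE; over.
    rewrite -mulr_sumr -(bigA_distr_bigA (fun i l => lam i (beta i) l *
      (z 0 i + r%:C * expi (unitangle R N) ^+ l) ^+ beta i)).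
    rewrite big1 ?mulr1// => i _.
    by have [_ ->] := hlam i; rewrite eqxx.
  under eq_bigr => gamma _.
    rewrite mulrCA -big_split/=; under eq_bigr do rewrite mxE; over.
  rewrite -mulr_sumr -(bigA_distr_bigA (fun i l => lam i (beta i) l *
    (z 0 i + r%:C * expi (unitangle R N) ^+ l) ^+ beta' i)).
  have [i bi] : exists i, beta i != beta' i.
    apply/existsP; apply: contraT; rewrite negb_exists => /forallP h.
    case/eqP: bb; apply/ffunP => i; apply/esym/eqP.
    by have := h i; rewrite negbK.
  by rewrite (bigD1 i)//=; have [_ ->] := hlam i; rewrite (negPf bi) mul0r mulr0.
apply: le_trans (cabs_sum _ _ _) _.
have M0 : 0 <= M.
  apply: le_trans (cabs_ge0 _) (cM z _) => i.
  by rewrite subrr cabs0 ltW.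
apply: (@le_trans _ _ (\sum_(gamma : {ffun 'I_n -> 'I_N}) ((B ^+ N) ^+ n * M))).
  apply: ler_sum => gamma _; rewrite cabsM ler_pM ?cabs_ge0//.
    rewrite cabs_prod -[X in _ <= _ ^+ X]card_ord -prodr_const.
    by apply: ler_prod => i _; rewrite cabs_ge0/=; have [] := hlam i.
  apply: cM => i; rewrite mxE addrAC subrr add0r cabsM cabsX cabs_expi.
  by rewrite expr1n mulr1 cabs_real gtr0_norm.
rewrite sumr_const card_ffun !card_ord -[leLHS]mulr_natl natrX exprMn.
by rewrite mulrA.
Qed.

End Interpolation.

(** * Generic points and pluripolarity of thin sets *)

(** Needed to apply Baire's theorem in a space of row vectors. *)
HB.instance Definition _ (R : realType) (m k : nat) :=
  Complete.on 'M[R]_(m, k).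

(** Listing each natural number infinitely often. *)
Lemma logn2_surj (k m : nat) : exists2 j, (m <= j)%N & logn 2 j.+1 = k.
Proof.
exists (2 ^ k * (m.*2).+1).-1.
  have := expn_gt0 2 k; move: (2 ^ k)%N => a; nia.
rewrite prednK ?muln_gt0 ?expn_gt0// lognM ?expn_gt0//.
by rewrite pfactorK// lognE dvdn2 oddS odd_double andbF addn0.
Qed.

Section Thin.
Variables (R : realType) (n : nat).
Implicit Types E : set 'rV[R[i]]_n.

(** On a fixed ball, a polynomial normalized in this way exceeds [e ^ (- C N)]
    somewhere, with [C] independent of [N]; thin sets are small in comparison. *)
Definition thin E := forall A : R, exists N : nat, (0 < N)%N /\
  exists c : {ffun 'I_n -> 'I_N} -> R[i],
  [/\ forall beta, cabs (c beta) <= 1, exists beta, cabs (c beta) = 1 &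
      forall z, E z -> cabs (peval c z) <= expR (- (A * N%:R))].

Definition complexify (x : 'rV[R]_(n + n)) : 'rV[R[i]]_n :=
  \row_i (x 0 (lshift n i) +i* x 0 (rshift n i))%C.

Lemma ccontinuous_complexify i : ccontinuous (fun x => complexify x 0 i).
Proof.
by split; under [X in continuous X]funext do rewrite mxE /=; exact: coord_continuous.
Qed.

(** If a normalized polynomial of degree [N] were below [e ^ (- a N)] on a whole
    ball, for [a] large with respect to that ball, then [coef_le_sup] would make
    all its coefficients less than one. *)
Lemma large_value_dense (N : nat -> nat)
    (c : forall a, {ffun 'I_n -> 'I_(N a)} -> R[i]) (a0 : nat) :
  (forall a, 0 < N a)%N -> (forall a, exists beta, cabs (@c a beta) = 1) ->
  let O := [set x | exists2 a, (a0 <= a)%N &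
    expR (- (a%:R * (N a)%:R)) < cabs (peval (@c a) (complexify x))] in
  open O /\ dense O.
Proof.
move=> N0 c1 O; split.
  have -> : O = \bigcup_(a in [set a | (a0 <= a)%N])
      [set x | expR (- (a%:R * (N a)%:R)) < cabs (peval (@c a) (complexify x))].
    by apply/seteqP; split=> x [a]; exists a.
  apply: bigcup_open => a _.
  have cc : continuous (fun x => cabs (peval (@c a) (complexify x))).
    by apply: continuous_cabs; apply: ccontinuous_peval; exact: ccontinuous_complexify.
  exact: (open_comp (fun x _ => cc x) (@open_gt _ _)).
move=> U [x0 Ux0] oU.
have [r r0 rU] : exists2 r : R, 0 < r & ball x0 r `<=` U.
  by have /nbhs_ballP[r /= r0 rU] := open_nbhs_nbhs (conj oU Ux0); exists r.
pose z := complexify x0; pose r2 := r / 2.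
have r20 : 0 < r2 by rewrite divr_gt0.
pose B := 1 + \sum_i (1 + cabs (z 0 i)) / r2.
have t0 i : 0 <= (1 + cabs (z 0 i)) / r2.
  by rewrite divr_ge0 ?addr_ge0 ?cabs_ge0// ltW.
have B1 : 1 <= B by rewrite lerDl sumr_ge0.
have B0 : 0 < B by apply: lt_le_trans B1.
have zB i : (1 + cabs (z 0 i)) / r2 <= B.
  by rewrite /B (bigD1 i)//= addrCA lerDl addr_ge0// sumr_ge0.
pose a := maxn a0 (Num.trunc (n%:R + n%:R * ln B)).+1.
apply: contrapT => hn.
have small (x : 'rV[R[i]]_n) : (forall i, cabs (x 0 i - z 0 i) <= r2) ->
    cabs (peval (@c a) x) <= expR (- (a%:R * (N a)%:R)).
  move=> xz; rewrite leNgt; apply/negP => big; apply: hn.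
  pose y : 'rV[R]_(n + n) := row_mx (\row_i complex.Re (x 0 i)) (\row_i complex.Im (x 0 i)).
  have xy : complexify y = x.
    apply/rowP => i; rewrite mxE row_mxEl row_mxEr !mxE.
    by case: (x 0 i).
  exists y; split; last by exists a; rewrite ?leq_maxl ?xy.
  apply: rU; split=> // i j; rewrite (ord1 i) -ball_normE /=.
  have h k : `|complex.Re (x 0 k) - x0 0 (lshift n k)| < r /\
      `|complex.Im (x 0 k) - x0 0 (rshift n k)| < r.
    have := xz k; rewrite /z !mxE; case: (x 0 k) => u v /= h.
    have r2r : r2 < r by rewrite ltr_pdivrMr// ltr_pMr// ltr1n.
    by split; apply: le_lt_trans r2r; apply: le_trans h;
      [exact: (cabs_Re (_ +i* _))|exact: (cabs_Im (_ +i* _))].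
  rewrite distrC; case: (splitP j) => k jk.
    have -> : j = lshift n k by apply: val_inj.
    by rewrite row_mxEl mxE; have [] := h k.
  have -> : j = rshift n k by apply: val_inj.
  by rewrite row_mxEr mxE; have [] := h k.
have [beta cb] := c1 a.
have := coef_le_sup r20 B1 zB small beta; rewrite cb leNgt => /negP; apply.
rewrite -[ltRHS]expR0.
have NB : (N a)%:R * B ^+ N a <= expR ((1 + ln B) * (N a)%:R).
  rewrite mulrDl mul1r expRD ler_pM ?exprn_ge0 ?(ltW B0)//.
    exact: natr_le_expR.
  by rewrite expRM_natr lnK ?posrE.
have Nge0 : 0 <= (N a)%:R * B ^+ N a by rewrite mulr_ge0// exprn_ge0// ltW.
apply: (@le_lt_trans _ _ (expR ((1 + ln B) * (N a)%:R) ^+ n *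
   expR (- (a%:R * (N a)%:R)))).
  by rewrite ler_wpM2r ?expR_ge0// lerXn2r ?nnegrE ?expR_ge0.
rewrite -expRM_natr -expRD ltr_expR.
have an : n%:R + n%:R * ln B < a%:R.
  by rewrite (lt_le_trans (truncnS_gt _))// ler_nat leq_maxr.
rewrite mulrAC -mulrBl pmulr_llt0 ?ltr0n//.
by rewrite subr_lt0 mulrC mulrDr mulr1.
Qed.

(** By Baire's theorem there is a point [z0] at which, for each of the thin sets,
    infinitely many of its polynomials exceed [e ^ (- a N)], while they are below
    [e ^ (- a ^ 2 N)] on the set.  With weights [(a ^ 2 N)^-1] the logarithms are
    summable at [z0] but add up to [-oo] on the set. *)
Lemma thin_bigcup_pluripolar (E : nat -> set 'rV[R[i]]_n) :
  (forall k, thin (E k)) -> (exists k, E k !=set0) ->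
  pluripolar (\bigcup_k E k).
Proof.
move=> thinE [k0 [e0 Ee0]].
have := choice (fun ka : nat * nat => thinE ka.1 (ka.2%:R ^+ 2)).
move=> [N hN].
have N0 ka : (0 < N ka)%N by have [] := hN ka.
have hN' ka : exists c : {ffun 'I_n -> 'I_(N ka)} -> R[i],
    [/\ forall beta, cabs (c beta) <= 1, exists beta, cabs (c beta) = 1 &
        forall z, E ka.1 z ->
          cabs (peval c z) <= expR (- (ka.2%:R ^+ 2 * (N ka)%:R))].
  by have [] := hN ka.
pose c ka := sval (cid (hN' ka)).
have c_le1 ka beta : cabs (c ka beta) <= 1.
  by have [h _ _] := svalP (cid (hN' ka)); exact: h.
have c_1 ka : exists beta, cabs (c ka beta) = 1.
  by have [_ h _] := svalP (cid (hN' ka)); exact: h.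
have c_small ka z : E ka.1 z ->
    cabs (peval (c ka) z) <= expR (- (ka.2%:R ^+ 2 * (N ka)%:R)).
  by have [_ _ h] := svalP (cid (hN' ka)); exact: h.
(* The valuation at 2 of i + 1 selects the thin set, so that each of them is
   dealt with infinitely often. *)
pose F i := [set x : 'rV[R]_(n + n) | exists2 a, (i <= a)%N &
  expR (- (a%:R * (N (logn 2 i.+1, a))%:R)) <
  cabs (peval (c (logn 2 i.+1, a)) (complexify x))].
have Fod i : open (F i) /\ dense (F i).
  exact: (@large_value_dense (fun a => N (logn 2 i.+1, a))
    (fun a => c (logn 2 i.+1, a)) i (fun a => N0 _) (fun a => c_1 _)).
have [x0 [_ x0F]] := Baire Fod (ex_intro _ (0 : 'rV[R]_(n + n)) I) openT.
pose z0 := complexify x0.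
have ha j : exists a, (2 ^ j <= a)%N /\
    expR (- (a%:R * (N (logn 2 j.+1, a))%:R)) <
    cabs (peval (c (logn 2 j.+1, a)) z0).
  have [i ji ik] := logn2_surj (logn 2 j.+1) (2 ^ j).
  have [a ia] := x0F i I; rewrite ik => h; exists a; split => //.
  exact: leq_trans ia.
have [a ha'] := choice ha.
have a0 j : (0 < a j)%N.
  by have [h _] := ha' j; rewrite (leq_trans _ h)// expn_gt0.
have aR0 j : 0 < (a j)%:R :> R by rewrite ltr0n.
pose ind j := (logn 2 j.+1, a j).
have NR0 j : 0 < (N (ind j))%:R :> R by rewrite ltr0n.
(* The j-th logarithm, times w j, is at most -1 on its thin set, and at least
   -1 / a j >= - 2^-j at z0. *)
pose w j : R := ((a j)%:R ^+ 2 * (N (ind j))%:R)^-1.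
have w0 j : 0 <= w j by rewrite invr_ge0 mulr_ge0// exprn_ge0.
have a_le j : (a j)%:R^-1 <= 2^-1 ^+ j :> R.
  have [h _] := ha' j.
  by rewrite exprVn lef_pV2 ?posrE ?exprn_gt0// -natrX ler_nat.
have geo_fin (f : nat -> R) (C : R) : (forall j, 0 <= f j <= C * 2^-1 ^+ j) ->
    (\sum_(0 <= j <oo) (f j)%:E < +oo)%E.
  move=> fC; apply: (@le_lt_trans _ _ (\sum_(0 <= j <oo) (C * 2^-1 ^+ j)%:E)%E).
    by apply: lee_nneseries => [j _ _|j _]; rewrite lee_fin; have /andP[] := fC j.
  have half : `|2^-1 : R| < 1 by rewrite gtr0_norm ?invf_lt1 ?ltr1n.
  have := @cvg_geometric_series R C 2^-1 half.
  move=> cv; suff -> : (\sum_(0 <= j <oo) (C * 2^-1 ^+ j)%:E)%E =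
      (C * (1 - 2^-1)^-1)%:E by rewrite ltry.
  apply/cvg_lim => //.
  under [X in X @ _ --> _]funext do rewrite sumEFin.
  by apply/fine_cvgP; split; [exact: nearW|exact: cv].
have [Es wE] : exists Es : R,
    (\sum_(0 <= j <oo) (w j * (N (ind j))%:R)%:E = Es%:E)%E.
  set S := (\sum_(0 <= j <oo) _)%E.
  exists (fine S); rewrite fineK// ge0_fin_numE; last first.
    by apply: nneseries_ge0 => j _ _; rewrite lee_fin mulr_ge0.
  apply: (geo_fin _ 1) => j; rewrite mulr_ge0//= mul1r (le_trans _ (a_le j))//.
  rewrite /w invfM divfK ?gt_eqF// lef_pV2 ?posrE ?exprn_gt0//.
  by rewrite ler_eXnr ?ler1n.
pose h z := (\sum_(0 <= j <oo) (w j)%:E * defect (fun j => c (ind j)) j z)%E.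
have term_ge0 j z : (0 <= (w j)%:E * defect (fun j => c (ind j)) j z)%E.
  by apply: wdefect_ge0 => // i beta; exact: c_le1.
have h_oo k z : E k z -> h z = +oo%E.
  move=> Ekz; apply/eqP; rewrite -leye_eq leNgt; apply/negP => hfin.
  have := nneseries_tail_cvg hfin (fun j _ => term_ge0 j z).
  move/fine_cvgP => [[J1 _ fin1] /cvgrPdist_lt /(_ 1 ltr01) [J2 _ lt1]].
  have [j Jj jk] := logn2_surj k (maxn J1 J2).
  have /fin1 finj : (J1 <= j)%N by rewrite (leq_trans _ Jj)// leq_maxl.
  have /lt1 /= : (J2 <= j)%N by rewrite (leq_trans _ Jj)// leq_maxr.
  rewrite sub0r normrN ltNge => /negP; apply.
  rewrite (le_trans _ (ler_norm _))// -lee_fin fineK//.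
  apply: (le_trans _ (nneseries_lim_ge j.+1 (fun i _ _ => term_ge0 i z))).
  have w1 : w j * ((a j)%:R ^+ 2 * (N (ind j))%:R) = 1.
    by rewrite mulVf// gt_eqF// mulr_gt0// exprn_gt0.
  rewrite big_nat1 /defect.
  apply: (@le_trans _ _ ((w j)%:E * ((a j)%:R ^+ 2 * (N (ind j))%:R)%:E)%E).
    by rewrite -EFinM w1.
  apply: lee_wpmul2l; first by rewrite lee_fin.
  have : cabs (peval (c (ind j)) z) <= expR (- ((a j)%:R ^+ 2 * (N (ind j))%:R)).
    by apply: c_small; rewrite /= jk.
  have := cabs_ge0 (peval (c (ind j)) z); rewrite le_eqVlt => /predU1P[<- _|P0 Ple].
    by rewrite le0_lneNy//= leey.
  rewrite lne_EFin// -EFinB lee_fin -[leLHS]add0r lerD//.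
    by rewrite mulr_ge0// growth_ge0.
  by rewrite lerNr -ler_expR lnK ?posrE.
have h_z0 : (h z0 < +oo)%E.
  have P0 j : 0 < cabs (peval (c (ind j)) z0).
    by have [_ hj] := ha' j; apply: le_lt_trans hj; exact: expR_ge0.
  pose f j := w j * ((N (ind j))%:R * growth z0 - ln (cabs (peval (c (ind j)) z0))).
  have hf j : ((w j)%:E * defect (fun j => c (ind j)) j z0 = (f j)%:E)%E.
    by rewrite /defect lne_EFin.
  rewrite /h; under eq_eseriesr do rewrite hf.
  apply: (geo_fin _ (growth z0 + 1)) => j.
  rewrite -lee_fin -hf term_ge0/=.
  have [_ hj] := ha' j.
  have : - ln (cabs (peval (c (ind j)) z0)) <= (a j)%:R * (N (ind j))%:R.
    by rewrite lerNl -ler_expR lnK ?posrE// ltW.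
  move=> hl; apply: (@le_trans _ _ ((growth z0 + 1) * (a j)%:R^-1)); last first.
    by rewrite ler_wpM2l// addr_ge0// growth_ge0.
  rewrite /f /w mulrC ler_pdivrMr ?mulr_gt0 ?exprn_gt0//.
  rewrite (_ : _ * (_ ^+ 2 * _) = (growth z0 + 1) * ((a j)%:R * (N (ind j))%:R)); last first.
    by rewrite expr2; field; rewrite gt_eqF.
  rewrite mulrDl mul1r lerD// mulrC ler_wpM2l ?growth_ge0//.
  by apply: ler_peMl; [exact: ltW|rewrite ler1n].
exists (potential (fun j => c (ind j)) w Es); split.
- by apply: plurisubharmonic_potential => // j beta; exact: c_le1.
- move=> [v hv]; have := hv e0; rewrite /potential -/(h e0) (h_oo _ _ Ee0) /= => hv0.
  have := hv z0; rewrite -hv0 /potential -/(h z0); move: h_z0.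
  have : (0 <= h z0)%E by apply: nneseries_ge0 => j _ _; exact: term_ge0.
  by case: (h z0).
- by move=> z [k _ Ekz]; rewrite /potential -/(h z) (h_oo _ _ Ekz).
Qed.

End Thin.

(** * Approximation by polynomials in few real parameters *)

Section Approximation.
Variables (R : realType) (X : Type) (S : set X) (mu L : nat) (theta : R).
Variable xi : X -> 'rV[R[i]]_mu.
Hypothesis L_gt1 : (1 < L)%N.
Hypothesis theta_ge0 : 0 <= theta.
Hypothesis theta_le : theta <= 4^-1.
Hypothesis xi_le : forall x i, S x -> cabs (xi x 0 i) <= theta.
Implicit Types (f g : X -> R[i]) (a b : {ffun 'I_mu -> 'I_L} -> R[i]).

(** The bound on the coefficients of the approximating polynomial is what allows
    the terms of high degree of a product to be dropped. *)
Definition approx (A e : R) f := exists a,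
  \sum_alpha cabs (a alpha) <= A /\
  forall x, S x -> cabs (f x - peval a (xi x)) <= e.

Lemma theta_le1 : theta <= 1.
Proof. by rewrite (le_trans theta_le)// invf_le1// ler1n. Qed.

Lemma L_gt0 : (0 < L)%N. Proof. exact: ltnW. Qed.

Lemma monomial_le (k : 'I_mu -> nat) x : S x ->
  cabs (\prod_i xi x 0 i ^+ k i) <= 1.
Proof.
move=> Sx; rewrite cabs_prod; apply: prodr_ile1 => i _.
rewrite cabs_ge0/= cabsX exprn_ile1 ?cabs_ge0//.
by rewrite (le_trans (xi_le i Sx)) ?theta_le1.
Qed.

Lemma monomial_le_exp (k : 'I_mu -> nat) x j : S x -> (L <= k j)%N ->
  cabs (\prod_i xi x 0 i ^+ k i) <= theta ^+ L.
Proof.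
move=> Sx Lk; rewrite (bigD1 j)//= cabsM -[leRHS]mulr1 ler_pM ?cabs_ge0//.
  rewrite cabsX (@le_trans _ _ (theta ^+ k j))//.
    by rewrite lerXn2r ?nnegrE ?cabs_ge0// xi_le.
  by rewrite ler_wiXn2l// theta_le1.
rewrite cabs_prod; apply: prodr_ile1 => i _.
rewrite cabs_ge0/= cabsX exprn_ile1 ?cabs_ge0//.
by rewrite (le_trans (xi_le i Sx)) ?theta_le1.
Qed.

Lemma approx_le A B e e' f : A <= B -> e <= e' -> approx A e f -> approx B e' f.
Proof.
move=> AB ee' [a [aA fa]]; exists a; split; first exact: le_trans AB.
by move=> x Sx; rewrite (le_trans (fa x Sx)).
Qed.

Lemma approx_ext A e f g : (forall x, S x -> f x = g x) ->
  approx A e f -> approx A e g.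
Proof.
by move=> fg [a [aA fa]]; exists a; split => // x Sx; rewrite -fg ?fa.
Qed.

Lemma approx_near A e f g e' : (forall x, S x -> cabs (g x - f x) <= e') ->
  approx A e f -> approx A (e' + e) g.
Proof.
move=> fg [a [aA fa]]; exists a; split => // x Sx.
rewrite -(subrK (f x) (g x)) -addrA (le_trans (cabsD _ _))// lerD ?fg//.
exact: fa.
Qed.

Lemma approx0 f e : (forall x, S x -> cabs (f x) <= e) -> approx 0 e f.
Proof.
move=> fe; exists (fun=> 0); split; first by rewrite big1// => ? _; rewrite cabs0.
by move=> x Sx; rewrite /peval big1 ?subr0 ?fe// => ? _; rewrite mul0r.
Qed.

Lemma approx_monomial (alpha : {ffun 'I_mu -> 'I_L}) :
  approx 1 0 (fun x => \prod_i xi x 0 i ^+ alpha i).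
Proof.
exists (fun beta => (beta == alpha)%:R); split.
  rewrite (bigD1 alpha)//= eqxx cabs1 big1 ?addr0// => i /negPf ->.
  by rewrite cabs0.
move=> x Sx; rewrite [X in _ - X](_ : _ = \prod_i xi x 0 i ^+ alpha i).
  by rewrite subrr cabs0.
rewrite /peval (bigD1 alpha)//= eqxx mul1r [X in _ + X]big1 ?addr0//.
by move=> i /negPf ->; rewrite mul0r.
Qed.

Lemma approx1 : approx 1 0 (fun=> 1).
Proof.
apply: approx_ext (approx_monomial [ffun=> Ordinal L_gt0]) => x _.
by rewrite big1// => i _; rewrite ffunE expr0.
Qed.

Lemma approx_xi i : approx 1 0 (fun x => xi x 0 i).
Proof.
pose al : {ffun 'I_mu -> 'I_L} :=
  [ffun j => if j == i then Ordinal L_gt1 else Ordinal L_gt0].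
apply: approx_ext (approx_monomial al) => x _.
rewrite (bigD1 i)//= ffunE eqxx expr1 big1 ?mulr1// => j /negPf ji.
by rewrite ffunE ji expr0.
Qed.

Lemma approxD A B e e' f g : approx A e f -> approx B e' g ->
  approx (A + B) (e + e') (fun x => f x + g x).
Proof.
move=> [a [aA fa]] [b [bB gb]]; exists (fun al => a al + b al); split.
  apply: (@le_trans _ _ (\sum_al cabs (a al) + \sum_al cabs (b al))).
    by rewrite -big_split; apply: ler_sum => al _; exact: cabsD.
  exact: lerD.
move=> x Sx.
have -> : peval (fun al => a al + b al) (xi x) = peval a (xi x) + peval b (xi x).
  by rewrite /peval -big_split; apply: eq_bigr => al _; rewrite mulrDl.
by rewrite opprD addrACA (le_trans (cabsD _ _))// lerD ?fa ?gb.
Qed.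

Lemma approxZ (c : R[i]) A e f : approx A e f ->
  approx (cabs c * A) (cabs c * e) (fun x => c * f x).
Proof.
move=> [a [aA fa]]; exists (fun al => c * a al); split.
  under eq_bigr do rewrite cabsM.
  by rewrite -mulr_sumr ler_wpM2l// cabs_ge0.
move=> x Sx.
have -> : peval (fun al => c * a al) (xi x) = c * peval a (xi x).
  by rewrite /peval mulr_sumr; apply: eq_bigr => al _; rewrite mulrA.
by rewrite -mulrBr cabsM ler_wpM2l ?cabs_ge0// fa.
Qed.

Lemma approx_sum (I : Type) (r : seq I) (c : I -> R[i]) (F : I -> X -> R[i]) A e :
  (forall i, approx A e (F i)) ->
  approx ((\sum_(i <- r) cabs (c i)) * A) ((\sum_(i <- r) cabs (c i)) * e)
    (fun x => \sum_(i <- r) c i * F i x).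
Proof.
move=> hF; elim: r => [|i r IH].
  rewrite big_nil !mul0r; apply: (@approx0 _ 0) => x _.
  by rewrite big_nil cabs0.
rewrite big_cons !mulrDl.
apply: approx_ext (approxD (approxZ (c i) (hF i)) IH) => x _.
by rewrite big_cons.
Qed.

(** The terms of the product of two polynomials that exceed the allowed degree
    are of size [theta ^+ L] and may be dropped. *)
Lemma approxM A B e e' F G f g : 0 <= e -> 0 <= e' ->
  (forall x, S x -> cabs (f x) <= F) -> (forall x, S x -> cabs (g x) <= G) ->
  approx A e f -> approx B e' g ->
  approx (A * B) (F * e' + e * (G + e') + A * B * theta ^+ L)
    (fun x => f x * g x).
Proof.
move=> e0 e0' fF gG [a [aA fa]] [b [bB gb]].
pose hit (p : {ffun 'I_mu -> 'I_L} * {ffun 'I_mu -> 'I_L})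
  (gam : {ffun 'I_mu -> 'I_L}) := [forall i, (p.1 i + p.2 i)%N == gam i].
pose low (p : {ffun 'I_mu -> 'I_L} * {ffun 'I_mu -> 'I_L}) :=
  [forall i, (p.1 i + p.2 i < L)%N].
pose add (p : {ffun 'I_mu -> 'I_L} * {ffun 'I_mu -> 'I_L}) :
  {ffun 'I_mu -> 'I_L} := [ffun i => insubd (Ordinal L_gt0) (p.1 i + p.2 i)%N].
have addE p i : low p -> add p i = (p.1 i + p.2 i)%N :> nat.
  by move=> /forallP lp; rewrite ffunE /insubd insubT.
exists (fun gam => \sum_(p | low p && (add p == gam)) a p.1 * b p.2).
have sab : \sum_p cabs (a p.1) * cabs (b p.2) <= A * B.
  rewrite -(pair_bigA _ (fun p q => cabs (a p) * cabs (b q)))/=.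
  under eq_bigr do rewrite -mulr_sumr.
  by rewrite -mulr_suml ler_pM// sumr_ge0// => ? _; exact: cabs_ge0.
split.
  apply: le_trans sab.
  apply: (@le_trans _ _ (\sum_gam \sum_(p | low p && (add p == gam))
      cabs (a p.1) * cabs (b p.2))).
    apply: ler_sum => gam _; apply: le_trans (cabs_sum _ _ _) _.
    by apply: ler_sum => p _; rewrite cabsM.
  rewrite -(partition_big add xpredT)//= big_mkcond/=.
  by apply: ler_sum => p _; case: ifP => // _; rewrite mulr_ge0 ?cabs_ge0.
move=> x Sx; set Pa := peval a (xi x); set Pb := peval b (xi x).
have -> : peval (fun gam => \sum_(p | low p && (add p == gam)) a p.1 * b p.2)
    (xi x) = Pa * Pb - \sum_(p | ~~ low p) a p.1 * b p.2 *
      \prod_i xi x 0 i ^+ (p.1 i + p.2 i).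
  have -> : Pa * Pb = \sum_p a p.1 * b p.2 *
      \prod_i xi x 0 i ^+ (p.1 i + p.2 i).
    rewrite /Pa /Pb /peval big_distrlr/= pair_bigA/=; apply: eq_bigr => p _.
    by under [in RHS]eq_bigr do rewrite exprD; rewrite big_split/=; ring.
  rewrite (bigID low)/= addrK (partition_big add xpredT)//=.
  apply: eq_bigr => gam _; rewrite mulr_suml; apply: eq_bigr => p /andP[lp /eqP <-].
  by congr (_ * _); apply: eq_bigr => i _; rewrite addE.
have -> : f x * g x - (Pa * Pb - \sum_(p | ~~ low p) a p.1 * b p.2 *
      \prod_i xi x 0 i ^+ (p.1 i + p.2 i)) =
  f x * (g x - Pb) + (f x - Pa) * Pb + \sum_(p | ~~ low p) a p.1 * b p.2 *
      \prod_i xi x 0 i ^+ (p.1 i + p.2 i) by ring.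
rewrite (le_trans (cabsD _ _))// lerD//.
  rewrite (le_trans (cabsD _ _))// !cabsM lerD// ler_pM ?cabs_ge0 ?fF ?gb ?fa//.
  rewrite -[Pb](subKr (g x)) (le_trans (cabsB _ _))// lerD ?gG ?gb//.
apply: le_trans (cabs_sum _ _ _) _.
apply: (@le_trans _ _ (\sum_p cabs (a p.1) * cabs (b p.2) * theta ^+ L)).
  rewrite big_mkcond; apply: ler_sum => p _; case: ifP => [np|_].
    rewrite !cabsM ler_wpM2l ?mulr_ge0 ?cabs_ge0//.
    move: np; rewrite negb_forall => /existsP[j]; rewrite -leqNgt.
    exact: (@monomial_le_exp (fun i => p.1 i + p.2 i)%N).
  by rewrite mulr_ge0 ?exprn_ge0// mulr_ge0 ?cabs_ge0.
by rewrite -mulr_suml ler_wpM2r ?exprn_ge0.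
Qed.

Section FixedPoint.
Variables (d : nat) (Y : 'I_d -> X -> R[i]).
Hypothesis Y_le : forall j x, S x -> cabs (Y j x) <= theta.

Lemma approx_monomial_Y (e : R) (k : 'I_d -> nat) : 0 <= e <= 4^-1 ->
  (forall j, approx 1 e (Y j)) ->
  approx 1 (2 * (e + theta ^+ L)) (fun x => \prod_j Y j x ^+ k j).
Proof.
move=> /andP[e0 e4] hY.
have tL0 : 0 <= theta ^+ L by rewrite exprn_ge0.
pose P f := approx 1 (2 * (e + theta ^+ L)) f /\
  forall x, S x -> cabs (f x) <= 1.
have P1 : P (fun=> 1).
  split; last by move=> x _; rewrite cabs1.
  by apply: approx_le approx1 => //; rewrite mulr_ge0// addr_ge0.
have PY f j : P f -> P (fun x => f x * Y j x).
  move=> [fa f1]; split; last first.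
    move=> x Sx; rewrite cabsM -[leRHS]mulr1 ler_pM ?cabs_ge0 ?f1//.
    by rewrite (le_trans (Y_le j Sx)) ?theta_le1.
  have e2 : 0 <= 2 * (e + theta ^+ L) by rewrite mulr_ge0// addr_ge0.
  apply: approx_le (approxM e2 e0 f1 (Y_le j) fa (hY j)); rewrite ?mulr1//.
  rewrite mul1r; set E := _ * (e + _) in e2 *.
  have te : theta + e <= 2^-1 by move: theta_le e4; lra.
  have := ler_wpM2l e2 te.
  rewrite mul1r /E; lra.
have PX f j m : P f -> P (fun x => f x * Y j x ^+ m).
  move=> Pf; elim: m => [|m IH].
    by under [X in P X]funext do rewrite expr0 mulr1.
  under [X in P X]funext do rewrite exprSr mulrA.
  exact: PY.
suff : P (fun x => \prod_j Y j x ^+ k j) by case.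
elim: (index_enum _) => [|j r IH].
  by under [X in P X]funext do rewrite big_nil.
under [X in P X]funext do rewrite big_cons mulrC.
exact: PX.
Qed.

(** Functions that satisfy a contracting polynomial equation over [xi] are
    approximated by its Picard iterates: starting from zero, each iteration halves
    the error, up to the defect [eta] of the equation and the truncation. *)
Lemma approx_fixed_point (bb : 'I_d -> 'I_mu -> R[i])
    (K : finType) (k : K -> 'I_d -> nat) (t : 'I_d -> K -> R[i]) (eta : R) :
  0 < theta -> 0 <= eta <= 16^-1 ->
  (forall j, \sum_i cabs (bb j i) <= 2^-1) ->
  (forall j, \sum_q cabs (t j q) <= 4^-1) ->
  (forall j x, S x -> cabs (Y j x - (\sum_i bb j i * xi x 0 i +
     \sum_q t j q * \prod_l Y l x ^+ k q l)) <= eta) ->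
  forall j, approx 1 (2 * eta + 2 * theta ^+ L) (Y j).
Proof.
move=> th0 /andP[eta0 eta16] hb ht hY.
have tL0 : 0 <= theta ^+ L by rewrite exprn_ge0.
have tL : theta ^+ L <= 16^-1.
  apply: (@le_trans _ _ (theta ^+ 2)).
    by rewrite ler_wiXn2l// theta_le1.
  rewrite expr2 (_ : 16^-1 = 4^-1 * 4^-1 :> R); last by lra.
  by rewrite ler_pM.
have step (e : R) : 0 <= e <= 4^-1 -> (forall j, approx 1 e (Y j)) ->
    forall j, approx 1 (eta + (e + theta ^+ L) / 2) (Y j).
  move=> e01 he j; apply: approx_near (hY j) _.
  have h1 := approx_sum (index_enum _) (bb j) approx_xi.
  have h2 := approx_sum (index_enum _) (t j)
    (fun q => approx_monomial_Y (k q) e01 he).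
  apply: approx_le (approxD h1 h2).
    rewrite !mulr1 (le_trans (lerD (hb j) (ht j)))//; lra.
  rewrite mulr0 add0r; set s := \sum_(q <- _) _.
  have s4 : s <= 4^-1 by exact: ht.
  apply: (@le_trans _ _ (4^-1 * (2 * (e + theta ^+ L)))).
    by rewrite ler_wpM2r// mulr_ge0// addr_ge0//; have /andP[] := e01.
  lra.
have iter_step N : exists e : R, [/\ 0 <= e <= 4^-1,
    e <= 2 * eta + theta ^+ L + 2^-1 ^+ N * theta & forall j, approx 1 e (Y j)].
  elim: N => [|N [e [e01 eN he]]].
    exists theta; split.
    - by rewrite theta_ge0.
    - by rewrite expr0 mul1r lerDr addr_ge0// mulr_ge0.
    - by move=> j; apply: approx_le (approx0 (Y_le j)).
  exists (eta + (e + theta ^+ L) / 2); split; last exact: step.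
    by move: e01 => /andP[? ?]; apply/andP; split; lra.
  rewrite exprS -mulrA; set T := _ * theta in eN *; lra.
have [N hN] : exists N, 2^-1 ^+ N * theta <= theta ^+ L.
  have tL1 : 0 < theta ^+ L by rewrite exprn_gt0.
  exists (Num.trunc (theta ^+ L)^-1).+1.
  set m := (Num.trunc _).+1.
  apply: (@le_trans _ _ (2^-1 ^+ m)).
    by rewrite ler_piMr ?theta_le1// exprn_ge0.
  rewrite -[leRHS]invrK exprVn lef_pV2 ?posrE ?invr_gt0 ?exprn_gt0//.
  rewrite (le_trans (ltW (truncnS_gt _)))// -natrX ler_nat.
  by rewrite ltnW// ltn_expl.
have [e [_ eN he]] := iter_step N.
by move=> j; apply: approx_le (he j) => //; lra.
Qed.

End FixedPoint.

End Approximation.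

(** * Polynomials that are small on many small cells *)

Section Cells.
Variable R : realType.

Lemma exists_kernel_vector (T1 T2 : finType) (M : T1 -> T2 -> R[i]) :
  (#|T2| < #|T1|)%N ->
  exists c : T1 -> R[i], [/\ forall t, cabs (c t) <= 1, exists t, cabs (c t) = 1 &
    forall t2, \sum_t c t * M t t2 = 0].
Proof.
move=> lt21.
pose A : 'M[R[i]]_(#|T1|, #|T2|) := \matrix_(i, j) M (enum_val i) (enum_val j).
have kn0 : kermx A != 0.
  rewrite -mxrank_eq0 mxrank_ker subn_eq0 -ltnNge.
  exact: leq_ltn_trans (rank_leq_col A) lt21.
have [i vn0] : exists i, row i (kermx A) != 0.
  apply/existsP; apply: contraT; rewrite negb_exists => /forallP h.
  case/eqP: kn0; apply/row_matrixP => i; rewrite row0; apply/eqP.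
  by have := h i; rewrite negbK.
set v := row i (kermx A) in vn0.
have vA : v *m A = 0 by rewrite -row_mul mulmx_ker row0.
pose c0 t := v 0 (enum_rank t).
have [t0 ct0] : exists t, c0 t != 0.
  apply/existsP; apply: contraT; rewrite negb_exists => /forallP h.
  case/eqP: vn0; apply/rowP => j; rewrite [RHS]mxE; apply/eqP.
  by have := h (enum_val j); rewrite negbK /c0 enum_valK.
pose t1 := [arg max_(t > t0) cabs (c0 t)]%O.
have t1max t : cabs (c0 t) <= cabs (c0 t1).
  by rewrite /t1; case: arg_maxP => // u _; apply.
have ct1 : 0 < cabs (c0 t1) by apply: lt_le_trans (t1max t0); rewrite cabs_gt0.
exists (fun t => (c0 t1)^-1 * c0 t); split.
- move=> t; rewrite cabsM cabsV mulrC ler_pdivrMr// mul1r; exact: t1max.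
- by exists t1; rewrite mulVf ?cabs1// -cabs_gt0.
move=> t2; under eq_bigr do rewrite -mulrA.
rewrite -mulr_sumr (reindex (@enum_val T1 T1))/=; last first.
  by exists enum_rank => x _; rewrite ?enum_valK ?enum_rankK.
have := congr1 (fun B : 'rV_#|T2| => B 0 (enum_rank t2)) vA; rewrite !mxE => vA2.
rewrite (_ : \sum_(j < #|T1|) _ = 0) ?mulr0//.
rewrite -[RHS]vA2; apply: eq_bigr => j _.
by rewrite /c0 enum_valK [A j _]mxE enum_rankK.
Qed.

Section OneCell.
Variables (n : nat) (S : set 'rV[R[i]]_n) (mu L : nat) (theta : R).
Variable xi : 'rV[R[i]]_n -> 'rV[R[i]]_mu.
Hypothesis L_gt1 : (1 < L)%N.
Hypothesis theta_ge0 : 0 <= theta.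
Hypothesis theta_le : theta <= 4^-1.
Hypothesis xi_le : forall x i, S x -> cabs (xi x 0 i) <= theta.

(** Each multiplication by a coordinate costs at most a factor [6 * C], in the
    coefficients as well as in the error. *)
Lemma approx_monomial_coord (C omega : R) N (beta : {ffun 'I_n -> 'I_N}) :
  1 <= C -> theta ^+ L <= omega -> omega <= 1 ->
  (forall i, approx S L xi C (C * omega) (fun z => z 0 i)) ->
  approx S L xi ((6 * C) ^+ (n * N)) ((6 * C) ^+ (n * N) * omega)
    (fun z => \prod_i z 0 i ^+ beta i).
Proof.
move=> C1 tom om1 hC; have C0 : 0 <= C by apply: le_trans C1.
have tL0 : 0 <= theta ^+ L by rewrite exprn_ge0.
have om0 : 0 <= omega by apply: le_trans tom.
have sup A f : 0 <= A -> approx S L xi A (A * omega) f ->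
    forall x, S x -> cabs (f x) <= 2 * A.
  move=> A0 [a [aA fa]] x Sx.
  have -> : f x = f x - peval a (xi x) + peval a (xi x) by rewrite subrK.
  rewrite (le_trans (cabsD _ _))//.
  have h1 := fa x Sx.
  have h2 : A * omega <= A by rewrite ler_piMr.
  have h3 : cabs (peval a (xi x)) <= A.
    apply: le_trans (cabs_sum _ _ _) (le_trans _ aA); apply: ler_sum => al _.
    rewrite cabsM ler_piMr ?cabs_ge0//.
    exact: (monomial_le theta_le xi_le).
  lra.
have step A f i : 1 <= A -> approx S L xi A (A * omega) f ->
    approx S L xi (6 * C * A) (6 * C * A * omega) (fun z => f z * z 0 i).
  move=> A1 fA; have A0 : 0 <= A by apply: le_trans A1.
  have AO : 0 <= A * omega by rewrite mulr_ge0.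
  have CO : 0 <= C * omega by rewrite mulr_ge0.
  have AC : 0 <= A * C by rewrite mulr_ge0.
  have := approxM L_gt1 theta_ge0 theta_le xi_le AO CO (sup _ _ A0 fA)
    (sup _ _ C0 (hC i)) fA (hC i).
  apply: approx_le.
    by rewrite -mulrA [C * A]mulrC ler_peMl//; lra.
  have h1 : A * C * theta ^+ L <= A * C * omega by rewrite ler_wpM2l.
  have h2 : A * C * omega * omega <= A * C * omega.
    by rewrite ler_piMr// mulr_ge0.
  rewrite (_ : _ + _ = 4 * (A * C * omega) + A * C * omega * omega +
    A * C * theta ^+ L); last by ring.
  by rewrite (_ : 6 * C * A * omega = 6 * (A * C * omega)); [lra|ring].
pose P k f := approx S L xi ((6 * C) ^+ k) ((6 * C) ^+ k * omega) f.
have C6 : 1 <= 6 * C by lra.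
have Pmon k k' f : (k <= k')%N -> P k f -> P k' f.
  move=> kk'; have h : (6 * C) ^+ k <= (6 * C) ^+ k' by rewrite ler_weXn2l.
  by apply: approx_le => //; rewrite ler_wpM2r.
have PX k f i m : P k f -> P (m + k)%N (fun z => f z * z 0 i ^+ m).
  move=> Pf; elim: m => [|m IH].
    by under [X in P _ X]funext do rewrite expr0 mulr1.
  under [X in P _ X]funext do rewrite exprSr mulrA.
  rewrite /P addSn exprS; apply: step => //.
  by rewrite exprn_ege1.
have prodP (r : seq 'I_n) : P (N * size r)%N (fun z => \prod_(i <- r) z 0 i ^+ beta i).
  elim: r => [|i r IH].
    under [X in P _ X]funext do rewrite big_nil.
    rewrite /P muln0 expr0 mul1r; apply: approx_le (approx1 S xi L_gt1) => //.
  under [X in P _ X]funext do rewrite big_cons mulrC.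
  by rewrite /= mulnS; apply: Pmon (PX _ _ i (beta i) IH); rewrite leq_add2r ltnW.
have := prodP (index_enum _).
by rewrite /index_enum -enumT -cardE card_ord mulnC.
Qed.

End OneCell.

(** Dimension count: there are [N ^ n] coefficients and [L ^ mu] linear
    conditions on each cell. *)
Lemma small_on_cells (n N mu L : nat) (theta C omega : R) (Gam : finType)
    (S : Gam -> set 'rV[R[i]]_n) (xi : Gam -> 'rV[R[i]]_n -> 'rV[R[i]]_mu) :
  (1 < L)%N -> 0 <= theta <= 4^-1 -> 1 <= C ->
  theta ^+ L <= omega -> omega <= 1 ->
  (forall g x i, S g x -> cabs (xi g x 0 i) <= theta) ->
  (forall g i, approx (S g) L (xi g) C (C * omega) (fun z => z 0 i)) ->
  (#|Gam| * L ^ mu < N ^ n)%N ->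
  exists c : {ffun 'I_n -> 'I_N} -> R[i],
  [/\ forall beta, cabs (c beta) <= 1, exists beta, cabs (c beta) = 1 &
      forall g z, S g z ->
        cabs (peval c z) <= N%:R ^+ n * ((6 * C) ^+ (n * N) * omega)].
Proof.
move=> L1 /andP[th0 th4] C1 tom om1 xile hC count.
have hb (gb : Gam * {ffun 'I_n -> 'I_N}) :=
  approx_monomial_coord L1 th0 th4 (xile gb.1) gb.2 C1 tom om1 (hC gb.1).
have [a ha] := choice hb.
have [|c [c1 cmax c0]] := @exists_kernel_vector {ffun 'I_n -> 'I_N}
  (Gam * {ffun 'I_mu -> 'I_L})%type
  (fun beta gal => a (gal.1, beta) gal.2) _.
  by rewrite card_prod !card_ffun !card_ord.
exists c; split => // g z Sz.
have -> : peval c z = \sum_beta c beta *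
    (\prod_i z 0 i ^+ beta i - peval (a (g, beta)) (xi g z)).
  under [RHS]eq_bigr do rewrite mulrBr.
  rewrite sumrB [X in _ - X](_ : _ = 0) ?subr0//.
  under eq_bigr do rewrite /peval mulr_sumr.
  rewrite exchange_big big1//= => al _.
  under eq_bigr do rewrite mulrA.
  by rewrite -mulr_suml (c0 (g, al)) mul0r.
apply: le_trans (cabs_sum _ _ _) _.
have h beta : true -> cabs (c beta * (\prod_i z 0 i ^+ beta i -
    peval (a (g, beta)) (xi g z))) <= (6 * C) ^+ (n * N) * omega.
  move=> _; rewrite cabsM -[leRHS]mul1r ler_pM ?cabs_ge0//.
  by have [_ h] := ha (g, beta); exact: h.
apply: le_trans (ler_sum _ h) _.
by rewrite sumr_const card_ffun !card_ord -[leLHS]mulr_natl natrX.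
Qed.

End Cells.

(** * Coordinatewise Taylor expansion *)

Section Taylor1.
Variable R : realType.

Lemma is_derive_monomial (k : nat) (c t : R) :
  is_derive t 1 (fun u => c * (u ^+ k.+1 / k.+1`!%:R)) (c * (t ^+ k / k`!%:R)).
Proof.
have h := is_deriveZ (c / k.+1`!%:R) (is_deriveX k.+1 (is_derive_id t (1 : R))).
apply: is_derive_eq.
  have -> : (fun u => c * (u ^+ k.+1 / k.+1`!%:R)) =
      (c / k.+1`!%:R) \*: ((id : R -> R) ^+ k.+1).
    apply/funext => u /=; rewrite /GRing.scale/= .
    have -> : ((id : R -> R) ^+ k.+1) u = u ^+ k.+1.
      by elim: k {h} => // k IH; rewrite exprS [RHS]exprS -IH.
    by rewrite mulrCA mulrC.
  exact: h.
rewrite /GRing.scale /= mulr1 factS natrM invfM.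
by rewrite -mulrA; congr (c * _); rewrite mulrACA mulVf ?pnatr_eq0// mul1r mulrC.
Qed.

Lemma is_derive_taylor (c : nat -> R) L (t : R) :
  is_derive t 1 (fun u => \sum_(a < L.+1) c a * (u ^+ a / a`!%:R))
    (\sum_(a < L) c a.+1 * (t ^+ a / a`!%:R)).
Proof.
elim: L => [|L IH].
  rewrite big_ord0.
  under [X in is_derive _ _ X]funext do rewrite big_ord_recr big_ord0 /= add0r expr0.
  exact: is_derive_cst.
rewrite big_ord_recr /=.
under [X in is_derive _ _ X]funext do rewrite big_ord_recr /=.
exact: is_deriveD IH (is_derive_monomial _ _ _).
Qed.

Lemma is_derive_continuous (f : R -> R) (df t : R) :
  is_derive t 1 f df -> {for t, continuous f}.
Proof.
by move=> [h _]; apply: differentiable_continuous; apply/derivable1_diffP.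
Qed.

Lemma le_derive (f F df dF : R -> R) : 
  (forall t : R, 0 <= t <= 1 -> is_derive t 1 f (df t)) ->
  (forall t : R, 0 <= t <= 1 -> is_derive t 1 F (dF t)) ->
  (forall t, 0 <= t <= 1 -> df t <= dF t) -> f 0 = 0 -> F 0 = 0 ->
  forall t, 0 <= t <= 1 -> f t <= F t.
Proof.
move=> hf hF dfF f0 F0 t /andP[t0 t1].
have hD (u : R) : 0 <= u <= 1 -> is_derive u 1 (F - f) (dF u - df u).
  by move=> u01; exact: is_deriveB (hF u u01) (hf u u01).
have [||c] := @MVT_segment R (F - f) (fun u => dF u - df u) 0 t t0.
- move=> u; rewrite in_itv/= => /andP[u0 ut].
  by apply: hD; rewrite ltW//= (le_trans (ltW ut)).
- apply: continuous_in_subspaceT => u; rewrite inE/= in_itv/= => /andP[u0 ut].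
  by apply: is_derive_continuous (hD u _); rewrite u0 (le_trans ut).
rewrite in_itv/= => /andP[c0 ct]; rewrite subr0 => h.
have : 0 <= (F - f) t - (F - f) 0.
  rewrite h mulr_ge0// subr_ge0 dfF// c0 (le_trans ct)//.
by rewrite -[(F - f) t]/(F t - f t) -[(F - f) 0]/(F 0 - f 0) f0 F0; lra.
Qed.

(** By induction on [L]: the derivative of the remainder of [g 0] is the remainder
    of [g 1] at the preceding order. *)
Lemma taylor_remainder (g : nat -> R -> R) (M : R) L :
  (forall k (t : R), (k < L)%N -> 0 <= t <= 1 -> is_derive t 1 (g k) (g k.+1 t)) ->
  (forall t, 0 <= t <= 1 -> `|g L t| <= M) ->
  forall t, 0 <= t <= 1 ->
    `|g 0%N t - \sum_(a < L) g a 0 * (t ^+ a / a`!%:R)| <= M * (t ^+ L / L`!%:R).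
Proof.
elim: L g => [|L IH] g dg gM t t01.
  by rewrite big_ord0 subr0 expr0 fact0 divr1 mulr1 gM.
have {}IH (u : R) : 0 <= u <= 1 -> `|g 1%N u - \sum_(a < L) g a.+1 0 * (u ^+ a / a`!%:R)| <=
    M * (u ^+ L / L`!%:R).
  by apply: (IH (fun k => g k.+1)) => // k v kL v01; exact: dg.
pose phi := fun u : R => g 0%N u - \sum_(a < L.+1) g a 0 * (u ^+ a / a`!%:R).
have dphi (u : R) : 0 <= u <= 1 -> is_derive u 1 phi
    (g 1%N u - \sum_(a < L) g a.+1 0 * (u ^+ a / a`!%:R)).
  move=> u01; apply: is_deriveB; first exact: dg.
  exact: (@is_derive_taylor (fun a => g a 0)).
have phi0 : phi 0 = 0.
  rewrite /phi big_ord_recl expr0 fact0 divr1 mulr1 big1 ?addr0 ?subrr// => i _.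
  by rewrite expr0n /= mul0r mulr0.
have dM (u : R) : is_derive u 1 (fun v => M * (v ^+ L.+1 / L.+1`!%:R)) (M * (u ^+ L / L`!%:R)).
  exact: is_derive_monomial.
have M0 : M * (0 ^+ L.+1 / L.+1`!%:R) = 0 by rewrite expr0n/= mul0r mulr0.
rewrite -/(phi t) ler_norml; apply/andP; split; last first.
  apply: (le_derive dphi (fun u _ => dM u)) => // u u01.
  exact: le_trans (ler_norm _) (IH u u01).
rewrite lerNl.
apply: (@le_derive (- phi) _ _ _ (fun u u01 => is_deriveN (dphi u u01)) (fun u _ => dM u)) => //.
  by move=> u u01; rewrite (le_trans _ (IH u u01))// -normrN ler_norm.
by rewrite -[LHS]/(- phi 0) phi0 oppr0.
Qed.

End Taylor1.

Section Staircase.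
Variables (R : realType) (d : nat).
Implicit Types (x y p : 'rV[R]_d) (f : 'rV[R]_d -> R).

Lemma is_derive_along f y (j : 'I_d) (u : R) :
  derivable f (y + u *: delta_mx 0 j) (delta_mx 0 j) ->
  is_derive u 1 (fun v => f (y + v *: delta_mx 0 j))
    ('D_(delta_mx 0 j) f (y + u *: delta_mx 0 j)).
Proof.
have e : (fun h : R => h^-1 *: (((fun v => f (y + v *: delta_mx 0 j)) \o shift u)
    (h *: 1) - f (y + u *: delta_mx 0 j))) =
  (fun h : R => h^-1 *: ((f \o shift (y + u *: delta_mx 0 j)) (h *: delta_mx 0 j) -
     f (y + u *: delta_mx 0 j))).
  apply/funext => h /=; congr (_ *: (f _ - _)).
  have -> : h *: (1 : R) = h by rewrite /GRing.scale/= mulr1.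
  by rewrite scalerDl [RHS]addrCA.
move=> df; split; first by rewrite /derivable e.
by rewrite /derive e.
Qed.

Lemma is_derive_along_scaled f y (j : 'I_d) (u X : R) :
  derivable f (y + (u * X) *: delta_mx 0 j) (delta_mx 0 j) ->
  is_derive u 1 (fun v => f (y + (v * X) *: delta_mx 0 j))
    (X * 'D_(delta_mx 0 j) f (y + (u * X) *: delta_mx 0 j)).
Proof.
move=> /is_derive_along df.
have dX : is_derive u 1 (fun v : R => v * X) X.
  have := is_deriveZ X (is_derive_id u (1 : R)).
  rewrite /GRing.scale/= mulr1.
  by have -> : X \*: (id : R -> R) = (fun v => v * X)
    by apply/funext => v /=; rewrite /GRing.scale/= mulrC.
rewrite mulrC.
exact: (@is_derive1_comp _ (fun v => f (y + v *: delta_mx 0 j))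
  (fun v => v * X) u _ _ df dX).
Qed.

(** The corners of a staircase from [p] to [x], along which the coordinates change
    one at a time, so that only partial derivatives intervene. *)
Definition reset (s : seq 'I_d) p x : 'rV[R]_d :=
  \row_j (if j \in s then p 0 j else x 0 j).

Lemma reset_cons j s p x (X := x 0 j - p 0 j) : j \notin s ->
  reset s p x = reset (j :: s) p x + (1 * X) *: delta_mx 0 j.
Proof.
move=> js; apply/rowP => i; rewrite !mxE in_cons mul1r eqxx/=.
have [->|ij] /= := eqVneq i j; last by rewrite mulr0 addr0.
by rewrite (negPf js) mulr1 /X addrC subrK.
Qed.

Definition in_box (h : R) p y := forall j, `|y 0 j - p 0 j| <= h.

Lemma in_box_reset h s p x (t : R) (j : 'I_d) : in_box h p x -> 0 <= t <= 1 ->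
  j \notin s ->
  in_box h p (reset (j :: s) p x + (t * (x 0 j - p 0 j)) *: delta_mx 0 j).
Proof.
move=> hx /andP[t0 t1] js i; have h0 : 0 <= h by apply: le_trans (hx j).
rewrite !mxE in_cons eqxx/=; have [->|ij] /= := eqVneq i j.
  rewrite mulr1 addrAC subrr add0r normrM ger0_norm//.
  by rewrite (le_trans _ (hx j))// ler_piMl.
by rewrite mulr0 addr0; case: ifP; rewrite ?subrr ?normr0.
Qed.

Definition mfact (alpha : 'I_d -> nat) : nat := \prod_j (alpha j)`!.

Definition upd (alpha : 'I_d -> nat) j a : 'I_d -> nat :=
  fun i => if i == j then a else alpha i.

Lemma pderivs_cat js js' f : pderivs (js ++ js') f = pderivs js (pderivs js' f).
Proof. by rewrite /pderivs foldr_cat. Qed.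

(** Differentiating once more in the first coordinate that has been
    differentiated keeps the order of differentiation of [mderiv]. *)
Lemma mderiv_upd s1 s j alpha a f : enum 'I_d = s1 ++ j :: s ->
  (forall i, i \notin s -> alpha i = 0%N) ->
  mderiv (upd alpha j a) f = pderivs (nseq a j) (mderiv alpha f).
Proof.
move=> es al0; have us : uniq (s1 ++ j :: s) by rewrite -es enum_uniq.
have := us; rewrite cat_uniq /= negb_or.
move=> /and3P[_ /andP[js1 /hasPn s1s'] /andP[js _]].
have s1s i : i \in s1 -> i \notin s.
  by move=> is1; apply/negP => /s1s'; rewrite is1.
have flat0 (t : seq 'I_d) (be : 'I_d -> nat) : (forall i, i \in t -> be i = 0%N) ->
    flatten [seq nseq (be i) i | i <- t] = [::].
  elim: t => //= i t IH h; rewrite h ?mem_head//= IH// => k kt.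
  by rewrite h// in_cons kt orbT.
have e1 : flatten [seq nseq (upd alpha j a i) i | i <- enum 'I_d] =
    nseq a j ++ flatten [seq nseq (alpha i) i | i <- s].
  rewrite es map_cat flatten_cat flat0 /=; last first.
    move=> i is1; rewrite /upd; case: (eqVneq i j) => [ij|_]; last exact/al0/s1s.
    by move: js1; rewrite -ij is1.
  rewrite {1}/upd eqxx; congr (_ ++ flatten _); apply/eq_in_map => i si.
  by rewrite /upd; case: (eqVneq i j) => // ij; move: js; rewrite -ij si.
have e2 : flatten [seq nseq (alpha i) i | i <- enum 'I_d] =
    flatten [seq nseq (alpha i) i | i <- s].
  rewrite es map_cat flatten_cat flat0 /=; last by move=> i /s1s /al0.
  by rewrite al0.
by rewrite /mderiv e1 e2 pderivs_cat.
Qed.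

Section Expansion.
Variables (U : set 'rV[R]_d) (f : 'rV[R]_d -> R) (p x : 'rV[R]_d).
Variables (h D q : R) (L : nat).
Hypothesis smooth_f : smooth_on U f.
Hypothesis boxU : forall y, in_box h p y -> U y.
Hypothesis L_gt0 : (0 < L)%N.
Hypothesis h_ge0 : 0 <= h.
Hypothesis q_ge0 : 0 <= q.
Hypothesis q_le : q <= 2^-1.
Hypothesis D_ge0 : 0 <= D.
Hypothesis mderiv_le : forall alpha y, in_box h p y -> (forall j, alpha j <= L)%N ->
  `|mderiv alpha f y| * h ^+ (\sum_j alpha j) <=
  D * q ^+ (\sum_j alpha j) * (mfact alpha)%:R.
Hypothesis box_x : in_box h p x.

Definition supported (s : seq 'I_d) (alpha : {ffun 'I_d -> 'I_L}) :=
  [forall i, (i \notin s) ==> (alpha i == 0 :> nat)].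

Definition degs (alpha : {ffun 'I_d -> 'I_L}) : 'I_d -> nat := fun j => alpha j.

Definition taylor_term y (alpha : {ffun 'I_d -> 'I_L}) : R :=
  mderiv (degs alpha) f y / (mfact (degs alpha))%:R *
  \prod_j (x 0 j - p 0 j) ^+ alpha j.

Lemma sum_geometric_ffun : \sum_(alpha : {ffun 'I_d -> 'I_L})
  q ^+ (\sum_j alpha j) <= 2 ^+ d.
Proof.
under eq_bigr do rewrite expr_sum.
rewrite -(bigA_distr_bigA (fun (j : 'I_d) (a : 'I_L) => q ^+ a)).
rewrite -[X in _ <= _ ^+ X]card_ord -prodr_const; apply: ler_prod => j _.
rewrite sumr_ge0/= => [|a _]; last by rewrite exprn_ge0.
have := subrX1 q L; have : 0 <= q ^+ L by rewrite exprn_ge0.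
set s := \sum_(_ < _) _; move=> qL e.
have s0 : 0 <= s by rewrite sumr_ge0// => a _; rewrite exprn_ge0.
have h1 : (1 - q) * s <= 1 by rewrite -opprB mulNr -e; lra.
have h2 : q * s <= 2^-1 * s by rewrite ler_wpM2r.
move: h1; rewrite mulrBl mul1r; lra.
Qed.

Definition updf (alpha : {ffun 'I_d -> 'I_L}) j (a : 'I_L) : {ffun 'I_d -> 'I_L} :=
  [ffun i => if i == j then a else alpha i].

Lemma sum_supported_cons j s (F : {ffun 'I_d -> 'I_L} -> R) : j \notin s ->
  \sum_(alpha | supported (j :: s) alpha) F alpha =
  \sum_(alpha | supported s alpha) \sum_a F (updf alpha j a).
Proof.
move=> js; pose o := Ordinal L_gt0.
rewrite (partition_big (fun alpha => updf alpha j o) (supported s))/=; last first.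
  move=> alpha /forallP sa; apply/forallP => i; apply/implyP => iS.
  rewrite ffunE; case: (eqVneq i j) => [//|ij].
  by have := sa i; rewrite in_cons negb_or ij iS.
apply: eq_bigr => alpha sa.
rewrite (reindex_onto (fun a => updf alpha j a) (fun al => al j))/=.
  apply: eq_bigl => a; rewrite ffunE eqxx eqxx andbT.
  apply/andP; split.
    apply/forallP => i; apply/implyP; rewrite in_cons negb_or => /andP[ij iS].
    by rewrite ffunE (negPf ij); have /forallP /(_ i) := sa; rewrite iS.
  apply/eqP/ffunP => i; rewrite !ffunE; case: (eqVneq i j) => [->|//].
  by apply/val_inj; have /forallP /(_ j) := sa; rewrite js/= => /eqP ->.
move=> al /andP[_ /eqP <-]; apply/ffunP => i; rewrite !ffunE.
by case: (eqVneq i j) => [->|].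
Qed.

Lemma mfact_upd (alpha : 'I_d -> nat) j a : alpha j = 0%N ->
  mfact (upd alpha j a) = (mfact alpha * a`!)%N.
Proof.
move=> aj; rewrite /mfact (bigD1 j)//= [in RHS](bigD1 j)//= aj fact0 mul1n mulnC.
rewrite {2}/upd eqxx; congr (_ * _)%N; apply: eq_bigr => i /negPf ij.
by rewrite /upd ij.
Qed.

Lemma sum_upd (alpha : 'I_d -> nat) j a : alpha j = 0%N ->
  (\sum_i upd alpha j a i = \sum_i alpha i + a)%N.
Proof.
move=> aj; rewrite (bigD1 j)//= [in RHS](bigD1 j)//= aj add0n addnC.
rewrite {2}/upd eqxx; congr (_ + _)%N; apply: eq_bigr => i /negPf ij.
by rewrite /upd ij.
Qed.

Lemma prod_upd (z : 'I_d -> R) (alpha : 'I_d -> nat) j a : alpha j = 0%N ->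
  \prod_i z i ^+ upd alpha j a i = (\prod_i z i ^+ alpha i) * z j ^+ a.
Proof.
move=> aj; rewrite (bigD1 j)//= [in RHS](bigD1 j)//= aj expr0 mul1r mulrC.
rewrite {2}/upd eqxx; congr (_ * _); apply: eq_bigr => i /negPf ij.
by rewrite /upd ij.
Qed.

Lemma mfact_gt0 (alpha : 'I_d -> nat) : (0 < mfact alpha)%N.
Proof. by rewrite prodn_gt0// => i; rewrite fact_gt0. Qed.

(** Taylor's formula in the coordinate [j] alone, applied to each of the
    derivatives in the coordinates that have been expanded already. *)
Lemma taylor_step s1 s j : enum 'I_d = s1 ++ j :: s ->
  `|\sum_(alpha | supported s alpha) taylor_term (reset s p x) alpha -
    \sum_(alpha | supported (j :: s) alpha) taylor_term (reset (j :: s) p x) alpha|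
  <= 2 ^+ d * D * q ^+ L.
Proof.
move=> es; have js : j \notin s.
  have : uniq (s1 ++ j :: s) by rewrite -es enum_uniq.
  by rewrite cat_uniq /= => /and4P[].
rewrite (sum_supported_cons _ js) -sumrB.
apply: le_trans (ler_norm_sum _ _ _) _.
apply: (@le_trans _ _ (\sum_(alpha : {ffun 'I_d -> 'I_L})
    q ^+ (\sum_i alpha i) * (D * q ^+ L))); last first.
  rewrite -mulr_suml mulrA ler_wpM2r ?exprn_ge0//.
  by rewrite ler_wpM2r// sum_geometric_ffun.
rewrite big_mkcond; apply: ler_sum => alpha _; case: ifP => sa; last first.
  by rewrite !mulr_ge0 ?exprn_ge0.
have al0 i : i \notin s -> degs alpha i = 0%N.
  by move=> iS; move/forallP: sa => /(_ i); rewrite iS => /eqP.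
have alj : degs alpha j = 0%N by exact: al0.
set X := x 0 j - p 0 j.
pose yt (t : R) := reset (j :: s) p x + (t * X) *: delta_mx 0 j.
pose W := (\prod_i (x 0 i - p 0 i) ^+ alpha i) / (mfact (degs alpha))%:R.
pose g a (t : R) := W * X ^+ a * mderiv (upd (degs alpha) j a) f (yt t).
have box_yt (t : R) : 0 <= t <= 1 -> in_box h p (yt t) by move=> t01; exact: in_box_reset.
have dg k (t : R) : (k < L)%N -> 0 <= t <= 1 -> is_derive t 1 (g k) (g k.+1 t).
  move=> _ t01.
  have dk : derivable (mderiv (upd (degs alpha) j k) f) (yt t) (delta_mx 0 j).
    by have [_ dj] := smooth_f (flatten [seq nseq (upd (degs alpha) j k i) i | i <- enum 'I_d])
      (boxU (box_yt t t01)); exact: dj.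
  have := is_deriveZ (W * X ^+ k) (is_derive_along_scaled dk).
  rewrite /GRing.scale/= /g exprS (mderiv_upd k.+1 _ es al0) /=.
  rewrite -/(pderivs (nseq k j) (mderiv (degs alpha) f)).
  rewrite -(mderiv_upd k _ es al0).
  by rewrite (_ : W * (X * X ^+ k) = W * X ^+ k * X) -?mulrA// [X * X ^+ k]mulrC.
have mf0 : 0 < (mfact (degs alpha))%:R :> R by rewrite ltr0n mfact_gt0.
have Wh : `|W| <= h ^+ (\sum_i alpha i) / (mfact (degs alpha))%:R.
  rewrite /W normrM normfV (gtr0_norm mf0) ler_pM2r ?invr_gt0//.
  rewrite normr_prod expr_sum; apply: ler_prod => i _.
  by rewrite normr_ge0/= normrX lerXn2r ?nnegrE.
pose M := D * q ^+ (\sum_i alpha i + L) * L`!%:R.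
have gM (t : R) : 0 <= t <= 1 -> `|g L t| <= M.
  move=> t01; have lealL i : (upd (degs alpha) j L i <= L)%N.
    rewrite /upd; case: ifP => // _; exact: ltnW (ltn_ord _).
  have := mderiv_le (box_yt t t01) lealL.
  rewrite mfact_upd// sum_upd// natrM => hm.
  rewrite /g (normrM (W * _)) (normrM W) normrX.
  set m : R := `|mderiv _ _ _| in hm *.
  apply: (@le_trans _ _ (h ^+ (\sum_i alpha i) / (mfact (degs alpha))%:R * h ^+ L * m)).
    apply: ler_wpM2r; first exact: normr_ge0.
    apply: ler_pM => //.
    by rewrite lerXn2r ?nnegrE//; exact: box_x.
  rewrite (_ : _ * m = m * h ^+ (\sum_i degs alpha i + L) / (mfact (degs alpha))%:R).
    rewrite ler_pdivrMr// (le_trans hm)// /M -!mulrA ler_wpM2l//.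
    by rewrite [(mfact _)%:R * _]mulrC.
  rewrite -[(\sum_i alpha i)%N]/(\sum_i degs alpha i)%N exprD.
  by move: (mfact _)%:R^-1 => F; ring.
have one01 : 0 <= (1 : R) <= 1 by rewrite ler01 lexx.
have := taylor_remainder dg gM one01.
have -> : g 0%N 1 = taylor_term (reset s p x) alpha.
  rewrite /g expr0 mulr1 /taylor_term /W /yt -reset_cons//.
  have -> : upd (degs alpha) j 0 = degs alpha.
    by apply/funext => i; rewrite /upd; case: (eqVneq i j) => [->|].
  by rewrite mulrC mulrA mulrAC.
have -> : \sum_(a < L) g a 0 * (1 ^+ a / a`!%:R) =
    \sum_a taylor_term (reset (j :: s) p x) (updf alpha j a).
  apply: eq_bigr => a _; rewrite expr1n mul1r /g /taylor_term /W.
  have -> : degs (updf alpha j a) = upd (degs alpha) j a.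
    by apply/funext => i; rewrite /degs ffunE /upd; case: ifP.
  have -> : yt 0 = reset (j :: s) p x by rewrite /yt mul0r scale0r addr0.
  have -> : \prod_i (x 0 i - p 0 i) ^+ updf alpha j a i =
      \prod_i (x 0 i - p 0 i) ^+ upd (degs alpha) j a i.
    by apply: eq_bigr => i _; rewrite ffunE /upd; case: ifP.
  rewrite prod_upd// mfact_upd// natrM invfM /X.
  set m := mderiv _ _ _; set F := (mfact _)%:R; set P := \prod_i _.
  rewrite -/P; ring.
rewrite expr1n mul1r => /le_trans; apply.
rewrite /M mulfK; last by rewrite pnatr_eq0 -lt0n fact_gt0.
by rewrite exprD mulrCA.
Qed.

Lemma taylor_expansion :
  `|f x - \sum_alpha taylor_term p alpha| <= d%:R * (2 ^+ d * D * q ^+ L).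
Proof.
have main s1 s : enum 'I_d = s1 ++ s ->
    `|f x - \sum_(alpha | supported s alpha) taylor_term (reset s p x) alpha| <=
    (size s)%:R * (2 ^+ d * D * q ^+ L).
  elim: s s1 => [|j s IH] s1 es.
    pose o : {ffun 'I_d -> 'I_L} := [ffun=> Ordinal L_gt0].
    rewrite (eq_bigl (pred1 o)) => [|al]; last first.
      apply/forallP/eqP => [h0|-> i]; last by rewrite ffunE.
      by apply/ffunP => i; apply/val_inj; rewrite ffunE; apply/eqP/(h0 i).
    rewrite big_pred1_eq mul0r /taylor_term.
    have o0 : degs o = (fun=> 0%N) by apply/funext => i; rewrite /degs ffunE.
    rewrite o0 /mfact big1// divr1 big1 => [|i _]; last by rewrite ffunE expr0.
    have -> : reset [::] p x = x by apply/rowP => i; rewrite mxE.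
    rewrite mulr1 /mderiv.
    have -> : flatten [seq nseq 0 i | i <- enum 'I_d] = [::].
      by elim: (enum 'I_d).
    by rewrite subrr normr0.
  have := IH (rcons s1 j); rewrite cat_rcons => /(_ es) h1.
  have h2 := taylor_step es.
  rewrite -(subrK (\sum_(alpha | supported s alpha) taylor_term (reset s p x) alpha) (f x)).
  rewrite -addrA (le_trans (ler_normD _ _))//= .
  by rewrite -[X in X%:R]addn1 natrD mulrDl mul1r lerD.
have := main [::] (enum 'I_d) erefl.
rewrite size_enum_ord (eq_bigl xpredT) => [|al]; last first.
  by apply/forallP => i; rewrite mem_enum.
have -> // : reset (enum 'I_d) p x = p by apply/rowP => i; rewrite mxE mem_enum.
Qed.

End Expansion.
End Staircase.

(** * Gevrey charts *)

Section Weights.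
Variable R : realType.

Lemma fact_le_exp L a : (a <= L)%N -> (a`! <= L ^ a.-1)%N.
Proof.
case: a => // a; elim: a => // a IH aL.
by rewrite factS /= expnS leq_mul// IH// ltnW.
Qed.

Lemma mfact_le_exp d L (alpha : 'I_d -> nat) : (0 < L)%N ->
  (forall j, alpha j <= L)%N -> (mfact alpha <= L ^ (\sum_j alpha j).-1)%N.
Proof.
move=> L0 aL; apply: (@leq_trans (L ^ \sum_j (alpha j).-1)).
  rewrite expn_sum; apply: leq_prod => j _; exact: fact_le_exp.
rewrite leq_pexp2l//.
elim: (index_enum _) => [|j r IH]; rewrite ?big_nil// !big_cons.
by move: IH; lia.
Qed.

(** Up to order [L] the Gevrey weights grow geometrically.  The exponent is one
    less than the degree, which compensates for a division by the size of the
    cells later on. *)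
Lemma mfact_powR_le d L (s : R) (alpha : 'I_d -> nat) : (0 < L)%N -> 1 <= s ->
  (forall j, alpha j <= L)%N ->
  (mfact alpha)%:R `^ s <=
  (mfact alpha)%:R * (L%:R `^ (s - 1)) ^+ (\sum_j alpha j).-1.
Proof.
move=> L0 s1 aL; have F0 : 0 < (mfact alpha)%:R :> R by rewrite ltr0n mfact_gt0.
have e : s = (s - 1) + 1 by rewrite subrK.
rewrite {1}e powRD; last by rewrite (gt_eqF F0) implybT.
rewrite powRr1 ?ler0n// mulrC ler_pM2l// -powR_mulrn ?powR_ge0//.
rewrite -powRrM mulrC powRrM.
rewrite powR_mulrn// ge0_ler_powR ?subr_ge0 ?nnegrE ?exprn_ge0//.
by rewrite -natrX ler_nat mfact_le_exp.
Qed.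

Lemma exists_powR_gt (c g : R) : 0 < g ->
  exists N : nat, (1 < N)%N /\ c < N%:R `^ g.
Proof.
move=> g0; pose c1 := Num.max c 1.
have c10 : 0 < c1 by rewrite lt_max ltr01 orbT.
exists (Num.trunc (c1 `^ g^-1)).+2; split => //.
apply: (@le_lt_trans _ _ ((c1 `^ g^-1) `^ g)).
  by rewrite -powRrM mulVf ?gt_eqF// powRr1 ?(ltW c10)// le_max lexx.
apply: gt0_ltr_powR; rewrite ?nnegrE ?powR_ge0//.
by rewrite (lt_le_trans (truncnS_gt _))// ler_nat.
Qed.

Lemma truncn_eq_dist (u v : R) : 0 <= u -> 0 <= v ->
  Num.trunc u = Num.trunc v -> `|u - v| <= 1.
Proof.
move=> u0 v0 uv; have /andP[h1 h2] := truncn_itv u0.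
have := truncn_itv v0; rewrite -uv => /andP[h3 h4].
move: h2 h4; rewrite -natr1; set t := (Num.trunc u)%:R in h1 h3 * => h2 h4.
by rewrite ler_norml; apply/andP; split; lra.
Qed.

End Weights.

(** The zero set of [rho] in a box around [x0], where [J] is the matrix of the
    differentials at [x0].  By [split1] a point is determined by [J x] and
    by its coordinates [Q x], which suffice for the points of the kernel of [J].  The variation
    [kappa] of the differentials and the scale [q1] have to be small with respect
    to the size [b2] of [D]. *)
Section Chart.
Variables (R : realType) (d K mu : nat).
Variable rho : 'I_K -> 'rV[R]_d -> R.
Variables (U : set 'rV[R]_d) (x0 : 'rV[R]_d).
Variables (J : 'M[R]_(K, d)) (B : 'M[R]_(d, mu)) (Q : 'M[R]_(mu, d))
  (D : 'M[R]_(d, K)).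
Variables (s r0 C kappa b1 b2 q1 : R).
Hypothesis s_ge1 : 1 <= s.
Hypothesis r0_gt0 : 0 < r0.
Hypothesis C_ge1 : 1 <= C.
Hypothesis kappa_ge0 : 0 <= kappa.
Hypothesis split1 : 1%:M = B *m Q + D *m J.
Hypothesis smooth_rho : forall k, smooth_on U (rho k).
Hypothesis boxU : forall y, in_box (r0 + r0) x0 y -> U y.
Hypothesis gevrey_rho : forall k (alpha : 'I_d -> nat) y,
  in_box (r0 + r0) x0 y ->
  `|mderiv alpha (rho k) y| <=
  C ^+ (\sum_j alpha j).+1 * (mfact alpha)%:R `^ s.
Hypothesis jacobian_near : forall k j y, in_box (r0 + r0) x0 y ->
  `|'D_(delta_mx 0 j) (rho k) y - J k j| <= kappa.
Hypothesis B_le : forall j, \sum_i `|B j i| <= b1.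
Hypothesis D_le : forall j, \sum_k `|D j k| <= b2.
Hypothesis b1_ge0 : 0 <= b1.
Hypothesis b2_ge0 : 0 <= b2.
Hypothesis kappa_le : b2 * (d%:R * kappa) <= 8^-1.
Hypothesis q1_gt0 : 0 < q1.
Hypothesis q1_le : q1 <= 2^-1.
Hypothesis q1_small : b2 * (C ^+ 2 * 2 ^+ d * q1 ^+ 2) <= 8^-1.

Definition lin a (M : 'M[R]_(a, d)) (i : 'I_a) (x : 'rV[R]_d) : R :=
  \sum_l M i l * x 0 l.

Definition piece : set 'rV[R]_d :=
  [set x | in_box r0 x0 x /\ forall k, rho k x = 0].

Lemma coord_split (X : 'rV[R]_d) j :
  X 0 j = \sum_i B j i * lin Q i X + \sum_k D j k * lin J k X.
Proof.
have := congr1 (fun M : 'M[R]_(d, 1) => M j 0) (mul1mx X^T).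
rewrite split1 mulmxDl -!mulmxA !mxE => <-.
by congr (_ + _); apply: eq_bigr => i _; rewrite !mxE; congr (_ * _);
  apply: eq_bigr => l _; rewrite !mxE.
Qed.

Lemma in_box_le (h1 h2 : R) (p y : 'rV[R]_d) : h1 <= h2 -> in_box h1 p y ->
  in_box h2 p y.
Proof. by move=> h12 hy j; rewrite (le_trans (hy j)). Qed.

Lemma in_box_trans (h1 h2 : R) (p y z : 'rV[R]_d) : in_box h1 p y -> in_box h2 y z ->
  in_box (h1 + h2) p z.
Proof.
move=> hy hz j; rewrite -(subrK (y 0 j) (z 0 j)) -addrA addrC.
by rewrite (le_trans (ler_normD _ _))// lerD// ?hy ?hz// addrC.
Qed.

Lemma in_box_convex (h : R) (p x y : 'rV[R]_d) (t : R) (j : 'I_d) u :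
  in_box h p x -> in_box h p y -> 0 <= t <= 1 -> j \notin u ->
  in_box h p (reset (j :: u) y x + (t * (x 0 j - y 0 j)) *: delta_mx 0 j).
Proof.
move=> hx hy /andP[t0 t1] ju i.
rewrite !mxE in_cons eqxx/=; have [->|ij] /= := eqVneq i j; last first.
  by rewrite mulr0 addr0; case: ifP.
rewrite mulr1 (_ : _ - p 0 j = t * (x 0 j - p 0 j) + (1 - t) * (y 0 j - p 0 j)); last by ring.
have t1' : 0 <= 1 - t by rewrite subr_ge0.
rewrite (le_trans (ler_normD _ _))// !normrM (ger0_norm t0) (ger0_norm t1').
have : t * `|x 0 j - p 0 j| <= t * h by rewrite ler_wpM2l.
have : (1 - t) * `|y 0 j - p 0 j| <= (1 - t) * h.
  by rewrite ler_wpM2l// subr_ge0.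
rewrite mulrBl mul1r; lra.
Qed.

Lemma mean_value k (x y : 'rV[R]_d) (M : R) :
  in_box (r0 + r0) x0 x -> in_box (r0 + r0) x0 y ->
  (forall j, `|x 0 j - y 0 j| <= M) ->
  `|rho k x - rho k y - lin J k (x - y)| <= d%:R * (kappa * M).
Proof.
move=> hx hy xyM.
have main s1 u : enum 'I_d = s1 ++ u ->
    `|rho k x - rho k (reset u y x) - \sum_(j <- u) J k j * (x 0 j - y 0 j)| <=
    (size u)%:R * (kappa * M).
  elim: u s1 => [|j u IH] s1 es.
    have -> : reset [::] y x = x by apply/rowP => i; rewrite mxE.
    by rewrite big_nil subrr subr0 normr0 mul0r.
  have ju : j \notin u.
    have : uniq (s1 ++ j :: u) by rewrite -es enum_uniq.
    by rewrite cat_uniq /= => /and4P[].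
  set X := x 0 j - y 0 j.
  pose yt (t : R) := reset (j :: u) y x + (t * X) *: delta_mx 0 j.
  pose g a (t : R) := if a is 0%N then rho k (yt t) - t * (J k j * X) else
    X * 'D_(delta_mx 0 j) (rho k) (yt t) - J k j * X.
  have hyt (t : R) : 0 <= t <= 1 -> in_box (r0 + r0) x0 (yt t).
    by move=> t01; exact: in_box_convex.
  have dg a (t : R) : (a < 1)%N -> 0 <= t <= 1 -> is_derive t 1 (g a) (g a.+1 t).
    rewrite ltnS leqn0 => /eqP -> t01.
    have [_ /(_ j) dj] := @smooth_rho k [::] _ (boxU (hyt t t01)).
    have dX : is_derive t 1 (fun v : R => v * (J k j * X)) (J k j * X).
      have := is_deriveZ (J k j * X) (is_derive_id t (1 : R)).
      rewrite /GRing.scale/= mulr1.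
      by have -> : (J k j * X) \*: (id : R -> R) = (fun v => v * (J k j * X))
        by apply/funext => v /=; rewrite /GRing.scale/= mulrC.
    exact: is_deriveB (is_derive_along_scaled dj) dX.
  have g1 (t : R) : 0 <= t <= 1 -> `|g 1%N t| <= kappa * M.
    move=> t01; rewrite /g mulrC -mulrBl normrM ler_pM ?jacobian_near ?xyM//.
    exact: hyt.
  have one01 : 0 <= (1 : R) <= 1 by rewrite ler01 lexx.
  have := taylor_remainder dg g1 one01.
  rewrite big_ord_recl big_ord0 expr0 expr1 fact0 /= mul1r mul0r subr0 divr1 !mulr1 addr0.
  have -> : yt 1 = reset u y x by rewrite /yt -reset_cons.
  have -> : yt 0 = reset (j :: u) y x by rewrite /yt mul0r scale0r addr0.
  move=> h1; have := IH (rcons s1 j); rewrite cat_rcons => /(_ es) h2.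
  rewrite big_cons -[X in X%:R]addn1 natrD mulrDl mul1r.
  apply: le_trans (lerD h2 h1).
  apply: le_trans (ler_normD _ _); rewrite le_eqVlt; apply/orP; left; apply/eqP.
  by congr (`| _ |); rewrite /X; ring.
have := main [::] (enum 'I_d) erefl; rewrite size_enum_ord.
have -> : reset (enum 'I_d) y x = y by apply/rowP => i; rewrite mxE mem_enum.
rewrite big_enum_cond/= /lin.
by under [in X in _ -> X]eq_bigr do rewrite !mxE.
Qed.

(** The zero set is a Lipschitz graph over the coordinates [Q x]: on the zero set
    [J (x - y)] is small with respect to [x - y], by the mean value theorem. *)
Lemma piece_lipschitz (x y : 'rV[R]_d) (w : R) : piece x -> piece y -> 0 <= w ->
  (forall i, `|lin Q i (x - y)| <= w) -> forall j, `|x 0 j - y 0 j| <= 2 * b1 * w.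
Proof.
move=> [hx rx] [hy ry] w0 hQ j0.
pose j1 := [arg max_(j > j0) `|x 0 j - y 0 j|]%O.
set M := `|x 0 j1 - y 0 j1|.
have Mmax j : `|x 0 j - y 0 j| <= M.
  by rewrite /M /j1; case: arg_maxP => // u _; apply.
have r0r0 : r0 <= r0 + r0 by rewrite lerDl ltW.
have hJ k : `|lin J k (x - y)| <= d%:R * (kappa * M).
  have := mean_value k (in_box_le r0r0 hx) (in_box_le r0r0 hy) Mmax.
  by rewrite rx ry subr0 sub0r normrN.
have M0 : 0 <= M by exact: normr_ge0.
suff : M <= b1 * w + 8^-1 * M.
  have b1w : 0 <= b1 * w by rewrite mulr_ge0.
  move=> h; apply: le_trans (Mmax j0) _; rewrite -mulrA; lra.
have -> : M = `|(x - y) 0 j1| by rewrite !mxE.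
rewrite {1}coord_split (le_trans (ler_normD _ _))// lerD//.
  apply: le_trans (ler_norm_sum _ _ _) _.
  apply: (@le_trans _ _ (\sum_i `|B j1 i| * w)).
    by apply: ler_sum => i _; rewrite normrM ler_wpM2l.
  by rewrite -mulr_suml ler_wpM2r.
have -> : `|(x - y) 0 j1| = M by rewrite !mxE.
apply: le_trans (ler_norm_sum _ _ _) _.
apply: (@le_trans _ _ (\sum_k `|D j1 k| * (d%:R * (kappa * M)))).
  by apply: ler_sum => k _; rewrite normrM ler_wpM2l.
rewrite -mulr_suml; apply: (@le_trans _ _ (b2 * (d%:R * (kappa * M)))).
  by rewrite ler_wpM2r// !mulr_ge0.
by rewrite !mulrA ler_wpM2r// -mulrA.
Qed.

Section Scale.
Variables (L : nat) (theta : R).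
Hypothesis L_gt1 : (1 < L)%N.
Hypothesis theta_gt0 : 0 < theta.
Hypothesis theta_le : theta <= 4^-1.

(** The loss of analyticity of a function of class [G^s], measured at the order
    of truncation [L]: its Taylor polynomials of order [L] behave like those of
    an analytic function with radius of convergence of order [1 / Lam]. *)
Definition Lam : R := L%:R `^ (s - 1).
(** The radius at which the Taylor coefficients of order [a] are of size
    [q1 ^ (4 a)], since [C * Lam * delta = q1 ^ 4]. *)
Definition delta : R := q1 ^+ 4 / (C * Lam).

Lemma Lam_ge1 : 1 <= Lam.
Proof.
have := ge0_ler_powR (_ : 0 <= s - 1); rewrite subr_ge0 => /(_ s_ge1 1 L%:R).
by rewrite powR1 !nnegrE => ->; rewrite ?ler1n// ltnW.
Qed.

Lemma C_gt0 : 0 < C. Proof. exact: lt_le_trans C_ge1. Qed.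
Lemma C_ge0 : 0 <= C. Proof. exact: ltW C_gt0. Qed.
Lemma Lam_gt0 : 0 < Lam. Proof. exact: lt_le_trans Lam_ge1. Qed.

Lemma delta_gt0 : 0 < delta.
Proof. by rewrite divr_gt0 ?exprn_gt0// mulr_gt0 ?C_gt0 ?Lam_gt0. Qed.

Lemma delta_ge0 : 0 <= delta. Proof. exact: ltW delta_gt0. Qed.

Lemma delta_CLam : C * Lam * delta = q1 ^+ 4.
Proof.
by rewrite /delta mulrC divfK// mulf_neq0 ?gt_eqF ?C_gt0 ?Lam_gt0.
Qed.

Definition unit_deg (l : 'I_d) : {ffun 'I_d -> 'I_L} :=
  [ffun i => if i == l then Ordinal L_gt1 else Ordinal (ltnW L_gt1)].

Lemma unit_degP (alpha : {ffun 'I_d -> 'I_L}) :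
  (\sum_j alpha j = 1)%N -> exists l, alpha = unit_deg l.
Proof.
move=> a1; have [l al] : exists l, alpha l != 0%N :> nat.
  apply/existsP; apply: contraT; rewrite negb_exists => /forallP h.
  by move: a1; rewrite big1// => i _; apply/eqP; have := h i; rewrite negbK.
exists l; move: a1; rewrite (bigD1 l)//= => a1.
have l1 : alpha l = 1%N :> nat.
  by apply/eqP; rewrite eqn_leq lt0n al andbT -a1 leq_addr.
have r0' : (\sum_(i | i != l) alpha i = 0)%N.
  by apply/eqP; rewrite -(eqn_add2l (alpha l)) addn0 a1 l1.
apply/ffunP => i; apply/val_inj; rewrite ffunE.
case: (eqVneq i l) => [->//|il] /=.
by move/eqP: r0'; rewrite sum_nat_eq0 => /forallP /(_ i); rewrite il => /eqP.
Qed.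

Lemma sum_unit_deg l : (\sum_j unit_deg l j = 1)%N.
Proof.
rewrite (bigD1 l)//= ffunE eqxx/= big1 ?addn0// => i /negPf il.
by rewrite ffunE il.
Qed.

Lemma prod_unit_deg l (X : 'I_d -> R) : \prod_j X j ^+ unit_deg l j = X l.
Proof.
rewrite (bigD1 l)//= ffunE eqxx/= expr1 big1 ?mulr1// => i /negPf il.
by rewrite ffunE il expr0.
Qed.

Lemma mderiv_unit_deg l (f : 'rV[R]_d -> R) :
  mderiv (degs (unit_deg l)) f = (fun x => 'D_(delta_mx 0 l) f x).
Proof.
have [s1 [s2 es]] : exists s1 s2, enum 'I_d = s1 ++ l :: s2.
  have : l \in enum 'I_d by rewrite mem_enum.
  by case/splitPr => s1 s2; exists s1, s2.
have -> : degs (unit_deg l) = upd (fun=> 0%N) l 1.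
  by apply/funext => i; rewrite /degs ffunE /upd; case: ifP.
rewrite (mderiv_upd 1 f es)// /mderiv.
have -> : flatten [seq nseq 0 i | i <- enum 'I_d] = [::] by elim: (enum 'I_d).
by [].
Qed.

(** Writing the equation [rho k x = 0] as [J (x - p) = ...], this is the
    coefficient of [(x - p) ^ alpha] on the right-hand side. *)
Definition tcoef (p : 'rV[R]_d) k (alpha : {ffun 'I_d -> 'I_L}) : R :=
  \sum_l (alpha == unit_deg l)%:R * J k l -
  mderiv (degs alpha) (rho k) p / (mfact (degs alpha))%:R.

(** The terms of degree one are small because the differentials vary little, and
    the constant term vanishes on the zero set; in degree [a >= 2], the estimate
    [q1 ^ (4 (a - 1))] has a factor [q1 ^ 2] to spare over [q1 ^ a]. *)
Lemma tcoef_le p k alpha : piece p ->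
  `|tcoef p k alpha| * delta ^+ (\sum_j alpha j) <=
  \sum_l (alpha == unit_deg l)%:R * (kappa * delta) +
  C ^+ 2 * q1 ^+ 2 * delta * q1 ^+ (\sum_j alpha j).
Proof.
move=> [hp rp]; have d0 := delta_gt0.
have r0r0 : r0 <= r0 + r0 by rewrite lerDl ltW.
have hp2 := in_box_le r0r0 hp.
have q0 : 0 <= q1 by rewrite ltW.
have rhs2 : 0 <= C ^+ 2 * q1 ^+ 2 * delta * q1 ^+ (\sum_j alpha j).
  rewrite mulr_ge0 ?exprn_ge0// mulr_ge0 ?delta_ge0//.
  by rewrite mulr_ge0 ?exprn_ge0 ?C_ge0.
have rhs1 : 0 <= \sum_l (alpha == unit_deg l)%:R * (kappa * delta).
  by apply: sumr_ge0 => l _; rewrite mulr_ge0// mulr_ge0 ?delta_ge0.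
have [[l al]|nal] := pselect (exists l, alpha = unit_deg l).
  have ul (i : 'I_d) : (alpha == unit_deg i) = (i == l).
    rewrite al; apply/eqP/eqP => [/ffunP /(_ i)|->//].
    by rewrite !ffunE eqxx; case: eqP => // _ /(congr1 val).
  rewrite /tcoef (bigD1 l)//= ul eqxx mul1r big1 ?addr0 => [|i /negPf il]; last first.
    by rewrite ul il mul0r.
  have -> : \sum_l0 (alpha == unit_deg l0)%:R * (kappa * delta) = kappa * delta.
    rewrite (bigD1 l)//= ul eqxx mul1r big1 ?addr0// => i /negPf il.
    by rewrite ul il mul0r.
  rewrite al sum_unit_deg expr1 mderiv_unit_deg.
  have -> : mfact (degs (unit_deg l)) = 1%N.
    rewrite /mfact big1// => i _; rewrite /degs ffunE.
    by case: ifP.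
  rewrite divr1 -[leLHS]addr0 lerD//; last first.
    by move: rhs2; rewrite al sum_unit_deg.
  by rewrite ler_wpM2r ?delta_ge0// distrC jacobian_near.
have nal' l : (alpha == unit_deg l) = false.
  by apply/eqP => h; apply: nal; exists l.
rewrite /tcoef big1 => [|l _]; last by rewrite nal' mul0r.
rewrite sub0r normrN.
case: (posnP (\sum_j alpha j)) => [a0|apos].
  have -> : mderiv (degs alpha) (rho k) p = 0.
    have -> : degs alpha = (fun=> 0%N).
      apply/funext => i; move/eqP: a0; rewrite sum_nat_eq0 => /forallP /(_ i) /=.
      by move/eqP.
    rewrite /mderiv.
    have -> : flatten [seq nseq 0 i | i <- enum 'I_d] = [::] by elim: (enum 'I_d).
    exact: rp.
  by rewrite mul0r normr0 mul0r addr_ge0.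
have a2 : (1 < \sum_j alpha j)%N.
  rewrite ltn_neqAle apos andbT; apply/eqP => /esym /unit_degP [l al].
  by apply: nal; exists l.
rewrite -[leLHS]add0r lerD//.
have F0 : 0 < (mfact (degs alpha))%:R :> R by rewrite ltr0n mfact_gt0.
rewrite normrM normfV (gtr0_norm F0).
have alL j : (degs alpha j <= L)%N by exact: ltnW (ltn_ord _).
have h1 : `|mderiv (degs alpha) (rho k) p| / (mfact (degs alpha))%:R <=
    C ^+ (\sum_j alpha j).+1 * Lam ^+ (\sum_j alpha j).-1.
  rewrite ler_pdivrMr// (le_trans (gevrey_rho k _ hp2))// -mulrA.
  rewrite ler_wpM2l ?exprn_ge0 ?(ltW C_gt0)// mulrC.
  exact: mfact_powR_le (ltnW L_gt1) s_ge1 alL.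
apply: le_trans (ler_wpM2r _ h1) _; first by rewrite exprn_ge0// ltW.
move: a2; set a := (\sum_j alpha j)%N; case: a => // a; rewrite ltnS => a0 /=.
have -> : C ^+ a.+2 * Lam ^+ a * delta ^+ a.+1 =
    C ^+ 2 * delta * (C * Lam * delta) ^+ a.
  move: (Lam) (delta) => u v; rewrite !exprMn !exprSr expr0.
  by move: (C ^+ a) (u ^+ a) (v ^+ a) => x y z; ring.
rewrite delta_CLam -exprM.
rewrite (_ : _ * q1 ^+ a.+1 = C ^+ 2 * delta * q1 ^+ (a.+1 + 2)); last first.
  by rewrite exprD; ring.
apply: ler_wpM2l.
  by apply: mulr_ge0; [rewrite exprn_ge0 ?C_ge0|exact: delta_ge0].
have q11 : q1 <= 1 by rewrite (le_trans q1_le)// invf_le1// ler1n.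
apply: (ler_wiXn2l q0 q11).
by rewrite addSnnS mulSn leq_add2l leq_pmulr.
Qed.

Definition Tcoef p j (alpha : {ffun 'I_d -> 'I_L}) : R :=
  \sum_k D j k * (tcoef p k alpha * delta ^+ (\sum_j alpha j)) / delta.

Lemma Tcoef_le p j : piece p -> \sum_alpha `|Tcoef p j alpha| <= 4^-1.
Proof.
move=> hp; have d0 := delta_gt0.
have q0 : 0 <= q1 by rewrite ltW.
pose tau := d%:R * kappa + C ^+ 2 * 2 ^+ d * q1 ^+ 2.
have htau k : \sum_alpha `|tcoef p k alpha| * delta ^+ (\sum_j alpha j) <= delta * tau.
  apply: le_trans (ler_sum _ (fun alpha _ => tcoef_le k alpha hp)) _.
  rewrite big_split /= exchange_big/=.
  rewrite (eq_bigr (fun=> kappa * delta)) => [|l _]; last first.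
    rewrite (bigD1 (unit_deg l))//= eqxx mul1r big1 ?addr0// => al /negPf ->.
    by rewrite mul0r.
  rewrite sumr_const card_ord -mulr_natl -mulr_sumr.
  have := sum_geometric_ffun d L q0 q1_le; set G := \sum_(_ | _) _ => hG.
  rewrite /tau mulrDr lerD//; first by rewrite le_eqVlt (_ : d%:R * (kappa * delta) = delta * (d%:R * kappa)) ?eqxx//; ring.
  rewrite (_ : delta * _ = C ^+ 2 * q1 ^+ 2 * delta * 2 ^+ d); last by ring.
  rewrite ler_wpM2l// mulr_ge0 ?delta_ge0//.
  by rewrite mulr_ge0 ?exprn_ge0 ?C_ge0.
apply: (@le_trans _ _ (\sum_k `|D j k| * tau)).
  apply: (@le_trans _ _ (\sum_alpha \sum_k `|D j k| *
      (`|tcoef p k alpha| * delta ^+ (\sum_j alpha j)) / delta)).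
    apply: ler_sum => al _; apply: le_trans (ler_norm_sum _ _ _) _.
    apply: ler_sum => k _; rewrite !normrM normfV normrX (gtr0_norm d0)//.
  rewrite exchange_big; apply: ler_sum => k _ /=.
  rewrite -mulr_suml -mulr_sumr -mulrA ler_wpM2l// ler_pdivrMr// mulrC.
  exact: htau.
rewrite -mulr_suml (@le_trans _ _ (b2 * tau))//.
  by rewrite ler_wpM2r// addr_ge0 ?mulr_ge0 ?exprn_ge0 ?C_ge0.
rewrite /tau mulrDr; move: kappa_le q1_small.
by set a1 := b2 * _; set a2 := b2 * _ => h1 h2; lra.
Qed.

(** Substituting the Taylor expansions at [p] of the equations into
    [x - p = B Q (x - p) + D J (x - p)], and rescaling by [delta], gives a
    contracting equation over [Q (x - p)]; the error is the Taylor remainder. *)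
Lemma cell_equation (p x : 'rV[R]_d) j : delta <= r0 -> piece p -> piece x ->
  in_box (theta * delta) p x ->
  `|(x 0 j - p 0 j) / delta - (\sum_i B j i * (lin Q i (x - p) / delta) +
     \sum_alpha Tcoef p j alpha * \prod_l ((x 0 l - p 0 l) / delta) ^+ alpha l)|
  <= b2 * d%:R * 2 ^+ d * C ^+ 2 * Lam * theta ^+ L.
Proof.
move=> dr0 hp hx xp; have d0 := delta_gt0.
have [hp1 rp] := hp; have [hx1 rx] := hx.
have th0 : 0 <= theta by rewrite ltW.
have h0 : 0 <= theta * delta by rewrite mulr_ge0// ltW.
have hr0 : theta * delta <= r0.
  apply: le_trans dr0; rewrite ler_piMl ?ltW//.
  by rewrite (le_lt_trans theta_le)// invf_lt1// ltr1n.
have box2 y : in_box (theta * delta) p y -> in_box (r0 + r0) x0 y.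
  by move=> hy; apply: in_box_trans hp1 (in_box_le hr0 hy).
pose q := theta * q1 ^+ 4.
have q0 : 0 <= q by rewrite mulr_ge0 ?exprn_ge0 ?ltW.
have q1_1 : q1 <= 1 by rewrite (le_trans q1_le)// invf_le1// ler1n.
have q12 : q <= 2^-1.
  apply: (@le_trans _ _ (theta * 1)).
    by rewrite ler_wpM2l//; apply: exprn_ile1; rewrite // ltW.
  by rewrite mulr1 (le_trans theta_le)// lef_pV2 ?posrE// ler_nat.
have md k alpha y : in_box (theta * delta) p y -> (forall i, alpha i <= L)%N ->
    `|mderiv alpha (rho k) y| * (theta * delta) ^+ (\sum_j alpha j) <=
    C * q ^+ (\sum_j alpha j) * (mfact alpha)%:R.
  move=> hy aL.
  have := gevrey_rho k alpha (box2 y hy).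
  have := mfact_powR_le (ltnW L_gt1) s_ge1 aL; rewrite -/Lam.
  set a := (\sum_j alpha j)%N; set F := (mfact alpha)%:R; set m := `|_| => hF hm.
  have F0 : 0 <= F by exact: ler0n.
  have hm2 : m <= C ^+ a.+1 * (F * Lam ^+ a).
    apply: le_trans hm _; rewrite ler_wpM2l ?exprn_ge0 ?(ltW C_gt0)//.
    apply: le_trans hF _; rewrite ler_wpM2l// ler_weXn2l ?Lam_ge1//.
    exact: leq_pred.
  apply: (@le_trans _ _ (C ^+ a.+1 * (F * Lam ^+ a) * (theta * delta) ^+ a)).
    by rewrite ler_wpM2r ?exprn_ge0.
  rewrite /q -delta_CLam le_eqVlt; apply/orP; left; apply/eqP.
  by rewrite exprS !exprMn; ring.
have C0 : 0 <= C by rewrite ltW// C_gt0.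
have tay k : `|\sum_(alpha : {ffun 'I_d -> 'I_L}) taylor_term (rho k) p x p alpha| <=
    d%:R * (2 ^+ d * C * q ^+ L).
  have boxU' y : in_box (theta * delta) p y -> U y by move=> hy; exact/boxU/box2.
  have := @taylor_expansion R d U (rho k) p x (theta * delta) C q L
    (smooth_rho k) boxU' (ltnW L_gt1) h0 q0 q12 C0 (md k) xp.
  by rewrite rx sub0r normrN.
have eJ k : lin J k (x - p) = \sum_alpha tcoef p k alpha *
      \prod_l (x 0 l - p 0 l) ^+ alpha l +
    \sum_(alpha : {ffun 'I_d -> 'I_L}) taylor_term (rho k) p x p alpha.
  rewrite -big_split /=.
  have -> : lin J k (x - p) = \sum_l J k l * \sum_(alpha : {ffun 'I_d -> 'I_L})
      (alpha == unit_deg l)%:R * \prod_i (x 0 i - p 0 i) ^+ alpha i.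
    apply: eq_bigr => l _; congr (_ * _).
    rewrite (bigD1 (unit_deg l))//= eqxx mul1r prod_unit_deg big1.
      by rewrite addr0 !mxE.
    by move=> al /negPf ->; rewrite mul0r.
  under [LHS]eq_bigr do rewrite mulr_sumr.
  rewrite exchange_big; apply: eq_bigr => al _ /=.
  rewrite /tcoef /taylor_term mulrBl subrK mulr_suml.
  by apply: eq_bigr => l _; rewrite mulrCA mulrA.
have eX : (x 0 j - p 0 j) / delta = \sum_i B j i * (lin Q i (x - p) / delta) +
    \sum_k D j k * lin J k (x - p) / delta.
  have := coord_split (x - p) j; rewrite !mxE => ->.
  by rewrite mulrDl !mulr_suml; congr (_ + _); apply: eq_bigr => i _; rewrite mulrA.
have eT : \sum_alpha Tcoef p j alpha * \prod_l ((x 0 l - p 0 l) / delta) ^+ alpha l =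
    \sum_k D j k * (\sum_alpha tcoef p k alpha *
      \prod_l (x 0 l - p 0 l) ^+ alpha l) / delta.
  rewrite /Tcoef; under eq_bigr do rewrite mulr_suml.
  rewrite exchange_big; apply: eq_bigr => k _ /=.
  rewrite mulr_sumr mulr_suml; apply: eq_bigr => al _.
  under [X in _ * X = _]eq_bigr do rewrite expr_div_n.
  rewrite big_split /= prodfV -expr_sum.
  have : delta ^+ (\sum_i al i) != 0 by rewrite expf_neq0// gt_eqF.
  set E := delta ^+ _; set P := \prod_(_ < _) _; set t := tcoef _ _ _ => E0.
  by field; rewrite E0 gt_eqF.
rewrite eX eT opprD addrACA subrr add0r -sumrB.
have -> : \sum_k (D j k * lin J k (x - p) / delta - D j k * (\sum_alpha
    tcoef p k alpha * \prod_l (x 0 l - p 0 l) ^+ alpha l) / delta) =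
  \sum_k D j k * (\sum_(alpha : {ffun 'I_d -> 'I_L}) taylor_term (rho k) p x p alpha) / delta.
  by apply: eq_bigr => k _; rewrite -mulrBl -mulrBr eJ addrAC subrr add0r.
apply: le_trans (ler_norm_sum _ _ _) _.
apply: (@le_trans _ _ (\sum_k `|D j k| * (d%:R * (2 ^+ d * C * q ^+ L) / delta))).
  apply: ler_sum => k _; rewrite !normrM normfV (gtr0_norm d0) -mulrA.
  by rewrite ler_wpM2l// ler_wpM2r// invr_ge0 ltW.
rewrite -mulr_suml (@le_trans _ _ (b2 * (d%:R * (2 ^+ d * C * q ^+ L) / delta)))//.
  by rewrite ler_wpM2r// !mulr_ge0 ?exprn_ge0// invr_ge0 ltW.
rewrite (_ : b2 * _ = b2 * d%:R * 2 ^+ d * C * (q ^+ L / delta)); last by ring.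
rewrite (_ : b2 * d%:R * 2 ^+ d * C ^+ 2 * Lam * _ =
  b2 * d%:R * 2 ^+ d * C * (C * Lam * theta ^+ L)); last by ring.
apply: ler_wpM2l; first by rewrite !mulr_ge0 ?exprn_ge0.
rewrite ler_pdivrMr// mulrAC delta_CLam /q exprMn mulrC ler_wpM2r ?exprn_ge0//.
rewrite -[leRHS]mulr1 -(prednK (ltnW L_gt1)) exprS ler_wpM2l ?exprn_ge0 ?(ltW q1_gt0)//.
by rewrite !exprn_ile1 ?exprn_ge0// ltW.
Qed.

(** Over a cell, [piece_lipschitz] keeps the rescaled coordinates below [theta],
    so that [approx_fixed_point] applies to [cell_equation].  The constant
    [2 * b1 + 1] is the Lipschitz constant, enlarged in order to be positive. *)
Lemma cell_approx (X : Type) (S : set X) (r : X -> 'rV[R]_d) (p : 'rV[R]_d)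
    (eta := b2 * d%:R * 2 ^+ d * C ^+ 2 * Lam * theta ^+ L) j :
  delta <= r0 -> piece p -> eta <= 16^-1 -> (forall z, S z -> piece (r z)) ->
  (forall z i, S z -> `|lin Q i (r z - p)| <= theta * delta / (2 * b1 + 1)) ->
  approx S L (fun z => \row_i ((2 * b1 + 1) / delta * lin Q i (r z - p))%:C)
    1 (2 * eta + 2 * theta ^+ L) (fun z => ((r z 0 j - p 0 j) / delta)%:C).
Proof.
move=> dr0 hp eta16 Sp Sw; have d0 := delta_gt0.
set b := 2 * b1 + 1; have b0 : 0 < b by rewrite ltr_wpDl// mulr_ge0.
have xi_le z i : S z -> cabs ((\row_i (b / delta * lin Q i (r z - p))%:C) 0 i) <= theta.
  move=> Sz; rewrite mxE cabs_real normrM (gtr0_norm (divr_gt0 b0 d0)).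
  rewrite mulrC mulrA ler_pdivrMr// -ler_pdivlMr//; exact: Sw.
have near_p z : S z -> in_box (theta * delta) p (r z).
  move=> Sz l; have w0 : 0 <= theta * delta / b.
    by apply: divr_ge0; [apply: mulr_ge0; exact: ltW|exact: ltW].
  apply: le_trans (piece_lipschitz (Sp z Sz) hp w0 (fun i => Sw z i Sz) l) _.
  rewrite mulrA ler_pdivrMr// mulrC; apply: ler_wpM2l; last by rewrite lerDl.
  by apply: mulr_ge0; exact: ltW.
have Y_le l z : S z -> cabs ((r z 0 l - p 0 l) / delta)%:C <= theta.
  move=> Sz; rewrite cabs_real normrM normfV (gtr0_norm d0) ler_pdivrMr//.
  exact: near_p.
have eta0 : 0 <= eta.
  by rewrite !mulr_ge0 ?exprn_ge0 ?C_ge0 ?(ltW Lam_gt0) ?(ltW theta_gt0).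
apply: (approx_fixed_point L_gt1 (ltW theta_gt0) theta_le xi_le Y_le
  (bb := fun j i => (B j i / b)%:C) (t := fun j al => (Tcoef p j al)%:C)
  (k := fun (al : {ffun 'I_d -> 'I_L}) l => al l) theta_gt0).
- by rewrite eta0.
- move=> l; under eq_bigr do rewrite cabs_real normrM normfV (gtr0_norm b0).
  rewrite -mulr_suml ler_pdivrMr// (le_trans (B_le l))// /b; lra.
- move=> l; under eq_bigr do rewrite cabs_real; exact: Tcoef_le.
move=> l z Sz.
have -> : \sum_i (B l i / b)%:C * (\row_i (b / delta * lin Q i (r z - p))%:C) 0 i =
    (\sum_i B l i * (lin Q i (r z - p) / delta))%:C :> R[i].
  rewrite rmorph_sum; apply: eq_bigr => i _; rewrite mxE -rmorphM; congr (_%:C).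
  by field; rewrite !gt_eqF.
have -> : \sum_q (Tcoef p l q)%:C * \prod_l0 ((r z 0 l0 - p 0 l0) / delta)%:C ^+ q l0 =
    (\sum_al Tcoef p l al * \prod_l0 ((r z 0 l0 - p 0 l0) / delta) ^+ al l0)%:C :> R[i].
  rewrite rmorph_sum; apply: eq_bigr => al _; rewrite rmorphM rmorph_prod.
  by congr (_ * _); apply: eq_bigr => i _; rewrite rmorphXn.
rewrite -rmorphD -rmorphB cabs_real.
by apply: cell_equation => //; [exact: Sp|exact: near_p].
Qed.

End Scale.

Section Embedding.
Variables (n : nat) (r : 'rV[R[i]]_n -> 'rV[R]_d) (e : 'I_n -> 'I_d -> R[i]).
Variables (e0 xb b3 : R).
Hypothesis coordE : forall (z : 'rV[R[i]]_n) i, z 0 i = \sum_j e i j * (r z 0 j)%:C.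
Hypothesis e_le : forall i, \sum_j cabs (e i j) <= e0.
Hypothesis x0_le : forall j, `|x0 0 j| + r0 <= xb.
Hypothesis Q_le : forall i, \sum_l `|Q i l| <= b3.
Hypothesis e0_ge0 : 0 <= e0.
Hypothesis xb_ge0 : 0 <= xb.
Hypothesis b3_ge0 : 0 <= b3.
Hypothesis q1_r0 : q1 <= r0.
Hypothesis dim_count : mu%:R * s < n%:R.

Definition Ccoord : R := 1 + e0 * (xb + r0).

Lemma Ccoord_ge1 : 1 <= Ccoord.
Proof. by rewrite lerDl mulr_ge0// addr_ge0// ltW. Qed.

Lemma delta_le_r0 L : (1 < L)%N -> delta L <= r0.
Proof.
move=> L1; apply: le_trans q1_r0; have h := delta_CLam L1.
have d0 := delta_ge0 L1; have CL : 1 <= C * Lam L.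
  by rewrite -[1]mulr1 ler_pM// Lam_ge1.
have : delta L <= C * Lam L * delta L by rewrite ler_peMl.
rewrite h => /le_trans; apply; rewrite exprS ler_piMr ?(ltW q1_gt0)//.
by rewrite exprn_ile1// ?(ltW q1_gt0)// (le_trans q1_le)// invf_le1// ler1n.
Qed.

Lemma coord_approx L theta (S : set 'rV[R[i]]_n) (p : 'rV[R]_d)
    (eta := b2 * d%:R * 2 ^+ d * C ^+ 2 * Lam L * theta ^+ L) i :
  (1 < L)%N -> 0 < theta -> theta <= 4^-1 ->
  piece p -> eta <= 16^-1 -> (forall z, S z -> piece (r z)) ->
  (forall z i, S z ->
     `|lin Q i (r z - p)| <= theta * delta L / (2 * b1 + 1)) ->
  approx S L (fun z => \row_i ((2 * b1 + 1) / delta L * lin Q i (r z - p))%:C)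
    Ccoord (Ccoord * (2 * eta + 2 * theta ^+ L)) (fun z => z 0 i).
Proof.
move=> L1 th0 th4 hp eta16 Sp Sw; set xi := fun z => _; set err := _ + _.
have d0 := delta_gt0 L1; have dr0 := delta_le_r0 L1.
have eta0 : 0 <= eta.
  by rewrite !mulr_ge0 ?exprn_ge0 ?C_ge0 ?(ltW (Lam_gt0 L1)) ?(ltW th0).
have err0 : 0 <= err by rewrite addr_ge0// mulr_ge0// exprn_ge0 ?ltW.
have hY j := cell_approx L1 th0 th4 j dr0 hp eta16 Sp Sw.
rewrite -/err -/xi in hY.
have h1 := approxZ (delta L)%:C (approx_sum (index_enum 'I_d) (e i) hY).
have h2 := approxZ (\sum_j e i j * (p 0 j)%:C) (approx1 S xi L1).
have de : delta L * \sum_j cabs (e i j) <= e0 * r0.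
  by rewrite mulrC ler_pM ?(ltW d0)// sumr_ge0// => j _; rewrite cabs_ge0.
have pe : cabs (\sum_j e i j * (p 0 j)%:C) <= e0 * xb.
  apply: le_trans (cabs_sum _ _ _) _.
  apply: (@le_trans _ _ (\sum_j cabs (e i j) * xb)); last first.
    by rewrite -mulr_suml ler_wpM2r.
  apply: ler_sum => j _; rewrite cabsM cabs_real ler_wpM2l ?cabs_ge0//.
  apply: le_trans (x0_le j); have [hp1 _] := hp.
  rewrite -(subrK (x0 0 j) (p 0 j)) (le_trans (ler_normD _ _))// addrC lerD2l.
  exact: hp1.
apply: approx_ext (approx_le _ _ (approxD h2 h1)).
- move=> z _; rewrite coordE mulr1 mulr_sumr -big_split; apply: eq_bigr => j _ /=.
  rewrite mulrCA -mulrDr; congr (_ * _); rewrite -rmorphM -rmorphD; congr (_%:C).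
  by rewrite mulrC divfK ?gt_eqF// addrC subrK.
- rewrite !mulr1 cabs_real (gtr0_norm d0) /Ccoord mulrDr.
  by rewrite -[leLHS]add0r lerD// lerD.
rewrite mulr0 add0r cabs_real (gtr0_norm d0) mulrA ler_wpM2r//.
apply: (le_trans de); rewrite /Ccoord mulrDr.
by rewrite -[leLHS]add0r lerD// -[leLHS]add0r lerD// mulr_ge0.
Qed.

Lemma Lam_le_exp L : Lam L <= expR (s - 1) ^+ L.
Proof.
rewrite -expRM_natl expRM; apply: ge0_ler_powR.
- by rewrite subr_ge0.
- by rewrite nnegrE.
- by rewrite nnegrE expR_ge0.
- exact: natr_le_expR.
Qed.

(** With [N] coefficients per variable and truncation at order [N], a chart
    carries about [N ^ (s - 1)] cells per real dimension, each of which imposes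
    about [N] conditions per real dimension.  Hence about [N ^ (mu * s)]
    conditions are imposed on [N ^ n] coefficients. *)
Lemma thin_piece : thin [set z | piece (r z)].
Proof.
move=> A.
(* G comes from the Taylor remainders, P0 from the number and the size of the
   monomials of P; theta makes P0 * C2 * theta at most e ^ (- A). *)
pose G := b2 * d%:R * 2 ^+ d * C ^+ 2.
pose C2 := 4 * ((1 + G) * expR (s - 1)).
pose P0 := expR n%:R * (6 * Ccoord) ^+ n.
pose theta := expR (- Num.max A 0) / (16 * (P0 * C2)).
have G0 : 0 <= G by rewrite !mulr_ge0 ?exprn_ge0 ?C_ge0.
have E1 : 1 <= expR (s - 1) by rewrite -[leLHS]expR0 ler_expR subr_ge0.
have C21 : 1 <= C2.
  have : 1 * 1 <= (1 + G) * expR (s - 1) by rewrite ler_pM// lerDl.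
  rewrite /C2; lra.
have CC1 := Ccoord_ge1.
have P01 : 1 <= P0.
  rewrite -[leLHS]mulr1 ler_pM//; first by rewrite -expR0 ler_expR.
  by rewrite exprn_ege1//; lra.
have PC1 : 1 <= P0 * C2 by rewrite -[leLHS]mulr1 ler_pM.
have PC0 : 0 < P0 * C2 by apply: lt_le_trans PC1.
have PCt : 16 * (P0 * C2 * theta) = expR (- Num.max A 0).
  by rewrite /theta mulrA mulrC divfK// gt_eqF// mulr_gt0.
have th0 : 0 < theta by rewrite divr_gt0 ?expR_gt0// mulr_gt0.
have M1 : expR (- Num.max A 0) <= 1.
  by rewrite -expR0 ler_expR oppr_le0 le_max lexx orbT.
have MA : expR (- Num.max A 0) <= expR (- A).
  by rewrite ler_expR lerN2 le_max lexx.
have C2t0 : 0 <= C2 * theta by rewrite mulr_ge0 ?(ltW th0)// (le_trans _ C21).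
have C2t : C2 * theta <= 16^-1.
  have : C2 * theta <= P0 * C2 * theta by rewrite -mulrA ler_peMl.
  lra.
have th16 : theta <= 16^-1.
  by apply: le_trans C2t; rewrite ler_peMl ?(ltW th0).
have th4 : theta <= 4^-1 by lra.
pose b := 2 * b1 + 1; have bp : 0 < b by rewrite ltr_wpDl// mulr_ge0.
pose R1 := b3 * r0; have R10 : 0 <= R1 by rewrite mulr_ge0// ltW.
pose C4 := 2 * R1 * (b * C / (theta * q1 ^+ 4)).
have C40 : 0 <= C4.
  apply: mulr_ge0; first exact: mulr_ge0.
  apply: divr_ge0; first by apply: mulr_ge0; [exact: ltW|exact: C_ge0].
  by apply: mulr_ge0; [exact: ltW|rewrite exprn_ge0// ltW].
have g0 : 0 < n%:R - mu%:R * s by rewrite subr_gt0.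
(* C4 * Lam is a bound for the number of cells along each parameter. *)
have [N [N1 hN]] := exists_powR_gt ((C4 + 1) ^+ mu) g0.
exists N; split; first exact: ltnW.
have dN := delta_gt0 N1; have LN := Lam_gt0 N1.
pose w := theta * delta N / b.
have w0 : 0 < w by apply: divr_gt0 bp; exact: mulr_gt0.
have wE : 2 * R1 / w = C4 * Lam N.
  rewrite /w /C4; have := delta_CLam N1.
  have : 0 < C := C_gt0; move: (delta N) (Lam N) dN LN => D' L' D0 L0 C0 <-.
  by field; rewrite !gt_eqF.
pose q := (Num.trunc (2 * R1 / w)).+1.
have qR : q%:R <= (C4 + 1) * Lam N.
  rewrite (_ : q%:R = (Num.trunc (2 * R1 / w))%:R + 1); last by rewrite natr1.
  rewrite (mulrDl C4) mul1r lerD ?Lam_ge1// -wE truncn_le.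
  by apply: divr_ge0 (ltW w0); rewrite mulr_ge0.
pose u i (z : 'rV[R[i]]_n) := (lin Q i (r z - x0) + R1) / w.
have u_itv i z : piece (r z) -> 0 <= u i z /\ (Num.trunc (u i z) < q)%N.
  move=> [hz _]; have : `|lin Q i (r z - x0)| <= R1.
    apply: le_trans (ler_norm_sum _ _ _) _.
    apply: (@le_trans _ _ (\sum_l `|Q i l| * r0)).
      apply: ler_sum => l _; rewrite normrM ler_wpM2l// !mxE; exact: hz.
    by rewrite -mulr_suml ler_wpM2r// ltW.
  rewrite ler_norml => /andP[h1 h2]; split.
    by apply: divr_ge0 (ltW w0); lra.
  rewrite ltnS le_truncn// ler_pM2r ?invr_gt0//; lra.
pose S (g : {ffun 'I_mu -> 'I_q}) : set 'rV[R[i]]_n :=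
  [set z | piece (r z) /\ forall i, Num.trunc (u i z) = g i].
pose eta := G * Lam N * theta ^+ N.
pose omega := 2 * eta + 2 * theta ^+ N.
have tN0 : 0 <= theta ^+ N by rewrite exprn_ge0 ?ltW.
have G1N : 1 + G <= (1 + G) ^+ N.
  by rewrite -{1}[1 + G]expr1 ler_weXn2l ?lerDl// ltnW.
have eta0 : 0 <= eta.
  by apply: mulr_ge0 => //; apply: mulr_ge0 => //; exact: ltW.
have om0 : 0 <= omega by apply: addr_ge0; exact: mulr_ge0.
(* The factor Lam, of order N ^ (s - 1), is absorbed by the N-th power. *)
have omega_le : omega <= (C2 * theta) ^+ N.
  pose T := ((1 + G) * expR (s - 1)) ^+ N.
  have h1 : G * Lam N <= T.
    rewrite /T exprMn ler_pM ?Lam_le_exp ?(ltW LN)//.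
    by apply: le_trans G1N; rewrite lerDr.
  have h2 : 1 <= T.
    by rewrite exprn_ege1// -[leLHS]mulr1 ler_pM// lerDl.
  have h3 : 4 <= (4 : R) ^+ N.
    by rewrite -{1}[4]expr1 ler_weXn2l ?ler1n// ltnW.
  rewrite exprMn [C2 ^+ N]exprMn -/T.
  rewrite (_ : omega = 2 * (G * Lam N + 1) * theta ^+ N); last first.
    by rewrite /omega /eta; ring.
  rewrite ler_wpM2r//; apply: (@le_trans _ _ (4 * T)); first lra.
  by rewrite ler_wpM2r//; apply: le_trans h2.
have omega16 : omega <= 16^-1.
  apply: (le_trans omega_le); apply: (le_trans _ C2t).
  rewrite -[leRHS]expr1 ler_wiXn2l//; last exact: ltnW.
  by apply: (le_trans C2t); rewrite invf_le1// ler1n.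
have eta16 : eta <= 16^-1 by move: omega16; rewrite /omega; lra.
have hcell g : exists xi : 'rV[R[i]]_n -> 'rV[R[i]]_mu,
    (forall z i, S g z -> cabs (xi z 0 i) <= theta) /\
    (forall i, approx (S g) N xi Ccoord (Ccoord * omega) (fun z => z 0 i)).
  have [[z0 Sz0]|noS] := pselect (exists z, S g z); last first.
    exists (fun=> 0); split => [z i Sz|i]; first by case: noS; exists z.
    apply: (@approx_le _ _ _ _ _ _ 0 _ 0).
    - by apply: le_trans CC1.
    - by apply: mulr_ge0 => //; apply: le_trans CC1.
    - by apply: approx0 => z Sz; case: noS; exists z.
  have [hz0 gz0] := Sz0.
  have Sw z i : S g z -> `|lin Q i (r z - r z0)| <= w.
    move=> [hz gz]; have [uz _] := u_itv i z hz; have [uz0 _] := u_itv i z0 hz0.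
    have := truncn_eq_dist uz uz0; rewrite gz gz0 => /(_ erefl).
    have -> : u i z - u i z0 = lin Q i (r z - r z0) / w.
      rewrite /u -mulrBl; congr (_ / _); rewrite opprD addrACA subrr addr0.
      rewrite /lin -sumrB; apply: eq_bigr => l _; rewrite !mxE; ring.
    by rewrite normrM normfV (gtr0_norm w0) ler_pdivrMr// mul1r.
  exists (fun z => \row_i (b / delta N * lin Q i (r z - r z0))%:C); split.
    move=> z i Sz; rewrite mxE cabs_real normrM (gtr0_norm (divr_gt0 bp dN)).
    by rewrite mulrC mulrA ler_pdivrMr// -ler_pdivlMr//; exact: Sw.
  move=> i; apply: coord_approx => //.
  by move=> z [].
have [xi hxi] := choice hcell.
have [] := @small_on_cells R n N mu N theta Ccoord omega {ffun 'I_mu -> 'I_q} S xi N1.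
- by rewrite (ltW th0).
- exact: CC1.
- rewrite /omega; lra.
- by apply: (le_trans omega16); rewrite invf_le1// ler1n.
- by move=> g z i Sz; have [h _] := hxi g; exact: h.
- by move=> g i; have [_ h] := hxi g; exact: h.
- rewrite card_ffun !card_ord -expnMn -(ltr_nat R) !natrX.
  apply: (@le_lt_trans _ _ ((C4 + 1) ^+ mu * (N%:R `^ s) ^+ mu)).
    rewrite -exprMn lerXn2r ?nnegrE ?mulr_ge0 ?powR_ge0 ?addr_ge0//.
    rewrite natrM (_ : N%:R `^ s = Lam N * N%:R).
      by rewrite mulrA ler_wpM2r.
    have e1 : s = (s - 1) + 1 by rewrite subrK.
    rewrite {1}e1 powRD ?powRr1//.
    by rewrite pnatr_eq0 -lt0n (ltnW N1) implybT.
  rewrite -(powR_mulrn mu (powR_ge0 _ _)) -powRrM -(powR_mulrn n (ler0n _ _)).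
  rewrite -(subrK (mu%:R * s) n%:R) powRD; last first.
    by rewrite pnatr_eq0 -lt0n (ltnW N1) implybT.
  have NR : 0 < N%:R :> R by rewrite ltr0n ltnW.
  by rewrite [s * _]mulrC ltr_pM2r ?powR_gt0.
move=> c [c1 cmax csmall]; exists c; split => // z hz.
pose g : {ffun 'I_mu -> 'I_q} := [ffun i => inord (Num.trunc (u i z))].
have Sz : S g z.
  split => // i; rewrite ffunE inordK//.
  by have [_ h] := u_itv i z hz.
apply: (le_trans (csmall g z Sz)).
rewrite exprM -mulNr expRM_natr.
apply: (@le_trans _ _ ((expR n%:R ^+ N) * (((6 * Ccoord) ^+ n) ^+ N * (C2 * theta) ^+ N))).
  have C60 : 0 <= (6 * Ccoord) ^+ n by rewrite exprn_ge0// mulr_ge0// (le_trans _ CC1).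
  rewrite ler_pM ?exprn_ge0//.
  - by apply: mulr_ge0 => //; exact: exprn_ge0.
  - rewrite -expRM_natr mulrC expRM_natr lerXn2r ?nnegrE ?expR_ge0//.
    exact: natr_le_expR.
  - by apply: ler_wpM2l => //; exact: exprn_ge0.
have PCt0 : 0 <= P0 * C2 * theta by rewrite mulr_ge0 ?(ltW PC0) ?(ltW th0).
have E2 : expR n%:R * ((6 * Ccoord) ^+ n * (C2 * theta)) = P0 * C2 * theta.
  by rewrite !mulrA.
rewrite -!exprMn E2 lerXn2r ?nnegrE ?expR_ge0//.
by apply: le_trans MA; rewrite -PCt; lra.
Qed.

End Embedding.
End Chart.

(** * Covering the submanifold *)

Section LocalThinness.
Variable R : realType.

Lemma le_sum_term (I : finType) (F : I -> R) (i : I) :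
  (forall j, 0 <= F j) -> F i <= \sum_j F j.
Proof. by move=> F0; rewrite (bigD1 i)//= lerDl sumr_ge0. Qed.

Lemma nbhs_in_box d (x : 'rV[R]_d) (P : set 'rV[R]_d) : nbhs x P ->
  exists h : R, 0 < h /\ forall y, in_box h x y -> P y.
Proof.
move=> /nbhs_ballP[h /= h0 hP]; exists (h / 2); split; first by rewrite divr_gt0.
move=> y hy; apply: hP; split=> // i j; rewrite ord1 /ball/= distrC.
by apply: (le_lt_trans (hy j)); rewrite ltr_pdivrMr// ltr_pMr// ltr1n.
Qed.

Lemma compact_in_box d (x : 'rV[R]_d) (h : R) : compact [set y | in_box h x y].
Proof.
have := @rV_compact R d (fun j => `[x 0 j - h, x 0 j + h]%classic)
  (fun j => @segment_compact R _ _).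
by congr compact; apply/seteqP; split => y hy j; have := hy j;
  rewrite /= in_itv/= ler_distl.
Qed.

Lemma row_free_complement (F : fieldType) K d (J : 'M[F]_(K, d)) : row_free J ->
  exists mu (B : 'M[F]_(d, mu)) (Q : 'M[F]_(mu, d)) (D : 'M[F]_(d, K)),
    (K + mu <= d)%N /\ 1%:M = B *m Q + D *m J.
Proof.
move=> fJ; pose P := 1%:M - pinvmx J *m J.
have JP : J *m P = 0 by rewrite mulmxBr mulmx1 mulmxA mulmxVp// mul1mx subrr.
exists (\rank P), (col_base P), (row_base P), (pinvmx J); split.
  by have := mulmx0_rank_max JP; rewrite (eqP fJ).
by rewrite mulmx_base subrK.
Qed.

Section Thinness.
Variable n : nat.
Implicit Types E F M : set 'rV[R[i]]_n.

Lemma thin_sub E F : E `<=` F -> thin F -> thin E.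
Proof.
move=> EF hF A; have [N [N0 [c [c1 cmax cF]]]] := hF A.
by exists N; split => //; exists c; split => // z /EF /cF.
Qed.

Lemma thin_set0 : thin (set0 : set 'rV[R[i]]_n).
Proof.
move=> A; exists 1%N; split => //; exists (fun=> 1); split => //.
- by move=> beta; rewrite cabs1.
- by exists [ffun=> ord0]; rewrite cabs1.
Qed.

Lemma thin_origin : (0 < n)%N -> thin [set (0 : 'rV[R[i]]_n)].
Proof.
move=> n0 A; exists 2; split => //.
exists (fun beta => (beta == [ffun=> ord_max])%:R); split.
- by move=> beta; case: eqP => _; rewrite ?cabs1 ?cabs0.
- by exists [ffun=> ord_max]; rewrite eqxx cabs1.
move=> z ->; rewrite /peval big1 ?cabs0 ?expR_ge0// => beta _.
case: eqP => [->|_]; last by rewrite mul0r.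
rewrite (bigD1 (Ordinal n0))//= ffunE mxE expr1.
by rewrite mul0r mulr0.
Qed.

Lemma coord_realify (z : 'rV[R[i]]_n) i : z 0 i =
  \sum_j ((j == lshift n i)%:R + 'i * (j == rshift n i)%:R) * (realify z 0 j)%:C.
Proof.
rewrite big_split_ord/= (bigD1 i)//= [X in _ + X](bigD1 i)//=.
rewrite !eqxx eq_lrshift eq_rlshift !big1 ?addr0 => [|k /negPf ki|k /negPf ki].
- rewrite row_mxEl row_mxEr !mxE mulr0 mulr1 add0r addr0 mul1r.
  exact: complexE.
- by rewrite eq_rlshift eq_rshift ki mulr0 addr0 mul0r.
- by rewrite eq_lrshift eq_lshift ki mulr0 addr0 mul0r.
Qed.

(** The kernel of the Jacobian matrix at [p] provides at most [m] parameters, and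
    the box is chosen so small that the Jacobian matrix hardly varies on it. *)
Lemma locally_thin s m M p : 1 <= s -> gevrey_submanifold s m M ->
  m%:R * s < n%:R -> M p ->
  exists r0 : R, 0 < r0 /\ thin [set z | M z /\ in_box r0 (realify p) (realify z)].
Proof.
move=> s1 [mn hM] hdim /hM[U [rho [oU Up grho Jfree Mrho]]].
set x0 := realify p in Up *.
pose J := jacobian_mx rho x0.
have [mu [B [Q [D [Kmu split1]]]]] := row_free_complement (Jfree x0 Up).
pose d := (n + n)%N; have d0 : 0 <= d%:R + 1 :> R by rewrite addr_ge0.
pose b1 := \sum_j \sum_i `|B j i|; pose b2 := 1 + \sum_j \sum_k `|D j k|.
pose b3 := \sum_i \sum_l `|Q i l|.
have D0 : 0 <= \sum_j \sum_k `|D j k| by apply: sumr_ge0 => j _; exact: sumr_ge0.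
have b20 : 0 < b2 by rewrite ltr_pwDl.
pose kappa := 8^-1 / (b2 * (d%:R + 1)).
have bd0 : 0 < b2 * (d%:R + 1) by rewrite mulr_gt0// ltr_wpDl.
have kappa0 : 0 < kappa by rewrite divr_gt0// invr_gt0.
have [h [h0 hU]] : exists h : R, 0 < h /\ forall y, in_box h x0 y ->
    U y /\ forall kj : 'I_(n + n - m) * 'I_(n + n), `|'D_(delta_mx 0 kj.2) (rho kj.1) y - J kj.1 kj.2| <= kappa.
  apply: nbhs_in_box; apply: filterI; first exact: open_nbhs_nbhs.
  apply: (@filter_forall _ ('I_(n + n - m) * 'I_(n + n))%type
    (fun kj y => `|'D_(delta_mx 0 kj.2) (rho kj.1) y - J kj.1 kj.2| <= kappa)
    (nbhs x0)) => -[k j] /=.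
  have [+ _] := (grho k).1 [:: j] x0 Up => /cvgrPdist_le /(_ _ kappa0).
  by apply: filterS => y; rewrite distrC /J mxE.
pose r0 := h / 2; have r00 : 0 < r0 by rewrite divr_gt0.
have rr : r0 + r0 = h by rewrite -splitr.
have boxU y : in_box (r0 + r0) x0 y -> U y by rewrite rr => /hU[].
have gevrey_const k : exists c : R, 0 < c /\
    forall (alpha : 'I_(n + n) -> nat) y, in_box (r0 + r0) x0 y ->
    `|mderiv alpha (rho k) y| <= c ^+ (\sum_j alpha j).+1 * (mfact alpha)%:R `^ s.
  have [C0 C00 hC0] := (grho k).2 _ (@compact_in_box _ x0 (r0 + r0)) boxU.
  by exists C0; split.
have [C0 hC0] := choice gevrey_const.
pose C := 1 + \sum_k C0 k.
have C00 k : 0 <= C0 k by have [/ltW] := hC0 k.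
have CC0 k : C0 k <= C.
  by rewrite /C -[leLHS]add0r lerD// le_sum_term.
have C1 : 1 <= C by rewrite lerDl sumr_ge0.
pose a := b2 * (C ^+ 2 * 2 ^+ d).
have a0 : 0 <= a.
  by rewrite mulr_ge0 ?(ltW b20)// mulr_ge0 ?exprn_ge0// (le_trans _ C1).
pose q1 := Num.min (Num.min 2^-1 r0) (8^-1 / (a + 1)).
have a1 : 0 < a + 1 by rewrite ltr_wpDl.
have q10 : 0 < q1 by rewrite !lt_min invr_gt0 ltr0n r00 divr_gt0// invr_gt0.
have q1_2 : q1 <= 2^-1 by rewrite !ge_min lexx.
exists r0; split => //.
pose e i (j : 'I_(n + n)) : R[i] :=
  (j == lshift n i)%:R + 'i * (j == rshift n i)%:R.
apply: (@thin_sub _ [set z | piece rho x0 r0 (realify z)]).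
  move=> z [Mz hz]; split => //; apply/Mrho => //; apply: boxU.
  by apply: in_box_le hz; rewrite lerDl ltW.
apply: (@thin_piece R _ _ mu rho U x0 J B Q D s r0 C kappa b1 b2 q1 _ _ _ _ _
  _ _ _ _ _ _ _ _ _ _ _ _ n (@realify R n) e
  (\sum_i \sum_j cabs (e i j)) (\sum_j `|x0 0 j| + r0) b3) => //.
- exact: ltW.
- by move=> k; have [] := grho k.
- move=> k alpha y hy; have [_ h1] := hC0 k.
  apply: le_trans (h1 alpha y hy) _; rewrite ler_wpM2r ?powR_ge0//.
  by rewrite lerXn2r ?nnegrE ?CC0// (le_trans _ C1).
- by move=> k j y; rewrite rr => /hU[_ /(_ (k, j))].
- move=> j; apply: (@le_sum_term _ (fun j => \sum_i `|B j i|)) => j'.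
  exact: sumr_ge0.
- move=> j; rewrite /b2 -[leLHS]add0r lerD//.
  by apply: (@le_sum_term _ (fun j => \sum_k `|D j k|)) => j'; exact: sumr_ge0.
- by apply: sumr_ge0 => j _; exact: sumr_ge0.
- exact: ltW.
- rewrite mulrA /kappa mulrCA ler_piMr// ler_pdivrMr// mul1r.
  by rewrite ler_wpM2l ?(ltW b20)// lerDl.
- rewrite mulrA -/a; apply: (@le_trans _ _ (a * q1)).
    by rewrite ler_wpM2l// expr2 ler_piMr ?(ltW q10)// (le_trans q1_2)// invf_le1// ler1n.
  apply: (@le_trans _ _ (a * (8^-1 / (a + 1)))).
    by rewrite ler_wpM2l// !ge_min lexx !orbT.
  by rewrite mulrCA ler_piMr// ler_pdivrMr// mul1r lerDl.
- exact: coord_realify.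
- move=> i; apply: (@le_sum_term _ (fun i => \sum_j cabs (e i j))) => i'.
  by apply: sumr_ge0 => j _; exact: cabs_ge0.
- by move=> j; rewrite lerD2r; apply: (@le_sum_term _ (fun j => `|x0 0 j|)).
- move=> i; apply: (@le_sum_term _ (fun i => \sum_l `|Q i l|)) => i'.
  exact: sumr_ge0.
- by apply: sumr_ge0 => i _; apply: sumr_ge0 => j _; exact: cabs_ge0.
- by rewrite addr_ge0 ?sumr_ge0// ltW.
- by apply: sumr_ge0 => j _; exact: sumr_ge0.
- by rewrite !ge_min lexx orbT.
apply: le_lt_trans hdim; rewrite ler_wpM2r ?(le_trans _ s1)// ler_nat.
by rewrite -(leq_add2l (n + n - m)) subnK.
Qed.

Lemma pluripolar_sub E F : E `<=` F -> pluripolar F -> pluripolar E.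
Proof.
by move=> EF [phi [psh nc phiF]]; exists phi; split => // z /EF /phiF.
Qed.

(** Boxes centred at points with rational coordinates of common denominator, so
    that there are countably many of them. *)
Definition lattice_box (cN : {ffun 'I_(n + n) -> int} * nat) : set 'rV[R[i]]_n :=
  [set z | forall j, `|realify z 0 j - (cN.1 j)%:~R / cN.2.+1%:R| <= cN.2.+1%:R^-1].

Lemma exists_lattice_box (p : 'rV[R[i]]_n) (h : R) : 0 < h ->
  exists cN, lattice_box cN p /\
    lattice_box cN `<=` [set z | in_box h (realify p) (realify z)].
Proof.
move=> h0; pose N := Num.trunc (2 / h); have N0 : 0 < N.+1%:R :> R by rewrite ltr0n.
pose c := [ffun j => Num.floor (realify p 0 j * N.+1%:R)].
have hp : lattice_box (c, N) p.
  move=> j; rewrite /= ffunE -[X in `|X - _|](mulfK (lt0r_neq0 N0)) -mulrBl.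
  rewrite normrM normfV (gtr0_norm N0) ler_piMl ?invr_ge0 ?(ltW N0)//.
  have /andP[h1 h2] := floor_itv (realify p 0 j * N.+1%:R).
  rewrite intrD in h2; rewrite ger0_norm ?subr_ge0//; lra.
exists (c, N); split => // z hz j.
have hN : N.+1%:R^-1 <= h / 2.
  rewrite -[leRHS]invrK lef_pV2 ?posrE ?invr_gt0 ?divr_gt0// invf_div.
  exact: ltW (truncnS_gt _).
have := hz j; have := hp j; rewrite /=; set t := _ / _ => h1 h2.
rewrite -(subrK t (realify z 0 j)) -addrA (le_trans (ler_normD _ _))//.
rewrite [X in _ + X]distrC (splitr h) lerD// (le_trans _ hN)//.
Qed.

Lemma locally_thin_pluripolar M : (0 < n)%N ->
  (forall p, M p -> exists h : R,
    0 < h /\ thin [set z | M z /\ in_box h (realify p) (realify z)]) ->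
  pluripolar M.
Proof.
move=> n0 hM.
pose T : countType := ({ffun 'I_(n + n) -> int} * nat)%type.
(* Boxes in which M is not thin are left out.  The origin is added, lest the
   union be empty. *)
pose E (k : nat) : set 'rV[R[i]]_n := if k is k'.+1 then
    [set z | exists cN : T, [/\ unpickle k' = Some cN,
      thin (M `&` lattice_box cN) & (M `&` lattice_box cN) z]]
  else [set 0].
apply: (@pluripolar_sub _ (\bigcup_k E k)).
  move=> p Mp; have [h [h0 thinh]] := hM p Mp.
  have [cN [hp hcN]] := exists_lattice_box p h0.
  exists (pickle (cN : T)).+1 => //; exists cN; split => //.
    exact: pickleK.
  by apply: thin_sub thinh => z [Mz /hcN].
apply: thin_bigcup_pluripolar; last by exists 0%N; exists 0.
case=> [|k]; first exact: thin_origin.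
have [[cN [ek thincN]]|no] := pselect (exists cN : T,
    unpickle k = Some cN /\ thin (M `&` lattice_box cN)).
  by apply: thin_sub thincN => z [cN' [+ _ Mz]]; rewrite ek => -[->].
apply: thin_sub thin_set0 => z [cN [ek thincN _]]; apply: no.
by exists cN.
Qed.

End Thinness.
End LocalThinness.

Unset Implicit Arguments.

Theorem theorem1p1 (R : realType) (n m : nat) (s : R) (M : set 'rV[R[i]]_n)
    (hs : 1 <= s) (hM : gevrey_submanifold s m M) (hreal : totally_real M)
    (hdim : m%:R * s < n%:R) :
  pluripolar M.
Proof.
apply: locally_thin_pluripolar => [|p Mp].
  rewrite -(ltr0n R); apply: le_lt_trans hdim.
  by rewrite mulr_ge0// (le_trans _ hs).
exact: locally_thin hs hM hdim Mp.
Qed.
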